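(* Let $\lambda,\mu\in\Lambda_n$, $x\in\mathfrak R(\lambda)$, $y\in\mathfrak R(\mu)$. Then $x\le_{\mathcal{LR}}y$ if and only if $\mu\trianglelefteq\lambda$. In particular $w_\lambda\le_{\mathcal{LR}}w_\mu$ iff $\mu\trianglelefteq\lambda$, and the sets $\mathfrak R(\lambda)$, $\lambda\in\Lambda_n$, are precisely the two-sided cells of $\mathfrak S_n$.
   Context: Let $W=\mathfrak S_n$ with Coxeter generators $s_i=(i,i+1)$, $1\le i<n$, length $l$, $\varepsilon_w=(-1)^{l(w)}$. $A=\mathbb Z[v,v^{-1}]$, $\bar{\ }$ the involution $v\mapsto v^{-1}$. $\mathcal H$ is the Iwahori–Hecke algebra over $A$ with basis $\{T_w\}$, $T_sT_w=T_{sw}$ if $l(sw)>l(w)$ and $T_sT_w=T_{sw}+(v-v^{-1})T_w$ otherwise. The involution $\overline{\sum a_wT_w}=\sum\bar a_wT_{w^{-1}}^{-1}$; $C_w$ (resp. $C'_w$) is the unique bar-invariant element with $C_w-T_w\in\sum_y v\mathbb Z[v]T_y$ (resp. $C'_w-T_w\in\sum_y v^{-1}\mathbb Z[v^{-1}]T_y$). Define $h_{x,y,z}$ by $C'_xC'_y=\sum_z h_{x,y,z}C'_z$. Write $x\leftarrow_{\mathcal L}y$ if $h_{s,y,x}\ne0$ for some generator $s$; $\le_{\mathcal L}$ is its reflexive–transitive closure; $x\le_{\mathcal R}y$ iff $x^{-1}\le_{\mathcal L}y^{-1}$; $\le_{\mathcal{LR}}$ is the pre-order generated by $\le_{\mathcal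 L}$ and $\le_{\mathcal R}$; the classes of the associated equivalence $\sim_{\mathcal{LR}}$ are the two-sided cells. $\Lambda_n$ = partitions of $n$ with dominance order $\trianglelefteq$ (partial sums). $\mathfrak S_\lambda$ is the Young subgroup generated by the $s_k$ with $k\notin\{\lambda_1+\dots+\lambda_i\}$, $w_\lambda$ its longest element. Over $K=\mathbb R(v)$, the irreducible characters $\chi_\lambda$ of $\mathcal H_K$ are labelled so that the character induced from the sign representation $T_u\mapsto\varepsilon_uv^{-l(u)}$ of the parabolic subalgebra of $\mathfrak S_\lambda$ equals $\chi_\lambda$ plus a sum of $\chi_\mu$ with $\lambda\triangleleft\mu$; $d_\lambda=\chi_\lambda(T_1)$, $a(\lambda)=l(w_\lambda)$. Let $\mathcal O$ be the localization of $\mathbb R[v]$ at $(v)$. For each $\lambda$ fix an orthogonal matrix representation $\mathfrak X_\lambda$ affording $\chi_\lambda$ (i.e. $\mathfrak X_\lambda(T_{w^{-1}})=P^{-1}\mathfrak X_\lambda(T_w)^{tr}P$ with $P$ invertible diagonal, entries in $1+v\mathbb R[v]$); the constant term at $v=0$ of $v^{a(\lambda)}\mathfrak X^{ij}_\lambda(T_w)\in\mathcal O$ is written $\varepsilon_wc^{ij}_{w,\lambda}$, and the $\mathfrak X_\lambda$ are chosen with all $c^{ij}_{w,\lambda}\in\mathbb Z$. Then for each $\lambda$ and $1\le i,j\le d_\lambda$ there is a unique $w=\mathbf w_\lambda(i,j)$ with $c^{ij}_{w,\lambda}\ne0$, these give a bijection onto $\mathfrak S_n$, and $\mathfrak R(\lambda):=\{\mathbf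 w_\lambda(i,j)\}$; so $\mathfrak S_n=\coprod_\lambda\mathfrak R(\lambda)$, and $w_\lambda\in\mathfrak R(\lambda)$. *)

(* Defs.v *)
From HB Require Import structures.
From mathcomp Require Import all_boot all_order all_algebra all_fingroup.
From mathcomp Require Import reals.
From Stdlib Require Import ClassicalEpsilon.

Set Implicit Arguments.
Unset Strict Implicit.
Unset Printing Implicit Defensive.

Import GRing.Theory Num.Theory.
Local Open Scope ring_scope.

Section Hecke.
Variable R : realType.
Variable n : nat.

Definition K := {fraction {poly R}}.
HB.instance Definition _ := GRing.Field.copy K {fraction {poly R}}.
Definition vK : K := tofrac 'X.
Definition pK (c : R) : K := tofrac (c%:P).

Definition len (w : 'S_n) : nat :=
  #|[set p : 'I_n * 'I_n | (p.1 < p.2)%N && (w p.2 < w p.1)%N]|.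

Definition eps (w : 'S_n) : K := (-1) ^+ len w.

Definition Sgen : {set 'S_n} :=
  [set tperm p.1 p.2 | p : 'I_n * 'I_n & (p.2 : nat) == p.1.+1].

(* elements of the Hecke algebra H_K = sum_w a_w T_w, as coefficient functions *)
Local Notation Hk := {ffun 'S_n -> K}.
Definition scH (c : K) (h : Hk) : Hk := [ffun y => c * h y].
Definition Tb (w : 'S_n) : Hk := [ffun y => (y == w)%:R].

(* left multiplication by T_s :  T_s T_w = T_{sw} (l(sw)>l(w)),
   T_{sw} + (v - v^-1) T_w otherwise *)
Definition mulT (s : 'S_n) (h : Hk) : Hk :=
  [ffun y => h (s * y)%g + (if (len (s * y)%g < len y)%N then (vK - vK^-1) * h y else 0)].

(* left multiplication by T_x, via T_x = T_s T_{sx} for a left descent s of x *)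
Fixpoint Tleft (k : nat) (x : 'S_n) (h : Hk) : Hk :=
  match k with
  | 0 => h
  | k'.+1 =>
      match [pick s in Sgen | (len (s * x)%g < len x)%N] with
      | Some s => mulT s (Tleft k' (s * x)%g h)
      | None => h
      end
  end.

Definition mulH (h1 h2 : Hk) : Hk := \sum_(x : 'S_n) scH (h1 x) (Tleft (len x) x h2).

(* T_{w^-1}^{-1} = T_{s}^{-1} T_{(sw)^-1}^{-1} for a left descent s of w,
   with T_s^{-1} = T_s - (v - v^-1) *)
Fixpoint Tinvinv (k : nat) (w : 'S_n) : Hk :=
  match k with
  | 0 => Tb 1%g
  | k'.+1 =>
      match [pick s in Sgen | (len (s * w)%g < len w)%N] with
      | Some s => mulT s (Tinvinv k' (s * w)%g) - scH (vK - vK^-1) (Tinvinv k' (s * w)%g)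
      | None => Tb 1%g
      end
  end.

Definition evinv (p : {poly R}) : K := (map_poly pK p).[vK^-1].
Definition barK (f : K) : K := evinv (generic_quotient.repr f).1 / evinv (generic_quotient.repr f).2.

Definition barH (h : Hk) : Hk := \sum_(w : 'S_n) scH (barK (h w)) (Tinvinv (len w) w).

Definition negA (a : K) : Prop :=
  exists p : {poly int}, p`_0 = 0 /\ a = (map_poly (fun z : int => z%:~R : K) p).[vK^-1].

(* C'_w : the unique bar-invariant element with C'_w - T_w in sum v^-1 Z[v^-1] T_y *)
Definition isCp (w : 'S_n) (h : Hk) : Prop :=
  barH h = h /\ forall y, negA (h y - Tb w y).
Definition Cp (w : 'S_n) : Hk := epsilon (inhabits (0 : Hk)) (isCp w).

Definition hcoefs (x y : 'S_n) : {ffun 'S_n -> K} :=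
  epsilon (inhabits (0 : {ffun 'S_n -> K}))
    (fun c => mulH (Cp x) (Cp y) = \sum_(z : 'S_n) scH (c z) (Cp z)).
Definition hxyz (x y z : 'S_n) : K := hcoefs x y z.

Definition edgeL : rel 'S_n := fun x y => [exists s in Sgen, hxyz s y x != 0].
Definition leL (x y : 'S_n) : bool := connect edgeL x y.
Definition leR (x y : 'S_n) : bool := leL x^-1%g y^-1%g.
Definition leLR (x y : 'S_n) : bool := connect (fun a b => leL a b || leR a b) x y.
Definition eqLR (x y : 'S_n) : bool := leLR x y && leLR y x.
Definition LRcell (x : 'S_n) : {set 'S_n} := [set y | eqLR x y].

Definition Part := {ffun 'I_n -> 'I_n.+1}.
HB.instance Definition _ := Finite.copy Part {ffun 'I_n -> 'I_n.+1}.
Definition ispart (l : Part) : bool :=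
  [forall i : 'I_n, forall j : 'I_n, (i <= j)%N ==> (l j <= l i)%N]
  && ((\sum_(i < n) (l i : nat))%N == n).
Definition psum (l : Part) (k : nat) : nat := (\sum_(i < n | (i < k)%N) (l i : nat))%N.
Definition dominates (mu l : Part) : bool := [forall k : 'I_n.+1, (psum mu k <= psum l k)%N].
Definition sdom (mu l : Part) : bool := dominates mu l && (mu != l).

Definition ysgens (l : Part) : {set 'S_n} :=
  [set tperm p.1 p.2 | p : 'I_n * 'I_n &
     ((p.2 : nat) == p.1.+1) && ~~ [exists i : 'I_n, (p.2 : nat) == psum l i.+1]].
Definition youngS (l : Part) : {group 'S_n} := <<ysgens l>>%G.
Definition wlong (l : Part) : 'S_n := [arg max_(w > 1%g in youngS l) len w]%O.
Definition aval (l : Part) : nat := len (wlong l).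

(* character of the module induced from the sign representation
   T_u |-> eps_u v^{-l(u)} of the parabolic subalgebra H_lambda:
   basis T_d (x) 1, d minimal left coset representatives of S_n / S_lambda *)
Definition Dmin (l : Part) : {set 'S_n} :=
  [set d | [forall u in youngS l, len d <= len (d * u)%g]%N].
Definition indchar (l : Part) (w : 'S_n) : K :=
  \sum_(d in Dmin l) \sum_(u in youngS l)
     mulH (Tb w) (Tb d) (d * u)%g * (eps u * vK ^- len u).

Definition isRep (d : nat) (X : 'S_n -> 'M[K]_d) : Prop :=
  X 1%g = 1%:M /\
  forall x y, \sum_(z : 'S_n) mulH (Tb x) (Tb y) z *: X z = X x *m X y.
Definition irrRep (d : nat) (X : 'S_n -> 'M[K]_d) : Prop :=
  isRep X /\ (0 < d)%N /\
  forall m (U : 'M[K]_(m, d)), (forall w, (U *m X w <= U)%MS) ->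
     (\rank U == 0)%N || row_full U.
Definition orthoRep (d : nat) (X : 'S_n -> 'M[K]_d) : Prop :=
  exists P : 'M[K]_d,
    (forall i j, i != j -> P i j = 0) /\
    (forall i, exists f : {poly R}, f.[0] = 1 /\ P i i = tofrac f) /\
    P \in unitmx /\
    forall w, X w^-1%g = invmx P *m (X w)^T *m P.

Definition ct (f : K) : R :=
  epsilon (inhabits (0 : R)) (fun c => exists p q : {poly R},
     q.[0] != 0 /\ f = tofrac p / tofrac q /\ c = p.[0] / q.[0]).

Section Reps.
Variable dim : Part -> nat.
Variable X : forall l : Part, 'S_n -> 'M[K]_(dim l).

Definition chi (l : Part) (w : 'S_n) : K := \tr (X l w).

Definition cco (l : Part) (w : 'S_n) (i j : 'I_(dim l)) : R :=
  (-1) ^+ len w * ct (vK ^+ aval l * X l w i j).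

Arguments cco : clear implicits.

Definition chosen_reps : Prop :=
  (forall l, ispart l -> irrRep (X l)) /\
  (* labelling: Ind(sign) = chi_lambda + sum of chi_mu with lambda <| mu, mu <> lambda *)
  (forall l, ispart l -> exists m : Part -> nat, forall w,
      indchar l w = chi l w +
        \sum_(mu : Part | ispart mu && sdom l mu) (m mu)%:R * chi mu w) /\
  (forall l, ispart l -> orthoRep (X l)) /\
  (forall (l : Part) (w : 'S_n) (i j : 'I_(dim l)), ispart l -> exists z : int, cco l w i j = z%:~R).

(* R(lambda) = { w_lambda(i,j) } = { w | c^{ij}_{w,lambda} <> 0 for some i j } *)
Definition Rset (l : Part) : {set 'S_n} :=
  [set w | [exists i, exists j, cco l w i j != 0]].
End Reps.

End Hecke.

(* Main.v *)
Require Import Defs.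
From HB Require Import structures.
From mathcomp Require Import all_boot all_order all_algebra all_fingroup.
From mathcomp Require Import reals.
From mathcomp Require Import zify ring.
From Stdlib Require Import ClassicalEpsilon.

Set Implicit Arguments.
Unset Strict Implicit.
Unset Printing Implicit Defensive.

Import GRing.Theory Num.Theory.
Local Open Scope ring_scope.

(* Let [Q_l] be the (quasi-idempotent) sign sum of the parabolic subalgebra of [l]; up to a power of
   [v] it is [C_(w_l)]. A Gale-Ryser count of [Q_l H Q'_k], with [Q'_k] the index sum for the conjugate
   of [k], shows that [X_m Q_l] vanishes unless [l] is dominated by [m], and has rank one for [m = l].
   Since the trace form is positive, the X_m are then jointly faithful and pairwise inequivalent, and
   Schur's relations hold with Schur elements [v^(-2 a(m)) (1 + O(v))]. Hence the integral leading
   coefficients are orthonormal vectors, which gives the bijection [w_m(i,j)].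

   Let [N_m] be the ideal of elements killed by all [X_k] with [m] not dominated by [k]. For
   [z = w_m(i,i0)] and [z' = w_m(i0,j)] the product [C_z C_z'] is a scalar multiple of a bar-invariant
   element [B] of [N_m] with leading coefficient at [(i,j)] only. A bar-invariant Laurent polynomial with
   neither constant term nor pole at [0] is zero, so, by descending induction on dominance, [B] is a
   multiple of [C_(w_m(i,j))] modulo bigger partitions; thus [C_y] lies in [N_m] and [y <= w_m] for all
   [y] in [R(m)]. Since [N_m] is an ideal, [x <= y] implies the dominance relation. Conversely, if
   [X_l C_y <> 0] then the rank one element [X_l Q_l] is a multiple of some [X_l (h C_y h')], so
   [w_l <= y]; and [X_l Q_m <> 0] for [m] dominated by [l], because the sign-isotypic vectors of a
   Young subgroup survive moving one box at a time, by positivity of the invariant form. *)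

(** * Lengths and parabolic subgroups of the symmetric group *)

(** Everything is tested at [v = 0], where the residue field is formally real; this replaces any
    positivity of Kazhdan-Lusztig coefficients. It is also why the proof runs on [C_w] although the
    preorder is defined by [C'_w]: the coefficients of [C_w - T_w] vanish at [v = 0], so [X_l(C_w)]
    and [X_l(T_w)] have the same leading coefficients. The semilinear map [jH] translates between
    the two bases. The shaping obstacle is that the matrices [X_l] are known only through the
    labelling by induced characters. That they are inequivalent and exhaustive has to be derived,
    and [R(v)] is not algebraically closed, so Schur's lemma does not give scalars for free; the
    rank one matrix [X_l(Q_l)] supplies the missing eigenline. A second obstacle is that bar does
    not act on the matrices [X_l]. It acts on coordinates in the basis [C], and the bijection
    [w_m(i,j)] allows each coordinate to be read off from one matrix position at [v = 0]. This is
    how vanishing of leading coefficients becomes vanishing of bar-invariant coordinates. *)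

Section Length.
Variable n : nat.
Implicit Types (s t w y d u : 'S_n) (i j k : 'I_n).

Definition adj i j := (j : nat) == i.+1.
(** Permutations are multiplied left to right, [(s * w) x = w (s x)]. So left multiplication by a
    generator exchanges positions and right multiplication exchanges values. *)
Definition desc s w := (len (s * w)%g < len w)%N.
Definition rdesc w s := (len (w * s)%g < len w)%N.

Lemma SgenP s : reflect (exists i j, adj i j /\ s = tperm i j) (s \in Sgen n).
Proof.
apply: (iffP imsetP) => [[[i j]]|[i [j [aij ->]]]].
  by rewrite inE /= => aij ->; exists i, j.
by exists (i, j); rewrite // inE.
Qed.

Lemma sgenV s : s \in Sgen n -> (s^-1)%g = s.
Proof. by case/SgenP=> i [j [_ ->]]; rewrite tpermV. Qed.

Lemma sgenK s w : s \in Sgen n -> (s * (s * w) = w)%g.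
Proof. by case/SgenP=> i [j [_ ->]]; rewrite mulgA tperm2 mul1g. Qed.

Lemma sgenKr s w : s \in Sgen n -> (w * s * s = w)%g.
Proof. by case/SgenP=> i [j [_ ->]]; rewrite -mulgA tperm2 mulg1. Qed.

Lemma adj_neq i j : adj i j -> i != j.
Proof. by move=> /eqP aij; apply/eqP=> ij; move: aij; rewrite ij; lia. Qed.

Lemma tperm_adj_lt i j (a b : 'I_n) : adj i j ->
  (a < b)%N -> (tperm i j a < tperm i j b)%N = ~~ ((a == i) && (b == j)).
Proof.
move=> /eqP aij ab; rewrite !permE /=.
have [ai|ai] := eqVneq a i; have [bj|bj] := eqVneq b j => /=.
- by rewrite ai bj in ab *; case: ifP => [/eqP e|_]; move: aij; rewrite ?e; lia.
- rewrite ai in ab *; case: ifP => [/eqP e|_]; first by move: ab; rewrite e; lia.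
  by move: bj; rewrite -val_eqE /=; lia.
- rewrite bj in ab *; case: (eqVneq a j) => [e|_]; first by move: ab; rewrite e; lia.
  case: ifP => [/eqP e|_]; first by move: aij; rewrite e; lia.
  by move: ai; rewrite -val_eqE /=; lia.
- move: ai bj; rewrite -!val_eqE /= => ai bj.
  case: ifP => [/eqP e|_]; case: ifP => [/eqP e'|_].
  + by move: ab; rewrite e e' aij ltnNge leqnSn.
  + by rewrite e aij in ab; rewrite (ltnW ab).
  + by rewrite e' in ab; rewrite aij ltnW.
  + by rewrite ab.
Qed.

(** An adjacent transposition keeps the order of every pair other than [(i, j)]. Applied to both
    entries it therefore matches the inversions of [w] with those of the product, [(i, j)] itself
    being the only new one. *)
Lemma len_ascl i j w : adj i j -> (w i < w j)%N ->
  len (tperm i j * w)%g = (len w).+1.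
Proof.
move=> aij wij; rewrite /len.
set A := [set p | _]; set B := [set p | _].
have ijA : (i, j) \in A.
  by rewrite inE /= !permM tpermL tpermR wij andbT; move/eqP: aij => ->.
rewrite (cardsD1 (i, j)) ijA add1n; congr _.+1.
pose f (p : 'I_n * 'I_n) := (tperm i j p.1, tperm i j p.2).
have fi : injective f by move=> [a b] [c d'] [/perm_inj -> /perm_inj ->].
rewrite -(card_imset _ fi); congr #|pred_of_set _|; apply/setP=> -[a b].
apply/imsetP/idP => [[[c e]] | ].
  rewrite !inE /= !permM xpair_eqE => h; case/andP: h => ne h; case/andP: h => ce we.
  by rewrite /f /= => -[-> ->]; rewrite tperm_adj_lt // ne.
rewrite inE /= => /andP[ab wab]; exists (tperm i j a, tperm i j b); last first.
  by rewrite /f /= !tpermK.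
have nij : ~~ ((a == i) && (b == j)).
  by apply/negP=> /andP[/eqP ai /eqP bj]; move: wab wij; rewrite ai bj; lia.
rewrite !inE /= !permM !tpermK wab tperm_adj_lt // nij !andbT.
rewrite ?eqb_id; apply/eqP=> -[h1 h2].
have ea : a = j by rewrite -(tpermK i j a) h1 tpermL.
have eb : b = i by rewrite -(tpermK i j b) h2 tpermR.
by move: ab; rewrite ea eb; move/eqP: aij => ->; lia.
Qed.

Lemma descE i j w : adj i j -> desc (tperm i j) w = (w j < w i)%N.
Proof.
move=> aij; rewrite /desc; case: (ltngtP (w i) (w j)) => wij.
- by rewrite len_ascl //; apply/negbTE; rewrite -leqNgt leqW.
- rewrite -{2}(sgenK (s := tperm i j) w); last by apply/SgenP; exists i, j.
  by rewrite (len_ascl (w := (tperm i j * w)%g)) ?leqnn // !permM tpermL tpermR.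
- by move/val_inj/perm_inj: wij => ij; move: (adj_neq aij); rewrite ij eqxx.
Qed.

Lemma len_asc s w : s \in Sgen n -> ~~ desc s w -> len (s * w)%g = (len w).+1.
Proof.
case/SgenP=> i [j [aij ->]]; rewrite descE // -leqNgt leq_eqVlt.
case/orP=> [/eqP/val_inj/perm_inj ij|]; last exact: len_ascl.
by move: (adj_neq aij); rewrite ij eqxx.
Qed.

Lemma desc_mul s w : s \in Sgen n -> desc s (s * w)%g = ~~ desc s w.
Proof.
move=> sS; rewrite {1}/desc sgenK //; case: (boolP (desc s w)) => [dw|ndw].
  by apply/negbTE; move: dw; rewrite /desc; lia.
by rewrite len_asc // leqnn.
Qed.

Lemma len_desc s w : s \in Sgen n -> desc s w -> len w = (len (s * w)%g).+1.
Proof.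
move=> sS dw; rewrite -{1}(sgenK w sS) len_asc //.
by rewrite desc_mul // dw.
Qed.

Lemma lenV w : len (w^-1)%g = len w.
Proof.
rewrite /len; set A := [set p | _]; set B := [set p | _].
pose f (p : 'I_n * 'I_n) := (w p.2, w p.1).
have fi : injective f by move=> [a b] [c d'] [/perm_inj -> /perm_inj ->].
rewrite -[RHS](card_imset _ fi); congr #|pred_of_set _|; apply/setP=> -[a b].
apply/idP/imsetP => [|[[c e]]].
  rewrite inE /= => /andP[ab wab].
  by exists ((w^-1)%g b, (w^-1)%g a); rewrite ?inE /f /= !permKV ?wab.
by rewrite !inE /= => /andP[ce we] [-> ->]; rewrite !permK we ce.
Qed.

Lemma len1 : len (1 : 'S_n)%g = 0%N.
Proof.
by apply/eqP; rewrite cards_eq0; apply/eqP/setP=> -[a b]; rewrite !inE /= !perm1; lia.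
Qed.

Lemma lenMV s w : s \in Sgen n -> len (w * s)%g = len (s * w^-1)%g.
Proof. by move=> sS; rewrite -lenV invMg (sgenV sS). Qed.

Lemma rdescV w s : s \in Sgen n -> rdesc w s = desc s (w^-1)%g.
Proof. by move=> sS; rewrite /rdesc /desc (lenMV w sS) lenV. Qed.

Lemma descV w s : s \in Sgen n -> desc s w = rdesc (w^-1)%g s.
Proof. by move=> sS; rewrite rdescV // invgK. Qed.

Lemma rdescE i j w : adj i j -> rdesc w (tperm i j) = ((w^-1)%g j < (w^-1)%g i)%N.
Proof.
by move=> aij; rewrite rdescV ?descE //; apply/SgenP; exists i, j.
Qed.

Lemma len_rasc s w : s \in Sgen n -> ~~ rdesc w s -> len (w * s)%g = (len w).+1.
Proof. by move=> sS; rewrite rdescV // lenMV // => /len_asc-> //; rewrite lenV. Qed.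

Lemma rdesc_mul s w : s \in Sgen n -> rdesc (w * s)%g s = ~~ rdesc w s.
Proof. by move=> sS; rewrite !rdescV // invMg (sgenV sS) desc_mul. Qed.

Lemma len_rdesc s w : s \in Sgen n -> rdesc w s -> len w = (len (w * s)%g).+1.
Proof.
move=> sS; rewrite rdescV // => /(len_desc sS).
by rewrite lenV (lenMV w sS).
Qed.

(* Right multiplication by [t = (k, k+1)] only exchanges the values [k] and [k+1]. *)
Lemma desc_mulr s t y : s \in Sgen n -> t \in Sgen n -> (s * y != y * t)%g ->
  desc s (y * t)%g = desc s y.
Proof.
case/SgenP=> i [j [aij ->]] /SgenP[k [l [akl ->]]] ne.
rewrite !descE // !permM.
have [lt|gt|/val_inj/perm_inj e] := ltngtP (y j) (y i); last 1 first.
- by move: (adj_neq aij); rewrite e eqxx.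
- rewrite tperm_adj_lt //; apply/negP=> /andP[/eqP yj /eqP yi].
  move/eqP: ne; apply; apply/permP=> x; rewrite !permM -yj -yi.
  rewrite (tpermC (y j)); case: (tpermP i j x) => [->|->|].
  + by rewrite tpermL.
  + by rewrite tpermR.
  + by move=> /eqP xi /eqP xj; rewrite tpermD // inj_eq 1?eq_sym //; exact: perm_inj.
- apply/negbTE; rewrite -leqNgt ltnW // tperm_adj_lt //.
  apply/negP=> /andP[/eqP yi /eqP yj].
  move/eqP: ne; apply; apply/permP=> x; rewrite !permM -yj -yi.
  case: (tpermP i j x) => [->|->|].
  + by rewrite tpermL.
  + by rewrite tpermR.
  + by move=> /eqP xi /eqP xj; rewrite tpermD // inj_eq 1?eq_sym //; exact: perm_inj.
Qed.

Lemma rdesc_mull s t y : s \in Sgen n -> t \in Sgen n -> (s * y != y * t)%g ->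
  rdesc (s * y)%g t = rdesc y t.
Proof.
move=> sS tS ne; rewrite !rdescV // invMg (sgenV sS) desc_mulr //.
by apply: contraNneq ne => e; rewrite -(inj_eq invg_inj) !invMg (sgenV sS) (sgenV tS) e.
Qed.

End Length.

(** * Parabolic subgroups given by blocks, and their minimal coset representatives *)

Section Blocks.
Variables (n : nat) (b : 'I_n -> nat).
Hypothesis b_mono : forall i j : 'I_n, (i <= j)%N -> (b i <= b j)%N.
Implicit Types (s t w y d u : 'S_n) (i j k : 'I_n).

(** Parabolic subgroups are described by a weakly increasing block function [b] rather than by a
    partition, so that the row blocks [bpart] and the column blocks [bcol] share one theory. *)
Definition bgens : {set 'S_n} :=
  [set tperm p.1 p.2 | p : 'I_n * 'I_n & adj p.1 p.2 && (b p.1 == b p.2)].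

Definition bgrp_set : {set 'S_n} := [set w : 'S_n | [forall k, b (w k) == b k]].

Lemma bgrpP w : reflect (forall k, b (w k) = b k) (w \in bgrp_set).
Proof. by rewrite inE; apply: (iffP forallP) => h k; apply/eqP/h. Qed.

Lemma bgrp_group_set : group_set bgrp_set.
Proof.
apply/group_setP; split=> [|x y /bgrpP bx /bgrpP by_]; apply/bgrpP=> k.
  by rewrite perm1.
by rewrite permM by_ bx.
Qed.
Canonical bgrp := Group bgrp_group_set.

Lemma bgensP s : reflect (exists i j, [/\ adj i j, b i = b j & s = tperm i j]) (s \in bgens).
Proof.
apply: (iffP imsetP) => [[[i j]]|[i [j [aij bij ->]]]].
  by rewrite inE /= => /andP[aij /eqP bij] ->; exists i, j.
by exists (i, j); rewrite // inE /= aij bij eqxx.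
Qed.

Lemma bgens_Sgen s : s \in bgens -> s \in Sgen n.
Proof. by case/bgensP=> i [j [aij _ ->]]; apply/SgenP; exists i, j. Qed.

Lemma bgens_bgrp s : s \in bgens -> s \in bgrp.
Proof.
case/bgensP=> i [j [_ bij ->]]; apply/bgrpP=> k.
by case: tpermP => // ->.
Qed.

Lemma block_incr (f : 'I_n -> nat) :
  (forall i j, adj i j -> b i = b j -> (f i < f j)%N) ->
  forall i j, (i < j)%N -> b i = b j -> (f i < f j)%N.
Proof.
move=> hf i j; move: {2}(j - i)%N (leqnn (j - i)%N) => m.
elim: m i j => [|m IH] i j; first by lia.
move=> hm ij bij; have [e|ne] := eqVneq (j : nat) i.+1.
  by apply: hf => //; apply/eqP.
have hi : (i.+1 < n)%N by apply: leq_trans (ltn_ord j); lia.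
pose i' := Ordinal hi.
have bi' : b i = b i'.
  by apply/eqP; rewrite eqn_leq b_mono //= bij b_mono //=; lia.
apply: (@ltn_trans (f i')); first by apply: hf => //; apply/eqP.
by apply: IH => /=; [lia|lia|rewrite -bi'].
Qed.

(** Without a descent inside the blocks, [u] increases on each block; it also increases across
    blocks because it preserves them. An increasing permutation is the identity. *)
Lemma bgrp_desc u : u \in bgrp -> u != 1%g -> exists2 s : 'S_n, s \in bgens & desc s u.
Proof.
move=> /bgrpP bu nu1.
case: (pickP [pred s in bgens | desc s u]) => [s /andP[sb ds]|none]; first by exists s.
have incr : forall i j, (i < j)%N -> (u i < u j)%N.
  move=> i j ij; case: (ltngtP (b i) (b j)) => bij.
  - rewrite ltnNge; apply/negP=> /b_mono; rewrite !bu; lia.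
  - by move: (b_mono (ltnW ij)); lia.
  apply: (@block_incr (fun k => val (u k))) => //= k l akl bkl.
  have := none (tperm k l); rewrite inE descE // => /negbT.
  rewrite negb_and => /orP[|].
    by case/bgensP; exists k, l.
  rewrite -leqNgt leq_eqVlt => /orP[/eqP/val_inj/perm_inj e|//].
  by move: (adj_neq akl); rewrite e eqxx.
case/eqP: nu1; apply/permP=> i; rewrite perm1; apply/val_inj => /=.
have inj' : forall x : 'I_n, (x <= u x)%N.
  move=> x; have [m] := ubnP (val x); elim: m x => // m IH x hx.
  case: x hx => -[|x] hx //= hm.
  have hx' : (x < n)%N by lia.
  have := IH (Ordinal hx') hm; have := incr (Ordinal hx') (Ordinal hx) (leqnn _).
  by move=> /= h1 h2; lia.
have inj2 : forall m (x : 'I_n), (n - x <= m)%N -> (u x <= x)%N.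
  elim=> [|m IH] x hm; first by have := ltn_ord x; lia.
  have [hx|hx] := ltnP x.+1 n; last by have := ltn_ord (u x); lia.
  have := IH (Ordinal hx) ; have := incr x (Ordinal hx) (leqnn _).
  by move=> /= h1 h2; have h3 := h2 ltac:(lia); lia.
by apply/eqP; rewrite eqn_leq inj' (inj2 n) //; lia.
Qed.

Lemma bgrp_gen : bgrp :=: <<bgens>>%g.
Proof.
apply/eqP; rewrite eqEsubset andbC gen_subG; apply/andP; split.
  by apply/subsetP=> s /bgens_bgrp.
apply/subsetP=> u; have [m] := ubnP (len u); elim: m u => // m IH u hm ub.
have [->|u1] := eqVneq u 1%g; first exact: group1.
have [s sb ds] := bgrp_desc ub u1.
rewrite -(sgenK u (bgens_Sgen sb)); apply: groupM; first exact: mem_gen.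
apply: IH; first by move: ds; rewrite /desc; lia.
by rewrite groupM // bgens_bgrp.
Qed.

(** These are the minimal length representatives of the cosets [d W], as [len_rreduced] and
    [rreduced_uniq] confirm. *)
Definition rreduced d := [forall s in bgens, ~~ rdesc d s].

Lemma rreducedP d : reflect (forall s, s \in bgens -> ~~ rdesc d s) (rreduced d).
Proof. exact: 'forall_implyP. Qed.

Lemma rreduced_incr d : rreduced d -> forall i j, (i < j)%N -> b i = b j ->
  ((d^-1)%g i < (d^-1)%g j)%N.
Proof.
move=> /rreducedP dr; apply: (@block_incr (fun k => val ((d^-1)%g k))) => k l akl bkl /=.
have /dr : tperm k l \in bgens by apply/bgensP; exists k, l.
rewrite rdescE // -leqNgt leq_eqVlt => /orP[/eqP/val_inj/perm_inj e|//].
by move: (adj_neq akl); rewrite e eqxx.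
Qed.

(** The inverse of [d] is increasing on blocks and [u] permutes each block, so [d] does not affect
    the comparison that decides a descent inside a block. *)
Lemma rreduced_rdesc d u s : rreduced d -> u \in bgrp -> s \in bgens ->
  rdesc (d * u)%g s = rdesc u s.
Proof.
move=> dr ub /bgensP[i [j [aij bij ->]]]; rewrite !rdescE // invMg !permM.
have /bgrpP bu : (u^-1)%g \in bgrp by rewrite groupV.
case: (ltngtP ((u^-1)%g j) ((u^-1)%g i)) => [h|h|/val_inj/perm_inj e].
- by apply: rreduced_incr; rewrite ?bu.
- by apply/negbTE; rewrite -leqNgt ltnW // rreduced_incr ?bu.
- by move: (adj_neq aij); rewrite e eqxx.
Qed.

Lemma bgrp_rdesc u : u \in bgrp -> u != 1%g -> exists2 s : 'S_n, s \in bgens & rdesc u s.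
Proof.
rewrite -groupV -(inj_eq invg_inj) invg1 => /bgrp_desc h /h [s sb].
by rewrite descV ?invgK ?bgens_Sgen //; exists s.
Qed.

Lemma len_rreduced d u : rreduced d -> u \in bgrp -> len (d * u)%g = (len d + len u)%N.
Proof.
move=> dr; have [m] := ubnP (len u); elim: m u => // m IH u hm ub.
have [->|u1] := eqVneq u 1%g; first by rewrite mulg1 len1 addn0.
have [s sb ds] := bgrp_rdesc ub u1; have sS := bgens_Sgen sb.
have usb : (u * s)%g \in bgrp by rewrite groupM // bgens_bgrp.
have lu := len_rdesc sS ds.
rewrite (len_rdesc sS (w := (d * u)%g)) ?rreduced_rdesc // -mulgA IH //.
  by rewrite lu addnS.
by rewrite -ltnS -lu.
Qed.

Lemma rreduced_ex w : exists d u, [/\ rreduced d, u \in bgrp & w = (d * u)%g].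
Proof.
have [m] := ubnP (len w); elim: m w => // m IH w hm.
have [/forallP wr|] := boolP (rreduced w).
  by exists w, 1%g; rewrite mulg1 group1; split=> //; apply/forallP.
rewrite negb_forall => /existsP[s]; rewrite negb_imply negbK => /andP[sb ds].
have [|d [u [dr ub e]]] := IH (w * s)%g.
  by move: ds; rewrite /rdesc; lia.
exists d, (u * s)%g; split=> //; first by rewrite groupM // bgens_bgrp.
by rewrite mulgA -e sgenKr // bgens_Sgen.
Qed.

(** Each of [d] and [d'] is the other one times an element of the subgroup. Additivity of lengths,
    used in both directions, forces this element to have length 0. *)
Lemma rreduced_uniq d u d' u' : rreduced d -> rreduced d' -> u \in bgrp -> u' \in bgrp ->
  (d * u = d' * u')%g -> d = d' /\ u = u'.
Proof.
move=> dr dr' ub ub' e.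
have h1 : d' = (d * (u * u'^-1))%g by rewrite mulgA e mulgK.
have h2 : d = (d' * (u' * u^-1))%g by rewrite mulgA -e mulgK.
have ub1 : (u * u'^-1)%g \in bgrp by rewrite groupM ?groupV.
have ub2 : (u' * u^-1)%g \in bgrp by rewrite groupM ?groupV.
have l1 := len_rreduced dr ub1; have l2 := len_rreduced dr' ub2.
rewrite -h1 in l1; rewrite -h2 in l2.
have l0 : len (u * u'^-1)%g = 0%N by lia.
have e1 : (u * u'^-1 = 1)%g.
  apply/eqP/negPn/negP=> /(bgrp_rdesc ub1)[s _]; rewrite /rdesc l0; lia.
have uu : u = u' by apply/eqP; rewrite eq_mulgV1 e1.
by split=> //; rewrite h1 e1 mulg1.
Qed.

End Blocks.

Section ExDesc.
Variable n : nat.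
Lemma ex_desc (w : 'S_n) : w != 1%g -> exists2 s : 'S_n, s \in Sgen n & desc s w.
Proof.
(* The constant block function turns the whole symmetric group into one block. *)
move=> w1; have mono : forall i j : 'I_n, (i <= j)%N -> ((fun=> 0%N) i <= (fun=> 0%N) j)%N by [].
have wb : w \in bgrp (n := n) (fun=> 0%N) by apply/bgrpP.
by have [s /bgens_Sgen sS ds] := bgrp_desc mono wb w1; exists s.
Qed.

Lemma T_ind (P : 'S_n -> Prop) : P 1%g ->
  (forall s w, s \in Sgen n -> ~~ desc s w -> P w -> P (s * w)%g) -> forall w, P w.
Proof.
move=> P1 PM w; have [m] := ubnP (len w); elim: m w => // m IH w hm.
have [->//|w1] := eqVneq w 1%g.
have [s sS ds] := ex_desc w1; have lw := len_desc sS ds.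
have a : ~~ desc s (s * w)%g by rewrite desc_mul // ds.
by rewrite -(sgenK w sS); apply: PM => //; apply: IH; lia.
Qed.

Lemma ex_rdesc (w : 'S_n) : w != 1%g -> exists2 s : 'S_n, s \in Sgen n & rdesc w s.
Proof.
rewrite -(inj_eq invg_inj) invg1 => /ex_desc[s sS ds].
by exists s; rewrite ?rdescV.
Qed.

Lemma len_eq0 (w : 'S_n) : (len w == 0)%N = (w == 1%g).
Proof.
apply/eqP/eqP => [l0|->]; last exact: len1.
by apply/eqP/negPn/negP=> /ex_desc[s _]; rewrite /desc l0.
Qed.

Lemma asc1 (s : 'S_n) : ~~ desc s 1%g.
Proof. by rewrite /desc len1. Qed.
End ExDesc.

(** A separate name for these functions, to which the Hecke product can be attached as ring
    multiplication. *)
Definition hecke (R : realType) (n : nat) := {ffun 'S_n -> K R}.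
HB.instance Definition _ (R : realType) (n : nat) :=
  GRing.Zmodule.copy (hecke R n) {ffun 'S_n -> K R}.

(** * The Iwahori-Hecke algebra *)

Section HeckeModule.
Variables (R : realType) (n : nat).
Local Notation H := (hecke R n).
Local Notation v := (vK R).

Lemma scHA (a b : K R) (h : H) : scH a (scH b h) = scH (a * b) h :> H.
Proof. by apply/ffunP=> y; rewrite !ffunE mulrA. Qed.
Lemma scH1 (h : H) : scH 1 h = h :> H.
Proof. by apply/ffunP=> y; rewrite !ffunE mul1r. Qed.
Lemma scHDr (a : K R) (h h' : H) : scH a (h + h') = (scH a h : H) + scH a h' :> H.
Proof. by apply/ffunP=> y; rewrite !ffunE mulrDr. Qed.
Lemma scHDl (h : H) (a b : K R) : scH (a + b) h = (scH a h : H) + scH b h :> H.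
Proof. by apply/ffunP=> y; rewrite !ffunE mulrDl. Qed.
End HeckeModule.

HB.instance Definition _ (R : realType) (n : nat) :=
  GRing.Zmodule_isLmodule.Build (K R) (hecke R n)
    (@scHA R n) (@scH1 R n) (fun a h h' => @scHDr R n a h h') (@scHDl R n).

Section HeckeMul.
Variables (R : realType) (n : nat).
Local Notation H := (hecke R n).
Local Notation v := (vK R).
Implicit Types (s t w x y : 'S_n) (h : H).

Definition T w : H := Tb R w.

Lemma addHE h h' y : (h + h') y = h y + h' y. Proof. by rewrite ffunE. Qed.
Lemma oppHE h y : (- h) y = - h y. Proof. by rewrite ffunE. Qed.
Lemma zeroHE y : (0 : H) y = 0. Proof. by rewrite ffunE. Qed.
Lemma scaleHE (a : K R) h y : (a *: h) y = a * h y. Proof. by rewrite ffunE. Qed.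
Lemma TE w y : T w y = (y == w)%:R. Proof. by rewrite ffunE. Qed.
Lemma sumHE (I : Type) (r : seq I) (P : pred I) (f : I -> H) y :
  (\sum_(i <- r | P i) f i) y = \sum_(i <- r | P i) f i y.
Proof.
elim/big_rec2: _ => [|i a b _ <-]; first exact: zeroHE.
by rewrite addHE.
Qed.

Lemma hecke_basis h : h = \sum_w h w *: T w.
Proof.
apply/ffunP=> y; rewrite sumHE (bigD1 y) //= scaleHE TE eqxx mulr1 big1 ?addr0 // => w wy.
by rewrite scaleHE TE eq_sym (negPf wy) mulr0.
Qed.

Definition mulTl s h : H := mulT s h.
(** The mirror image of [mulT], written out independently of the product. Associativity will follow
    from the fact that left and right operators commute. *)
Definition mulTr t h : H :=
  [ffun y => h (y * t)%g + (if rdesc y t then (v - v^-1) * h y else 0)].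

Lemma mulTlE s h y : mulTl s h y = h (s * y)%g + (if desc s y then (v - v^-1) * h y else 0).
Proof. by rewrite ffunE. Qed.
Lemma mulTrE s h y : mulTr s h y = h (y * s)%g + (if rdesc y s then (v - v^-1) * h y else 0).
Proof. by rewrite ffunE. Qed.

Lemma mulTl_linear s : linear (mulTl s).
Proof.
move=> a h h'; apply/ffunP=> y; rewrite !(mulTlE, addHE, scaleHE).
by case: ifP => _; ring.
Qed.
HB.instance Definition _ s := GRing.isLinear.Build (K R) H H _ (mulTl s) (mulTl_linear s).
Lemma mulTr_linear s : linear (mulTr s).
Proof.
move=> a h h'; apply/ffunP=> y; rewrite !(mulTrE, addHE, scaleHE).
by case: ifP => _; ring.
Qed.
HB.instance Definition _ s := GRing.isLinear.Build (K R) H H _ (mulTr s) (mulTr_linear s).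

(** If [s * y = y * t], both operators act on the same pair of coordinates under the same descent
    condition. Otherwise neither multiplication changes the descent condition of the other. *)
Lemma mulT_comm s t h : s \in Sgen n -> t \in Sgen n ->
  mulTl s (mulTr t h) = mulTr t (mulTl s h).
Proof.
move=> sS tS; apply/ffunP=> y; rewrite !(mulTlE, mulTrE) mulgA.
have [e|ne] := eqVneq (s * y)%g (y * t)%g.
  have e2 : (s * y * t = y)%g by rewrite e sgenKr.
  have e3 : rdesc y t = desc s y by rewrite /rdesc /desc e.
  have e4 : rdesc (s * y)%g t = ~~ desc s y by rewrite e rdesc_mul // e3.
  rewrite e2 e4 -e desc_mul // e3.
  by case: (desc s y) => /=; ring.
rewrite desc_mulr // rdesc_mull //.
by case: ifP => _; case: ifP => _; ring.
Qed.

Lemma mulTl_asc s w : s \in Sgen n -> ~~ desc s w -> mulTl s (T w) = T (s * w)%g.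
Proof.
move=> sS asc; apply/ffunP=> y; rewrite mulTlE !TE.
have -> : (s * y == w)%g = (y == (s * w)%g).
  by apply/eqP/eqP => [<-|->]; rewrite sgenK.
case: ifP => [dy|_]; last by rewrite addr0.
have [yw|_] := eqVneq y w; last by rewrite mulr0 addr0.
by move: asc; rewrite -yw dy.
Qed.

Lemma mulTr_asc s w : s \in Sgen n -> ~~ rdesc w s -> mulTr s (T w) = T (w * s)%g.
Proof.
move=> sS asc; apply/ffunP=> y; rewrite mulTrE !TE.
have -> : (y * s == w)%g = (y == (w * s)%g).
  by apply/eqP/eqP => [<-|->]; rewrite sgenKr.
case: ifP => [dy|_]; last by rewrite addr0.
have [yw|_] := eqVneq y w; last by rewrite mulr0 addr0.
by move: asc; rewrite -yw dy.
Qed.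

(** Every [T w] is reached from [T 1] by right multiplications, so an operator commuting with these
    is determined by its value at [T 1]. *)
Lemma eq_operator (f g : {linear H -> H}) :
  (forall t h, t \in Sgen n -> f (mulTr t h) = mulTr t (f h)) ->
  (forall t h, t \in Sgen n -> g (mulTr t h) = mulTr t (g h)) ->
  f (T 1%g) = g (T 1%g) -> f =1 g.
Proof.
move=> fr gr e1 h; rewrite (hecke_basis h) !linear_sum; apply: eq_bigr => w _.
rewrite !linearZ /=; congr (_ *: _).
have [m] := ubnP (len w); elim: m w => // m IH w hm.
have [->//|w1] := eqVneq w 1%g.
have [s sS ds] := ex_rdesc w1.
rewrite -(sgenKr w sS) -mulTr_asc ?rdesc_mul ?ds //.
rewrite fr // gr // IH //; move: ds hm; rewrite /rdesc; lia.
Qed.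

Lemma Tleft_linear k x : linear (fun h => Tleft k x h : H).
Proof.
elim: k x => [|k IH] x a h h' //=; case: pickP => //= s _.
by rewrite IH -!/(mulTl s _) linearP.
Qed.

Lemma Tleft_mulTr k x t h : t \in Sgen n ->
  Tleft k x (mulTr t h) = mulTr t (Tleft k x h).
Proof.
move=> tS; elim: k x => [|k IH] x //=; case: pickP => //= s /andP[sS _].
by rewrite IH -!/(mulTl s _) mulT_comm.
Qed.

Lemma Tleft_T1 x : Tleft (len x) x (T 1%g) = T x.
Proof.
move e: (len x) => k; elim: k x e => [|k IH] x e /=.
  by move/eqP: e; rewrite len_eq0 => /eqP ->.
case: pickP => [s /andP[sS ds]|none].
  have e' : len (s * x)%g = k by have := len_desc sS ds; rewrite e => -[].
  by rewrite (IH _ e') -/(mulTl s _) mulTl_asc ?sgenK // desc_mul // negbK.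
have [|s sS ds] := @ex_desc n x; first by rewrite -len_eq0 e.
by have := none s; rewrite /= sS; move: ds; rewrite /desc => ->.
Qed.

End HeckeMul.

(* Locked so that matching never unfolds a product into its defining sum. *)
HB.lock Definition hmul (R : realType) (n : nat) (h h' : hecke R n) : hecke R n := mulH h h'.

Section HeckeRing.
Variables (R : realType) (n : nat).
Local Notation H := (hecke R n).
Local Notation v := (vK R).
Local Notation hmul := (@hmul R n).
Local Notation T := (@T R n).
Implicit Types (s t w x y : 'S_n) (h : H).

Lemma hmulE h h' : hmul h h' = \sum_x h x *: (Tleft (len x) x h' : H).
Proof. by rewrite hmul.unlock. Qed.

Lemma hmul_linearr h : linear (hmul h).
Proof.
move=> a h1 h2; rewrite !hmulE scaler_sumr -big_split; apply: eq_bigr => x _ /=.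
by rewrite Tleft_linear scalerDr !scalerA mulrC.
Qed.
HB.instance Definition _ h := GRing.isLinear.Build (K R) H H _ (hmul h) (hmul_linearr h).

Lemma hmul_linearl h : linear (hmul^~ h).
Proof.
move=> a h1 h2; rewrite !hmulE scaler_sumr -big_split; apply: eq_bigr => x _ /=.
by rewrite addHE scaleHE scalerDl scalerA.
Qed.

Lemma hmul_mulTr h t h' : t \in Sgen n -> hmul h (mulTr t h') = mulTr t (hmul h h').
Proof.
move=> tS; rewrite !hmulE linear_sum; apply: eq_bigr => x _.
by rewrite Tleft_mulTr // linearZ.
Qed.

Lemma hmul1 h : hmul h (T 1%g) = h.
Proof. by rewrite hmulE [RHS]hecke_basis; apply: eq_bigr => x _; rewrite Tleft_T1. Qed.

Lemma hmul1l h : hmul (T 1%g) h = h.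
Proof.
rewrite hmulE (bigD1 1%g) //= TE eqxx scale1r len1 big1 ?addr0 // => x x1.
by rewrite TE (negPf x1) scale0r.
Qed.

(** Both sides, as functions of [h'], commute with right multiplications and agree at [T 1]. This is
    the substance of associativity. *)
Lemma hmul_mulTl s h h' : s \in Sgen n -> hmul (mulTl s h) h' = mulTl s (hmul h h').
Proof.
move=> sS; move: h'.
have lin : linear (mulTl s \o hmul h) by move=> a x y /=; rewrite !linearP.
pose g : {linear H -> H} := HB.pack (mulTl s \o hmul h)
  (GRing.isLinear.Build (K R) H H _ (mulTl s \o hmul h) lin).
apply: (@eq_operator R n (hmul (mulTl s h)) g) => [t h' tS|t h' tS|] /=.
- by rewrite hmul_mulTr.
- by rewrite hmul_mulTr // mulT_comm.
- by rewrite !hmul1.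
Qed.

Lemma hmul_Tleft k x h h' : hmul (Tleft k x h) h' = Tleft k x (hmul h h').
Proof.
elim: k x => [|k IH] x //=; case: pickP => //= s /andP[sS _].
by rewrite -!/(mulTl s _) hmul_mulTl // IH.
Qed.

Lemma hmulA : associative hmul.
Proof.
move=> h1 h2 h3; rewrite [in LHS]hmulE [in RHS](hmulE h1 h2).
pose f := hmul^~ h3.
have fD : {morph f : x y / x + y} by move=> x y; have := hmul_linearl h3 1 x y; rewrite !scale1r.
have f0 : f 0 = 0 by have := hmul_linearl h3 (-1) 0 0; rewrite !scaleN1r oppr0 addr0 addNr.
have fZ (a : K R) (h : H) : f (a *: h) = a *: f h.
  by have := hmul_linearl h3 a h 0; rewrite !addr0 -/(f _) -/(f h) -/(f 0) f0 addr0.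
rewrite -[RHS]/(f _) (big_morph f fD f0); apply: eq_bigr => x _.
by rewrite fZ /f hmul_Tleft.
Qed.

Lemma T1_neq0 : T 1%g != 0.
Proof.
by apply/eqP=> /ffunP/(_ 1%g); rewrite TE eqxx zeroHE => /eqP; rewrite oner_eq0.
Qed.

Lemma hmulDl : left_distributive hmul +%R.
Proof. by move=> x y z; have := hmul_linearl z 1 x y; rewrite !scale1r. Qed.
Lemma hmulDr : right_distributive hmul +%R.
Proof. by move=> x y z; rewrite linearD. Qed.
End HeckeRing.

HB.instance Definition _ (R : realType) (n : nat) :=
  GRing.Zmodule_isNzRing.Build (hecke R n)
    (@hmulA R n) (@hmul1l R n) (@hmul1 R n) (@hmulDl R n) (@hmulDr R n) (@T1_neq0 R n).

Lemma len_mul_le n (x y : 'S_n) : (len (x * y)%g <= len x + len y)%N.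
Proof.
have [m] := ubnP (len x); elim: m x => // m IH x hm.
have [->|x1] := eqVneq x 1%g; first by rewrite mul1g leq_addl.
have [s sS ds] := ex_desc x1; have lx := len_desc sS ds.
have E : (s * (x * y) = s * x * y)%g by rewrite mulgA.
have l1 : (len (s * x)%g < m)%N by lia.
have h := IH _ l1.
case: (boolP (desc s (x * y)%g)) => [dd|aa].
  by have := len_desc sS dd; rewrite E; lia.
by have := len_asc sS aa; rewrite E; lia.
Qed.

Section HeckeAlg.
Variables (R : realType) (n : nat).
Local Notation H := (hecke R n).
Lemma hecke_scalerAl (a : K R) (u w : H) : a *: (u * w) = (a *: u) * w.
Proof.
have := hmul_linearl w a u 0; rewrite !addr0 => e.
by rewrite [RHS]e -[hmul 0 w]/(0 * w) mul0r addr0.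
Qed.
Lemma hecke_scalerAr (a : K R) (u w : H) : a *: (u * w) = u * (a *: w).
Proof. by rewrite -[LHS]/(a *: hmul u w) -linearZ. Qed.
End HeckeAlg.

HB.instance Definition _ (R : realType) (n : nat) :=
  GRing.Lmodule_isLalgebra.Build (K R) (hecke R n) (@hecke_scalerAl R n).
HB.instance Definition _ (R : realType) (n : nat) :=
  GRing.Lalgebra_isAlgebra.Build (K R) (hecke R n) (@hecke_scalerAr R n).

Section HeckeTheory.
Variables (R : realType) (n : nat).
Local Notation H := (hecke R n).
Local Notation F := (K R).
Local Notation v := (vK R).
Local Notation T := (@T R n).
Implicit Types (s t w x y d u : 'S_n) (h : H).

Lemma mulHE h h' : mulH h h' = h * h'. Proof. by rewrite -[h * h']/(hmul h h') hmul.unlock. Qed.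

Lemma T1 : T 1%g = 1. Proof. by []. Qed.

Lemma mulTlM s h : s \in Sgen n -> mulTl s h = T s * h.
Proof.
move=> sS; rewrite -{1}[h]mul1r; have := hmul_mulTl 1 h sS.
by rewrite -/(hmul _ _) => <-; rewrite -T1 mulTl_asc ?asc1 // mulg1.
Qed.

Lemma mulTrM s h : s \in Sgen n -> mulTr s h = h * T s.
Proof.
move=> sS; rewrite -{1}[h]mulr1; have := hmul_mulTr h 1 sS.
rewrite -/(hmul _ _) => <-; rewrite -T1 mulTr_asc ?mul1g //.
by rewrite rdescV // invg1 asc1.
Qed.

Lemma TsM s w : s \in Sgen n -> ~~ desc s w -> T s * T w = T (s * w)%g.
Proof. by move=> sS a; rewrite -mulTlM // mulTl_asc. Qed.
Lemma TMs s w : s \in Sgen n -> ~~ rdesc w s -> T w * T s = T (w * s)%g.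
Proof. by move=> sS a; rewrite -mulTrM // mulTr_asc. Qed.

Lemma Ts2 s : s \in Sgen n -> T s * T s = 1 + (v - v^-1) *: T s.
Proof.
move=> sS; rewrite -mulTlM //; apply/ffunP=> y.
rewrite mulTlE addHE scaleHE -T1 !TE.
have -> : (s * y == s)%g = (y == 1%g) by rewrite -{2}(mulg1 s) (inj_eq (mulgI s)).
have [->|ys] := eqVneq y s; last by rewrite mulr0 if_same.
have dss : desc s s by rewrite -{2}(mulg1 s) desc_mul // asc1.
by rewrite dss.
Qed.

Lemma TM x y : len (x * y)%g = (len x + len y)%N -> T x * T y = T (x * y)%g.
Proof.
have [m] := ubnP (len x); elim: m x => // m IH x hm e.
have [x1|x1] := eqVneq x 1%g; first by rewrite x1 T1 mul1r mul1g.
have [s sS ds] := ex_desc x1; have lx := len_desc sS ds.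
have e1 : (len (s * x * y) = len (s * x) + len y)%N.
  have E : (s * x * y = s * (x * y))%g by rewrite mulgA.
  have h1 : (len (s * x * y) <= len (s * x) + len y)%N := len_mul_le _ _.
  have h2 : (len (x * y) <= (len (s * x * y)).+1)%N.
    rewrite E; case: (boolP (desc s (x * y)%g)) => [d|a].
      by rewrite -(len_desc sS d).
    by rewrite (len_asc sS a) -addn2 leq_addr.
  by lia.
have hd : desc s (x * y)%g by rewrite /desc mulgA e1; lia.
rewrite -{1}(sgenK x sS) -TsM ?desc_mul ?ds // -mulrA IH //; last by lia.
by rewrite -mulgA TsM ?sgenK // desc_mul // hd.
Qed.

(** The coefficient at 1 is the symmetrising trace; this says that [T x] and [T (x^-1)] form dual
    bases for it. *)
Lemma tau_Tl x h : (T x * h) 1%g = h (x^-1)%g.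
Proof.
move: h; have [m] := ubnP (len x); elim: m x => // m IH x hm h.
have [->|x1] := eqVneq x 1%g; first by rewrite T1 mul1r invg1.
have [s sS ds] := ex_rdesc x1; have lw := len_rdesc sS ds.
rewrite -{1}(sgenKr x sS) -TMs ?rdesc_mul ?ds // -mulrA IH; last by lia.
rewrite -mulTlM // mulTlE invMg (sgenV sS) sgenK //.
by rewrite desc_mul // -rdescV // ds /= addr0.
Qed.

Lemma tauE h h' : (h * h') 1%g = \sum_w h w * h' (w^-1)%g.
Proof.
rewrite {1}(hecke_basis h) mulr_suml sumHE; apply: eq_bigr => w _.
by rewrite -scalerAl scaleHE tau_Tl.
Qed.

Lemma tauC h h' : (h * h') 1%g = (h' * h) 1%g.
Proof.
rewrite !tauE (reindex_inj invg_inj) /=; apply: eq_bigr => w _.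
by rewrite invgK mulrC.
Qed.

Lemma coefE h w : h w = (h * T (w^-1)%g) 1%g.
Proof. by rewrite tauC tau_Tl invgK. Qed.

Lemma coefE' h w : h w = (T (w^-1)%g * h) 1%g.
Proof. by rewrite tau_Tl invgK. Qed.

(** The antiautomorphism inverting the indices. It plays the role of the adjoint: the trace of
    [flat h * h] is a sum of squares, see [tau_flat]. *)
Definition flat h : H := [ffun w => h (w^-1)%g].
Lemma flatE h w : flat h w = h (w^-1)%g. Proof. by rewrite ffunE. Qed.

Lemma flat_linear : linear flat.
Proof. by move=> a h h'; apply/ffunP=> w; rewrite !(flatE, addHE, scaleHE). Qed.
HB.instance Definition _ := GRing.isLinear.Build F H H _ flat flat_linear.

Lemma flat_sum (I : Type) (r : seq I) (P : pred I) (f : I -> H) :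
  flat (\sum_(i <- r | P i) f i) = \sum_(i <- r | P i) flat (f i).
Proof. exact: linear_sum. Qed.
Lemma flatZ (a : F) h : flat (a *: h) = a *: flat h.
Proof. exact: linearZ. Qed.

Lemma flatK : involutive flat.
Proof. by move=> h; apply/ffunP=> w; rewrite !flatE invgK. Qed.

Lemma flatT w : flat (T w) = T (w^-1)%g.
Proof. by apply/ffunP=> y; rewrite flatE !TE -(inj_eq invg_inj) invgK. Qed.

Lemma flat1 : flat 1 = 1. Proof. by rewrite -T1 flatT invg1. Qed.

Lemma flatTM w h : flat (T w * h) = flat h * T (w^-1)%g.
Proof.
move: h; have [m] := ubnP (len w); elim: m w => // m IH w hm h.
have [->|w1] := eqVneq w 1%g; first by rewrite invg1 T1 mul1r mulr1.
have [s sS ds] := ex_desc w1; have lw := len_desc sS ds.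
rewrite -{1}(sgenK w sS) -TsM ?desc_mul ?ds // -mulrA.
have -> : flat (T s * (T (s * w)%g * h)) = flat (T (s * w)%g * h) * T s.
  rewrite -mulTlM // -mulTrM //; apply/ffunP=> y.
  by rewrite flatE mulTlE mulTrE !flatE invMg (sgenV sS) rdescV.
rewrite IH; last by lia.
rewrite -mulrA invMg (sgenV sS) TMs // ?sgenKr //.
by rewrite -{1}(sgenV sS) -invMg -descV // desc_mul // ds.
Qed.

Lemma flatM h h' : flat (h * h') = flat h' * flat h.
Proof.
rewrite {1}(hecke_basis h) mulr_suml linear_sum {2}(hecke_basis h) linear_sum mulr_sumr.
apply: eq_bigr => w _; rewrite -scalerAl !linearZ /= flatTM flatT.
by rewrite -scalerAr.
Qed.

Lemma tau_flat h : (flat h * h) 1%g = \sum_w h w ^+ 2.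
Proof.
rewrite tauE (reindex_inj invg_inj) /=; apply: eq_bigr => w _.
by rewrite flatE invgK expr2.
Qed.

End HeckeTheory.

Lemma mulV_cancel (F : fieldType) (a f b : F) : a != 0 -> f != 0 -> b != 0 ->
  a * f^-1 * (f / (b * a)) * b = 1.
Proof. by move=> a0 f0 b0; field; rewrite a0 b0 f0. Qed.

(** * The local ring of rational functions regular at 0 *)

Section LocalRing.
Variable R : realType.
Local Notation F := (K R).
Local Notation v := (vK R).
Implicit Types (f g : F) (p q : {poly R}).

Definition frK p : F := tofrac p.
Lemma frK_zmod : zmod_morphism frK. Proof. exact: tofracB. Qed.
HB.instance Definition _ := GRing.isZmodMorphism.Build {poly R} F frK frK_zmod.
Lemma frK_monoid : monoid_morphism frK.
Proof. by split; [exact: tofrac1 | exact: tofracM]. Qed.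
HB.instance Definition _ := GRing.isMonoidMorphism.Build {poly R} F frK frK_monoid.

Lemma frKM p q : frK (p * q) = frK p * frK q. Proof. exact: rmorphM. Qed.
Lemma frKD p q : frK (p + q) = frK p + frK q. Proof. exact: rmorphD. Qed.
Lemma frKN p : frK (- p) = - frK p. Proof. exact: rmorphN. Qed.
Lemma frK1 : frK 1 = 1. Proof. exact: rmorph1. Qed.
Lemma frK0 : frK 0 = 0. Proof. exact: rmorph0. Qed.
Lemma frKXn p m : frK (p ^+ m) = frK p ^+ m. Proof. exact: rmorphXn. Qed.

Lemma frK_eq0 p : (frK p == 0) = (p == 0).
Proof. exact: tofrac_eq0. Qed.
Lemma frK_inj : injective frK.
Proof. by move=> p q /eqP; rewrite tofrac_eq => /eqP. Qed.
Lemma frKX : frK 'X = v. Proof. by []. Qed.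
Lemma v_neq0 : v != 0. Proof. by rewrite -frKX frK_eq0 polyX_eq0. Qed.

Lemma vX_neq0 m : v ^+ m != 0. Proof. exact: expf_neq0 v_neq0. Qed.

Lemma repr_frac f : f = frK (generic_quotient.repr f).1 / frK (generic_quotient.repr f).2.
Proof.
set x := generic_quotient.repr f.
have x2 : x.2 != 0 by exact: denom_ratioP.
have x2' : frK x.2 != 0 by rewrite frK_eq0.
apply: (canRL (mulfK x2')); rewrite -[f in LHS]generic_quotient.reprK -/x /frK.
unlock FracField.tofrac; rewrite -[LHS]FracField.pi_mul.
apply/eqP; rewrite (FracField.equivf_def) /FracField.mulf !numden_Ratio ?mulr1 ?oner_neq0 //.
by rewrite mulrC.
Qed.

Lemma fracP f : exists p q, q != 0 /\ f = frK p / frK q.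
Proof. by exists (generic_quotient.repr f).1, (generic_quotient.repr f).2; split; [exact: denom_ratioP|exact: repr_frac]. Qed.

#[global] Opaque frK vK K.

Definition inO f := exists p q, q.[0] != 0 /\ f = frK p / frK q.

Lemma poly0_neq q : q.[0] != 0 -> q != 0.
Proof. by apply: contraNneq => ->; rewrite horner0. Qed.

(** The choice made inside [ct] only guarantees some representation as a fraction. Cross-multiplying
    and evaluating at 0 shows that all representations give the same value. *)
Lemma ctE p q : q.[0] != 0 -> ct (frK p / frK q) = p.[0] / q.[0].
Proof.
move=> q0; rewrite /ct.
set P := (fun c => _).
have : P (epsilon (inhabits 0) P) by apply: epsilon_spec; exists (p.[0] / q.[0]), p, q.
case=> p' [q' [q0' [e ->]]].
have nq : frK q != 0 by rewrite frK_eq0 poly0_neq.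
have nq' : frK q' != 0 by rewrite frK_eq0 poly0_neq.
have /eqP : frK p / frK q = frK p' / frK q' := e.
rewrite (eqr_div _ _ nq nq') -!frKM => /eqP e'.
have /(congr1 (fun r => r.[0])) := frK_inj e'; rewrite !hornerM => h.
by apply: (mulIf q0); apply: (mulIf q0'); rewrite divfK // mulrAC divfK //.
Qed.

Lemma ct_frK p : ct (frK p) = p.[0].
Proof. by rewrite -[frK p]divr1 -frK1 ctE hornerC ?oner_neq0 // divr1. Qed.
Lemma inO_frK p : inO (frK p).
Proof. by exists p, 1; rewrite hornerC oner_neq0 frK1 divr1. Qed.

Lemma inO0 : inO 0. Proof. by rewrite -frK0; exact: inO_frK. Qed.
Lemma inO1 : inO 1. Proof. by rewrite -frK1; exact: inO_frK. Qed.
Lemma inOv : inO v. Proof. exact: (inO_frK 'X). Qed.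
Lemma ct0 : ct (0 : F) = 0. Proof. by rewrite -frK0 ct_frK horner0. Qed.
Lemma ct1 : ct (1 : F) = 1. Proof. by rewrite -frK1 ct_frK hornerC. Qed.
Lemma ctv : ct v = 0. Proof. by rewrite -frKX ct_frK hornerX. Qed.

Lemma inO_ctM f g : inO f -> inO g -> inO (f * g) /\ ct (f * g) = ct f * ct g.
Proof.
move=> [p [q [q0 ->]]] [p' [q' [q0' ->]]].
have h : (q * q').[0] != 0 by rewrite hornerM mulf_neq0.
have e : frK p / frK q * (frK p' / frK q') = frK (p * p') / frK (q * q').
  by rewrite !frKM invfM mulrACA.
by rewrite e; split; [exists (p * p'), (q * q')|rewrite !ctE // !hornerM invfM mulrACA].
Qed.
Lemma inOM f g : inO f -> inO g -> inO (f * g). Proof. by move=> a b; case: (inO_ctM a b). Qed.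
Lemma ctM f g : inO f -> inO g -> ct (f * g) = ct f * ct g.
Proof. by move=> a b; case: (inO_ctM a b). Qed.

Lemma inO_ctD f g : inO f -> inO g -> inO (f + g) /\ ct (f + g) = ct f + ct g.
Proof.
move=> [p [q [q0 ->]]] [p' [q' [q0' ->]]].
have h : (q * q').[0] != 0 by rewrite hornerM mulf_neq0.
have nq : frK q != 0 by rewrite frK_eq0 poly0_neq.
have nq' : frK q' != 0 by rewrite frK_eq0 poly0_neq.
have e : frK p / frK q + frK p' / frK q' = frK (p * q' + p' * q) / frK (q * q').
  by rewrite (addf_div _ _ nq nq') frKD !frKM.
rewrite e; split; [by exists (p * q' + p' * q), (q * q')|].
by rewrite !ctE // !hornerE addf_div.
Qed.
Lemma inOD f g : inO f -> inO g -> inO (f + g). Proof. by move=> a b; case: (inO_ctD a b). Qed.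
Lemma ctD f g : inO f -> inO g -> ct (f + g) = ct f + ct g.
Proof. by move=> a b; case: (inO_ctD a b). Qed.

Lemma inON1 : inO (-1). Proof. by rewrite -frK1 -frKN; exact: inO_frK. Qed.
Lemma ctN1 : ct (-1 : F) = -1. Proof. by rewrite -frK1 -frKN ct_frK hornerN hornerC. Qed.
Lemma inON f : inO f -> inO (- f). Proof. by move=> h; rewrite -mulN1r; apply: inOM inON1 h. Qed.
Lemma ctN f : inO f -> ct (- f) = - ct f.
Proof. by move=> h; rewrite -mulN1r ctM ?ctN1 ?mulN1r //; exact: inON1. Qed.

Lemma inO_sum (I : Type) (r : seq I) (P : pred I) (f : I -> F) :
  (forall i, P i -> inO (f i)) ->
  inO (\sum_(i <- r | P i) f i) /\
  ct (\sum_(i <- r | P i) f i) = \sum_(i <- r | P i) ct (f i).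
Proof.
move=> h; elim/big_rec2: _ => [|i y x Pi [hx ex]]; first by split; [exact: inO0|exact: ct0].
by split; [apply: inOD => //; exact: h|rewrite ctD ?ex //; exact: h].
Qed.
Lemma inO_bigsum (I : Type) (r : seq I) (P : pred I) (f : I -> F) :
  (forall i, P i -> inO (f i)) -> inO (\sum_(i <- r | P i) f i).
Proof. by move=> h; case: (inO_sum r h). Qed.
Lemma ct_sum (I : Type) (r : seq I) (P : pred I) (f : I -> F) :
  (forall i, P i -> inO (f i)) ->
  ct (\sum_(i <- r | P i) f i) = \sum_(i <- r | P i) ct (f i).
Proof. by move=> h; case: (inO_sum r h). Qed.

Lemma inOX f m : inO f -> inO (f ^+ m).
Proof. by move=> h; elim: m => [|m IH]; rewrite ?expr0 ?exprS; [exact: inO1|exact: inOM]. Qed.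
Lemma ctX f m : inO f -> ct (f ^+ m) = ct f ^+ m.
Proof.
by move=> h; elim: m => [|m IH]; rewrite ?expr0 ?exprS ?ct1 // ctM ?IH //; exact: inOX.
Qed.
Lemma ctXv m : ct (v ^+ m.+1) = 0.
Proof. by rewrite ctX ?ctv ?expr0n //; exact: inOv. Qed.
Lemma inOXv m : inO (v ^+ m). Proof. by apply: inOX; exact: inOv. Qed.

Lemma ct_vM m f : inO f -> ct (v ^+ m.+1 * f) = 0.
Proof. by move=> h; rewrite ctM ?ctXv ?mul0r //; exact: inOXv. Qed.

Lemma inO_inv f : inO f -> ct f != 0 -> inO f^-1 /\ ct f^-1 = (ct f)^-1.
Proof.
move=> [p [q [q0 ->]]]; rewrite ctE // => h.
have p0 : p.[0] != 0 by apply: contraNneq h => ->; rewrite mul0r.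
by rewrite invf_div ctE // invf_div; split=> //; exists q, p.
Qed.

Lemma inO_ct0 f : inO f -> ct f = 0 -> inO (f / v).
Proof.
move=> [p [q [q0 ->]]]; rewrite ctE // => /eqP.
rewrite mulf_eq0 invr_eq0 (negPf q0) orbF => p0.
have /factor_theorem[p' ->] : root p 0 by [].
rewrite polyC0 subr0; exists p', q; split=> //.
by rewrite frKM frKX mulrAC mulfK ?v_neq0.
Qed.

(** The step of every induction on pole orders: when the constant term vanishes, one power of [v]
    can be saved. *)
Lemma inO_ct0_iff f m : inO (v ^+ m.+1 * f) -> ct (v ^+ m.+1 * f) = 0 -> inO (v ^+ m * f).
Proof.
by move=> h c; have := inO_ct0 h c; rewrite exprSr mulrAC mulfK ?v_neq0.
Qed.

Lemma poly_X_factor p : p != 0 -> exists m q, q.[0] != 0 /\ p = 'X^m * q.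
Proof.
have [k] := ubnP (size p); elim: k p => // k IH p hk p0.
have [/factor_theorem[q e]|r0] := boolP (root p 0); last by exists 0, p; rewrite expr0 mul1r.
move: e; rewrite polyC0 subr0 => e.
have q0 : q != 0 by apply: contraNneq p0 => q0; rewrite e q0 mul0r.
have [|m [q' [h eq']]] := IH q _ q0.
  by move: hk; rewrite e size_mulX.
by exists m.+1, q'; split=> //; rewrite e eq' exprSr -!mulrA (mulrC q').
Qed.

Lemma inO_ex f : exists m, inO (v ^+ m * f).
Proof.
have [p [q [q0 ->]]] := fracP f; have [m [q' [h ->]]] := poly_X_factor q0.
exists m, p, q'; split=> //; rewrite frKM frKXn frKX.
by rewrite invfM mulrCA mulVKf ?vX_neq0.
Qed.

Lemma inO_ex_fin (I : finType) (f : I -> F) : exists m, forall i, inO (v ^+ m * f i).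
Proof.
have h : forall i, {m | inO (v ^+ m * f i)} by move=> i; apply: constructive_indefinite_description (inO_ex _).
exists (\sum_i sval (h i))%N => i; rewrite (bigD1 i) //= exprD -mulrA mulrCA.
by apply: inOM (inOXv _) (svalP (h i)).
Qed.

(** If [f] were nonzero, some [v ^+ m / f] would be regular; multiplied by [f / v ^+ m.+1] and by
    [v] it gives 1, whose constant term would then be 0. *)
Lemma inO_all0 f : (forall m, inO (f / v ^+ m)) -> f = 0.
Proof.
move=> h; apply/eqP/negPn/negP=> f0.
have [m hm] := inO_ex f^-1.
have := h m.+1 => hf.
have e : v ^+ m * f^-1 * (f / v ^+ m.+1) * v = 1.
  rewrite exprS.
  apply: (@mulV_cancel F (v ^+ m) f v).
  - by rewrite expf_neq0 ?v_neq0.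
  - by [].
  - exact: v_neq0.
have := ct1; rewrite -e ctM ?ctv ?mulr0; last 2 first.
- exact: inOM.
- exact: inOv.
by move/eqP; rewrite eq_sym oner_eq0.
Qed.

(* The residue field [R] is formally real, so leading terms of squares cannot cancel. *)
Lemma inO_sumsq (I : finType) (u f : I -> F) :
  (forall i, inO (u i)) -> (forall i, ct (u i) = 1) ->
  inO (\sum_i u i * f i ^+ 2) -> forall i, inO (f i).
Proof.
move=> uO u1 sO; have [m hm] := inO_ex_fin f.
elim: m hm => [|m IH] hm; first by move=> i; have := hm i; rewrite expr0 mul1r.
apply: IH => i. apply: inO_ct0_iff => //.
have e : \sum_i u i * (v ^+ m.+1 * f i) ^+ 2 = v ^+ (m.+1 * 2) * \sum_i u i * f i ^+ 2.
  by rewrite mulr_sumr; apply: eq_bigr => k _; rewrite exprMn -exprM mulrCA.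
have := congr1 (@ct R) e; rewrite mulSn [X in _ = X -> _]ct_vM //.
have h k : inO (u k * (v ^+ m.+1 * f k) ^+ 2) by apply: inOM => //; exact: inOX.
rewrite ct_sum; last by move=> k _; exact: h.
have hc k : ct (u k * (v ^+ m.+1 * f k) ^+ 2) = ct (v ^+ m.+1 * f k) ^+ 2.
  rewrite ctM //; last exact: inOX.
  by rewrite u1 mul1r ctX.
under eq_bigr => k _ do rewrite hc.
move/eqP; rewrite psumr_eq0; last by move=> k _; exact: sqr_ge0.
move/allP => /(_ i (mem_index_enum i)) /=; rewrite sqrf_eq0 => /eqP; exact.
Qed.

(** A vanishing sum still vanishes after all [f i] are divided by a power of [v]. By the regularity
    criterion each [f i] is thus divisible by every power of [v]. *)
Lemma sumsq_eq0 (I : finType) (u f : I -> F) :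
  (forall i, inO (u i)) -> (forall i, ct (u i) = 1) ->
  \sum_i u i * f i ^+ 2 = 0 -> forall i, f i = 0.
Proof.
move=> uO u1 s0 i; apply: inO_all0 => m.
apply: (inO_sumsq (u := u) (f := fun i => f i / v ^+ m)) => //.
have -> : \sum_j u j * (f j / v ^+ m) ^+ 2 = (\sum_j u j * f j ^+ 2) / v ^+ m ^+ 2.
  by rewrite mulr_suml; apply: eq_bigr => j _; rewrite exprMn exprVn mulrA.
by rewrite s0 mul0r; exact: inO0.
Qed.

End LocalRing.

(** * The bar involution and the Kazhdan-Lusztig bases *)

Section BarField.
Variable R : realType.
Local Notation F := (K R).
Local Notation v := (vK R).
Implicit Types (f g : F) (p q : {poly R}).

Lemma pKE (c : R) : pK c = frK c%:P. Proof. by []. Qed.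
Lemma pK_zmod : zmod_morphism (@pK R).
Proof. by move=> a b; rewrite !pKE polyCB rmorphB. Qed.
HB.instance Definition _ := GRing.isZmodMorphism.Build R F (@pK R) pK_zmod.
Lemma pK_monoid : monoid_morphism (@pK R).
Proof. by split=> [|a b]; rewrite !pKE ?frK1 // polyCM frKM. Qed.
HB.instance Definition _ := GRing.isMonoidMorphism.Build R F (@pK R) pK_monoid.

Lemma evinvE p : evinv p = (map_poly (@pK R) p).[v^-1]. Proof. by []. Qed.
Lemma evinv_zmod : zmod_morphism (@evinv R).
Proof. by move=> a b; rewrite !evinvE rmorphB hornerD hornerN. Qed.
HB.instance Definition _ := GRing.isZmodMorphism.Build {poly R} F (@evinv R) evinv_zmod.
Lemma evinv_monoid : monoid_morphism (@evinv R).
Proof. by split=> [|a b]; rewrite !evinvE ?rmorph1 ?hornerC // rmorphM hornerM. Qed.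
HB.instance Definition _ := GRing.isMonoidMorphism.Build {poly R} F (@evinv R) evinv_monoid.

Lemma evinvX : evinv ('X : {poly R}) = v^-1.
Proof. by rewrite evinvE map_polyX hornerX. Qed.

(** The witness is the polynomial with reversed coefficients. *)
Lemma evinv_rev p : exists r, r.[0] = lead_coef p /\ v ^+ (size p).-1 * evinv p = frK r.
Proof.
exists (\sum_(i < size p) p`_i *: 'X^((size p).-1 - i)); split.
  have [->|p0] := eqVneq p 0; first by rewrite size_poly0 big_ord0 horner0 lead_coef0.
  rewrite horner_sum lead_coefE.
  have sp : (0 < size p)%N by rewrite size_poly_gt0.
  have hs : ((size p).-1 < size p)%N by rewrite prednK.
  rewrite (bigD1 (Ordinal hs)) //= subnn expr0 hornerZ hornerC mulr1 big1 ?addr0 // => i ni.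
  rewrite hornerZ hornerXn expr0n -[(_ == _)%N]negbK subn_eq0 -ltnNge.
  have -> : (i < (size p).-1)%N.
    rewrite ltn_neqAle; apply/andP; split; last by rewrite -ltnS prednK.
    by apply: contraNneq ni => e; apply/eqP/val_inj.
  by rewrite mulr0.
rewrite evinvE horner_coef size_map_poly mulr_sumr raddf_sum.
apply: eq_bigr => i _; rewrite coef_map /= -mul_polyC frKM frKXn frKX -pKE mulrCA.
congr (_ * _); rewrite exprVn.
have h : ((size p).-1 = (size p).-1 - i + i)%N.
  by rewrite subnK // -ltnS prednK //; apply: leq_ltn_trans (ltn_ord i).
by rewrite {1}h exprD mulfK // vX_neq0.
Qed.

Lemma evinv_eq0 p : (evinv p == 0) = (p == 0).
Proof.
apply/eqP/eqP => [e|->]; last by rewrite rmorph0.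
have [r [r0]] := evinv_rev p; rewrite e mulr0 => /esym/eqP; rewrite frK_eq0 => /eqP h.
by apply/eqP; rewrite -lead_coef_eq0 -r0 h horner0.
Qed.

(** [barK] is computed on the chosen representative of a fraction; cross-multiplication makes the
    result independent of it. *)
Lemma barK_frac p q : q != 0 -> barK (frK p / frK q) = evinv p / evinv q.
Proof.
move=> q0; set f := _ / _.
set p' := (generic_quotient.repr f).1; set q' := (generic_quotient.repr f).2.
have q0' : q' != 0 by exact: denom_ratioP.
have e : frK p / frK q = frK p' / frK q' by rewrite -repr_frac.
have fq : frK q != 0 by rewrite frK_eq0.
have fq' : frK q' != 0 by rewrite frK_eq0.
move/eqP: e; rewrite (eqr_div _ _ fq fq') -!frKM => /eqP/frK_inj e.
rewrite -[LHS]/(evinv p' / evinv q').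
have eq0 : evinv q != 0 by rewrite evinv_eq0.
have eq0' : evinv q' != 0 by rewrite evinv_eq0.
by apply/eqP; rewrite (eqr_div _ _ eq0' eq0) -!rmorphM /= e.
Qed.

Lemma barK_frK p : barK (frK p) = evinv p.
Proof. by rewrite -[frK p]divr1 -frK1 barK_frac ?oner_neq0 // rmorph1 divr1. Qed.

Lemma barK_zmod : zmod_morphism (@barK R).
Proof.
move=> f g; have [p [q [q0 ->]]] := fracP f; have [p' [q' [q0' ->]]] := fracP g.
have fq : frK q != 0 by rewrite frK_eq0.
have fq' : frK q' != 0 by rewrite frK_eq0.
have eq0 : evinv q != 0 by rewrite evinv_eq0.
have eq0' : evinv q' != 0 by rewrite evinv_eq0.
have h : q * q' != 0 by rewrite mulf_neq0.
have e1 : frK p / frK q - frK p' / frK q' = frK (p * q' - p' * q) / frK (q * q').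
  by rewrite -mulNr (addf_div _ _ fq fq') mulNr frKD frKN !frKM.
rewrite e1 !barK_frac // -(mulNr (evinv p')) (addf_div _ _ eq0 eq0') mulNr.
by rewrite rmorphB !rmorphM.
Qed.
HB.instance Definition _ := GRing.isZmodMorphism.Build F F (@barK R) barK_zmod.

Lemma barK_monoid : monoid_morphism (@barK R).
Proof.
split=> [|f g]; first by rewrite -frK1 barK_frK rmorph1.
have [p [q [q0 ->]]] := fracP f; have [p' [q' [q0' ->]]] := fracP g.
have h : q * q' != 0 by rewrite mulf_neq0.
by rewrite mulf_div -!frKM !barK_frac // mulf_div !rmorphM.
Qed.
HB.instance Definition _ := GRing.isMonoidMorphism.Build F F (@barK R) barK_monoid.

Lemma barKv : barK v = v^-1. Proof. by rewrite -frKX barK_frK evinvX. Qed.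
Lemma barKvV : barK v^-1 = v. Proof. by rewrite fmorphV /= barKv invrK. Qed.
Lemma barK_sub : barK (v - v^-1) = v^-1 - v.
Proof. by rewrite rmorphB /= barKv barKvV. Qed.

Lemma barK_eq0 f : (barK f == 0) = (f == 0). Proof. exact: fmorph_eq0. Qed.

(** The restriction to denominators [v ^+ m] is essential for the vanishing lemma below:
    [v / (1 + v ^+ 2)] is bar-invariant, regular and zero at 0, yet nonzero. *)
Definition Laur f := exists m p, f = frK p / v ^+ m.

Lemma Laur_frK p : Laur (frK p). Proof. by exists 0, p; rewrite expr0 divr1. Qed.
Lemma Laur0 : Laur 0. Proof. by rewrite -frK0; exact: Laur_frK. Qed.
Lemma Laur1 : Laur 1. Proof. by rewrite -frK1; exact: Laur_frK. Qed.
Lemma Laurv : Laur v. Proof. exact: (Laur_frK 'X). Qed.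
Lemma LaurV : Laur v^-1. Proof. by exists 1%N, 1; rewrite frK1 div1r expr1. Qed.
Lemma LaurM f g : Laur f -> Laur g -> Laur (f * g).
Proof.
move=> [m [p ->]] [m' [p' ->]]; exists (m + m')%N, (p * p').
by rewrite mulf_div -frKM exprD.
Qed.
Lemma LaurD f g : Laur f -> Laur g -> Laur (f + g).
Proof.
have vm : forall k, v ^+ k != 0 := @vX_neq0 R.
move=> [m [p ->]] [m' [p' ->]]; exists (m + m')%N, (p * 'X^m' + p' * 'X^m).
by rewrite (addf_div _ _ (vm m) (vm m')) -exprD frKD !frKM !frKXn frKX.
Qed.
Lemma LaurN f : Laur f -> Laur (- f).
Proof. by move=> [m [p ->]]; exists m, (- p); rewrite frKN mulNr. Qed.
Lemma LaurB f g : Laur f -> Laur g -> Laur (f - g).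
Proof. by move=> a b; apply: LaurD => //; exact: LaurN. Qed.
Lemma LaurX f m : Laur f -> Laur (f ^+ m).
Proof. by move=> h; elim: m => [|m IH]; rewrite ?expr0 ?exprS; [exact: Laur1|exact: LaurM]. Qed.
Lemma Laur_sum (I : Type) (r : seq I) (P : pred I) (f : I -> F) :
  (forall i, P i -> Laur (f i)) -> Laur (\sum_(i <- r | P i) f i).
Proof. by move=> h; elim/big_rec: _ => [|i x Pi hx]; [exact: Laur0|apply: LaurD => //; exact: h]. Qed.

(* By bar-invariance such a Laurent polynomial also vanishes at infinity. *)
Lemma Laur_bar_eq0 f : Laur f -> barK f = f -> inO f -> ct f = 0 -> f = 0.
Proof.
move=> [m [p e]] bf fO f0; apply/eqP/negPn/negP=> nf.
have vm : forall k, v ^+ k != 0 := @vX_neq0 R.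
have p0 : p != 0 by apply: contraNneq nf => p0; rewrite e p0 frK0 mul0r.
have [k [q [q0 ep]]] := poly_X_factor p0.
have e1 : v ^+ m * f = v ^+ k * frK q.
  by rewrite e ep frKM frKXn frKX mulrC (divfK (vm m)).
have [km|mk] := leqP k m.
  have : ct (v ^+ (m - k) * f) = q.[0].
    rewrite -ct_frK; congr (ct _); apply: (mulfI (vm k)).
    by rewrite mulrA -exprD subnKC.
  rewrite ctM ?f0 ?mulr0 //; last exact: inOXv.
  by move=> h; move: q0; rewrite -h eqxx.
pose r := 'X^(k - m) * q.
have er : f = frK r.
  apply: (mulfI (vm m)); rewrite e1 frKM frKXn frKX mulrA -exprD subnKC //.
  exact: ltnW.
have r0 : r.[0] = 0 by rewrite -ct_frK -er.
have rn : r != 0 by rewrite -frK_eq0 -er.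
have [r' [h' er']] := evinv_rev r.
have sr : (1 < size r)%N.
  rewrite ltnNge; apply/negP=> /size1_polyC rc; move: r0 rn; rewrite rc hornerC => ->.
  by rewrite eqxx.
have := congr1 (@ct R) er'; rewrite -barK_frK -er bf ct_frK h'.
rewrite ctM ?f0 ?mulr0 //; last exact: inOXv.
by move/esym/eqP; rewrite lead_coef_eq0 (negPf rn).
Qed.

End BarField.

(** * Integral polynomials in the inverse of the parameter *)

Section NegPowers.
Variable R : realType.
Local Notation F := (K R).
Local Notation v := (vK R).
Implicit Types f g : F.

Definition evZ (p : {poly int}) : F := (map_poly (fun z : int => z%:~R : F) p).[v^-1].
Lemma evZ_zmod : zmod_morphism evZ.
Proof. by move=> a b; rewrite /evZ rmorphB hornerD hornerN. Qed.
HB.instance Definition _ := GRing.isZmodMorphism.Build {poly int} F evZ evZ_zmod.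
Lemma evZ_monoid : monoid_morphism evZ.
Proof. by split=> [|a b]; rewrite /evZ ?rmorph1 ?hornerC // rmorphM hornerM. Qed.
HB.instance Definition _ := GRing.isMonoidMorphism.Build {poly int} F evZ evZ_monoid.

Definition npZ f := exists p, f = evZ p.

Lemma npZD f g : npZ f -> npZ g -> npZ (f + g).
Proof. by move=> [p ->] [q ->]; exists (p + q); rewrite rmorphD. Qed.
Lemma npZM f g : npZ f -> npZ g -> npZ (f * g).
Proof. by move=> [p ->] [q ->]; exists (p * q); rewrite rmorphM. Qed.
Lemma npZN f : npZ f -> npZ (- f).
Proof. by move=> [p ->]; exists (- p); rewrite rmorphN. Qed.
Lemma npZ_int (z : int) : npZ z%:~R.
Proof. by exists z%:P; rewrite /evZ map_polyC hornerC. Qed.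
Lemma npZ0 : npZ 0. Proof. exact: (npZ_int 0). Qed.
Lemma npZ1 : npZ 1. Proof. exact: (npZ_int 1). Qed.
Lemma evZX : evZ 'X = v^-1. Proof. by rewrite /evZ map_polyX hornerX. Qed.
Lemma npZV : npZ v^-1. Proof. by exists 'X; rewrite evZX. Qed.

Lemma negAP f : negA f <-> exists2 g, npZ g & f = v^-1 * g.
Proof.
split=> [[p [p0 ->]]|[g [p ->] ->]]; last first.
  exists ('X * p); split; first by rewrite coefXM.
  by rewrite -[RHS]/(evZ _) rmorphM /= evZX.
have /factor_theorem[q ->] : root p 0 by rewrite /root horner_coef0 p0.
rewrite polyC0 subr0 -[(_).[_]]/(evZ _) rmorphM /= evZX mulrC.
by exists (evZ q) => //; exists q.
Qed.

Lemma negA0 : negA (0 : F).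
Proof. by apply/negAP; exists 0; [exact: npZ0|rewrite mulr0]. Qed.
Lemma negAD f g : negA f -> negA g -> negA (f + g).
Proof.
move=> /negAP[a ha ->] /negAP[b hb ->]; apply/negAP; exists (a + b); first exact: npZD.
by rewrite mulrDr.
Qed.
Lemma negAM f g : npZ f -> negA g -> negA (f * g).
Proof.
move=> ha /negAP[b hb ->]; apply/negAP; exists (f * b); first exact: npZM.
by rewrite mulrCA.
Qed.
Lemma negAN f : negA f -> negA (- f).
Proof. by move=> h; rewrite -mulN1r; apply: negAM h; apply: npZN npZ1. Qed.
Lemma negAB f g : negA f -> negA g -> negA (f - g).
Proof. by move=> a b; apply: negAD a (negAN b). Qed.
Lemma negAV g : npZ g -> negA (v^-1 * g).
Proof. by move=> h; apply/negAP; exists g. Qed.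
Lemma npZ_negA f : negA f -> npZ f.
Proof. by move=> /negAP[g hg ->]; apply: npZM npZV hg. Qed.
Lemma npZ_vnegA f : negA f -> npZ (v * f).
Proof. by move=> /negAP[g hg ->]; rewrite mulVKf ?v_neq0. Qed.
Lemma npZ_ct f : npZ f -> exists c : int, negA (f - c%:~R).
Proof.
move=> [p ->]; exists p`_0, (p - (p`_0)%:P); split; first by rewrite coefB coefC subrr.
rewrite -[RHS]/(evZ _) rmorphB /=; congr (_ - _).
by rewrite /evZ map_polyC hornerC.
Qed.
Lemma negA_sum (I : Type) (r : seq I) (P : pred I) (f : I -> F) :
  (forall i, P i -> negA (f i)) -> negA (\sum_(i <- r | P i) f i).
Proof. by move=> h; elim/big_rec: _ => [|i x Pi hx]; [exact: negA0|apply: negAD => //; exact: h]. Qed.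

Definition posP f := exists p : {poly R}, p.[0] = 0 /\ f = frK p.

Lemma barK_negA f : negA f -> posP (barK f).
Proof.
move=> [p [p0 ->]]; exists (map_poly intr p); split.
  by rewrite horner_coef0 coef_map /= p0 rmorph0.
have -> : barK (map_poly (fun z : int => z%:~R : F) p).[v^-1] =
          (map_poly (fun z : int => z%:~R : F) p).[v].
  rewrite -horner_map /= barKvV -map_poly_comp /=; congr (_.[_]).
  by apply: eq_map_poly => z /=; rewrite rmorph_int.
elim/poly_ind: p {p0} => [|p c IH]; first by rewrite !rmorph0 horner0.
rewrite !rmorphD !rmorphM /= !map_polyX !map_polyC /= hornerD hornerM hornerX hornerC IH.
by rewrite frKX -pKE !rmorph_int.
Qed.

Lemma posP_O f : posP f -> [/\ Laur f, inO f & ct f = 0].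
Proof. by move=> [p [p0 ->]]; split; [exact: Laur_frK|exact: inO_frK|rewrite ct_frK]. Qed.

Lemma negA_bar f : negA f -> barK f = f -> f = 0.
Proof.
move=> nf bf; have := barK_negA nf; rewrite bf => /posP_O[h1 h2 h3].
exact: Laur_bar_eq0.
Qed.
End NegPowers.

HB.lock Definition bH (R : realType) (n : nat) (h : hecke R n) : hecke R n := barH h.

Section BarHecke.
Variables (R : realType) (n : nat).
Local Notation H := (hecke R n).
Local Notation F := (K R).
Local Notation v := (vK R).
Local Notation T := (@T R n).
Implicit Types (s t w x y d u : 'S_n) (h : H).

Local Notation bH := (@bH R n).
Lemma bHdef h : barH h = bH h. Proof. by rewrite bH.unlock. Qed.
Definition IT w : H := Tinvinv R (len w) w.
Definition Tsinv s : H := T s - (v - v^-1) *: 1.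

Lemma bHE h : bH h = \sum_w barK (h w) *: IT w. Proof. by rewrite -bHdef. Qed.

Lemma TsK s : s \in Sgen n -> T s * Tsinv s = 1.
Proof.
by move=> sS; rewrite /Tsinv mulrBr -scalerAr mulr1 Ts2 // addrK.
Qed.
Lemma TsVK s : s \in Sgen n -> Tsinv s * T s = 1.
Proof.
by move=> sS; rewrite /Tsinv mulrBl -scalerAl mul1r Ts2 // addrK.
Qed.

Lemma IT1 : IT 1%g = 1. Proof. by rewrite /IT len1. Qed.

Lemma ITE w : w != 1%g -> exists2 s : 'S_n, (s \in Sgen n) && desc s w & IT w = Tsinv s * IT (s * w)%g.
Proof.
move=> w1; rewrite /IT; case e : (len w) => [|k].
  by move: w1; rewrite -len_eq0 e.
rewrite /=; case: pickP => [s /andP[sS ds]|none].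
  exists s; first by rewrite sS.
  have -> : len (s * w)%g = k by have := len_desc sS ds; rewrite e => -[].
  rewrite -[mulT s _]/(mulTl s (Tinvinv R k (s * w)%g)) mulTlM //.
  by rewrite /Tsinv mulrBl -scalerAl mul1r.
have [s sS ds] := ex_desc w1.
by have := none s; rewrite /= sS; move: ds; rewrite /desc => ->.
Qed.

(** [Tinvinv] follows a reduced word picked arbitrarily. Recognising the result as the inverse of
    [T (w^-1)] frees it from that choice. *)
Lemma IT_inv w : IT w * T (w^-1)%g = 1 /\ T (w^-1)%g * IT w = 1.
Proof.
have [m] := ubnP (len w); elim: m w => // m IH w hm.
have [->|w1] := eqVneq w 1%g; first by rewrite IT1 invg1 T1 mulr1.
have [s /andP[sS ds] ->] := ITE w1.
have lw := len_desc sS ds; have [|h1 h2] := IH (s * w)%g; first by lia.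
have a : ~~ rdesc (w^-1 * s)%g s by rewrite rdesc_mul // -descV // ds.
have e : T (w^-1)%g = T ((s * w)^-1)%g * T s.
  by rewrite invMg (sgenV sS) TMs // sgenKr.
rewrite e; split.
  by rewrite -mulrA [X in _ * X]mulrA h1 mul1r TsVK.
by rewrite -mulrA [X in _ * X]mulrA TsK // mul1r h2.
Qed.

Lemma IT_uniq w h : h * T (w^-1)%g = 1 -> h = IT w.
Proof. by move=> e; have [_ h2] := IT_inv w; rewrite -[h]mulr1 -h2 mulrA e mul1r. Qed.

Lemma IT_asc s w : s \in Sgen n -> ~~ desc s w -> IT (s * w)%g = Tsinv s * IT w.
Proof.
move=> sS a; symmetry; apply: IT_uniq.
have -> : T ((s * w)^-1)%g = T (w^-1)%g * T s.
  by rewrite invMg (sgenV sS) TMs // -descV.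
have [h1 _] := IT_inv w.
by rewrite -mulrA [X in _ * X]mulrA h1 mul1r TsVK.
Qed.

Lemma bHD h h' : bH (h + h') = bH h + bH h'.
Proof.
rewrite !bHE -big_split; apply: eq_bigr => w _ /=.
by rewrite addHE rmorphD scalerDl.
Qed.
Lemma bHZ (a : F) h : bH (a *: h) = barK a *: bH h.
Proof.
rewrite !bHE scaler_sumr; apply: eq_bigr => w _ /=.
by rewrite scaleHE rmorphM scalerA.
Qed.
Lemma bH0 : bH 0 = 0. Proof. by have := bHZ 0 0; rewrite scale0r rmorph0 scale0r. Qed.
Lemma bHN h : bH (- h) = - bH h.
Proof. by have := bHZ (-1) h; rewrite rmorphN rmorph1 !scaleN1r. Qed.
Lemma bH_sum (I : Type) (r : seq I) (P : pred I) (f : I -> H) :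
  bH (\sum_(i <- r | P i) f i) = \sum_(i <- r | P i) bH (f i).
Proof. exact: (big_morph bH bHD bH0). Qed.

Lemma bHT w : bH (T w) = IT w.
Proof.
rewrite bHE (bigD1 w) //= TE eqxx rmorph1 scale1r big1 ?addr0 // => y yw.
by rewrite TE (negPf yw) rmorph0 scale0r.
Qed.
Lemma bH1 : bH 1 = 1. Proof. by rewrite -T1 bHT IT1. Qed.

Lemma bHTs s h : s \in Sgen n -> bH (T s * h) = Tsinv s * bH h.
Proof.
move=> sS; rewrite (hecke_basis h) mulr_sumr !bH_sum mulr_sumr; apply: eq_bigr => w _.
rewrite -scalerAr !bHZ -scalerAr; congr (_ *: _); rewrite bHT.
have [ds|a] := boolP (desc s w); last by rewrite TsM // bHT IT_asc.
have a : ~~ desc s (s * w)%g by rewrite desc_mul // ds.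
have e : IT w = Tsinv s * IT (s * w)%g by rewrite -IT_asc // sgenK.
have eT : T w = T s * T (s * w)%g by rewrite TsM // sgenK.
(* The inverse of [T s] satisfies the quadratic relation with [v] and [v^-1] exchanged, which is
   exactly what bar makes of the relation for [T s]. *)
have q2 : Tsinv s * Tsinv s = 1 + (v^-1 - v) *: Tsinv s.
  by rewrite {1}/Tsinv mulrBl TsK // -scalerAl mul1r -scaleNr opprB.
rewrite eT mulrA Ts2 // mulrDl mul1r -scalerAl -eT bHD bHZ !bHT e barK_sub.
by rewrite mulrA q2 [RHS]mulrDl mul1r -scalerAl.
Qed.

Lemma bHTM w h : bH (T w * h) = IT w * bH h.
Proof.
have [m] := ubnP (len w); elim: m w => // m IH w hm.
have [->|w1] := eqVneq w 1%g; first by rewrite T1 IT1 !mul1r.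
have [s sS ds] := ex_desc w1; have lw := len_desc sS ds.
have a : ~~ desc s (s * w)%g by rewrite desc_mul // ds.
rewrite -{1 2}(sgenK w sS) -TsM // IT_asc // -mulrA bHTs // IH ?mulrA //; lia.
Qed.

Lemma bHM h h' : bH (h * h') = bH h * bH h'.
Proof.
rewrite {1 2}(hecke_basis h) mulr_suml !bH_sum mulr_suml; apply: eq_bigr => w _.
by rewrite -scalerAl !bHZ -scalerAl bHTM bHT.
Qed.

Lemma bH_flat h : bH (flat h) = flat (bH h).
Proof.
rewrite (hecke_basis h) flat_sum !bH_sum flat_sum; apply: eq_bigr => w _.
rewrite flatZ flatT !bHZ flatZ !bHT; congr (_ *: _).
symmetry; apply: IT_uniq; rewrite -flatT -flatM.
by have [_ ->] := IT_inv w; exact: flat1.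
Qed.

Lemma Tsinv_coef s h y : s \in Sgen n ->
  (Tsinv s * h) y = h (s * y)%g + (if desc s y then 0 else - ((v - v^-1) * h y)).
Proof.
move=> sS; rewrite /Tsinv mulrBl -scalerAl mul1r addHE oppHE scaleHE -mulTlM // mulTlE.
by case: ifP => _; ring.
Qed.

Lemma IT_tri w : IT w w = 1 /\ forall y, y != w -> (len w <= len y)%N -> IT w y = 0.
Proof.
have [m] := ubnP (len w); elim: m w => // m IH w hm.
have [->|w1] := eqVneq w 1%g.
  by rewrite IT1 -T1 TE eqxx; split=> // y y1 _; rewrite TE (negPf y1).
have [s /andP[sS ds] ->] := ITE w1.
have lw := len_desc sS ds; have [|h1 h2] := IH (s * w)%g; first by lia.
split=> [|y yw ly]; rewrite Tsinv_coef //; first by rewrite ds h1 addr0.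
have ne1 : (s * y != s * w)%g by rewrite (inj_eq (mulgI s)).
have ne2 : (y != s * w)%g by apply: contraTneq ly => ->; rewrite -ltnNge lw.
have l1 : (len y <= (len (s * y)%g).+1)%N.
  case: (boolP (desc s y)) => [d|a]; first by rewrite -len_desc.
  by rewrite len_asc // -addn2 leq_addr.
rewrite (h2 _ ne1) ?(h2 _ ne2); [|lia|lia].
by rewrite mulr0 oppr0 if_same addr0.
Qed.

(** Downward induction on length: once the coefficients at longer elements vanish, triangularity of
    bar makes the coefficient at [w] bar-invariant, and a bar-invariant element of [v^-1 Z[v^-1]] is
    0. *)
Lemma bar_neg0 h : bH h = h -> (forall y, negA (h y)) -> h = 0.
Proof.
move=> bh nh; apply/ffunP=> w; rewrite zeroHE.
have [m] := ubnP (#|[set: 'I_n * 'I_n]| - len w)%N; elim: m w => // m IH w hm.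
apply: negA_bar; first exact: nh.
rewrite -[in RHS]bh bHE sumHE (bigD1 w) //= scaleHE (IT_tri w).1 mulr1 big1 ?addr0 // => y yw.
rewrite scaleHE; have [ly|ly] := leqP (len y) (len w).
  by rewrite (IT_tri y).2 ?mulr0 // eq_sym.
rewrite IH ?rmorph0 ?mul0r //.
have : (len y <= #|[set: 'I_n * 'I_n]|)%N by apply: subset_leq_card; exact: subsetT.
by lia.
Qed.
End BarHecke.

(** * The Kazhdan-Lusztig basis: existence, uniqueness, symmetries *)

Section KLBasis.
Variables (R : realType) (n : nat).
Local Notation H := (hecke R n).
Local Notation F := (K R).
Local Notation v := (vK R).
Local Notation T := (@T R n).
Implicit Types (s t w x y d u : 'S_n) (h : H).

Definition CpH w : H := Cp R w.

Lemma isCp_uniq w h h' : isCp w h -> isCp w h' -> h = h'.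
Proof.
rewrite /isCp => -[]; rewrite bHdef => b1 n1 []; rewrite bHdef => b2 n2; apply/eqP; rewrite -subr_eq0; apply/eqP; apply: bar_neg0.
  by rewrite bHD bHN; congr (_ - _).
move=> y; rewrite addHE oppHE.
have -> : h y - h' y = (h y - Tb R w y) - (h' y - Tb R w y) by ring.
exact: negAB (n1 y) (n2 y).
Qed.

Lemma isCp_Cp w h : isCp w h -> CpH w = h.
Proof.
move=> ih; apply: (isCp_uniq (w := w)) => //.
by rewrite /CpH /Cp; apply: epsilon_spec; exists h.
Qed.

Definition kl_spec w h := [/\ isCp w h, h w = 1,
  forall y, y != w -> (len w <= len y)%N -> h y = 0 &
  forall s, s \in Sgen n -> desc s w -> T s * h = v *: h].

Lemma kl_neg w h y : isCp w h -> y != w -> negA (h y).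
Proof. by move=> [_ nh] yw; have := nh y; rewrite ffunE (negPf yw) subr0. Qed.

Lemma Tplus_coef s h y : s \in Sgen n ->
  ((T s + v^-1 *: 1) * h) y = h (s * y)%g + (if desc s y then v else v^-1) * h y.
Proof.
move=> sS; rewrite mulrDl -scalerAl mul1r addHE scaleHE -mulTlM // mulTlE -addrA.
congr (_ + _); case: ifP => _; last by rewrite add0r.
by rewrite -mulrDl subrK.
Qed.

(** The Kazhdan-Lusztig recursion. The factor [T s + v^-1] is [C'_s]; the product with [C'_(sw)] is
    bar-invariant, and integral multiples of shorter [C'_y] are subtracted to remove its constant
    terms. *)
Lemma kl_step s w : s \in Sgen n -> desc s w ->
  (forall y, (len y < len w)%N -> kl_spec y (CpH y)) ->
  exists h, [/\ isCp w h, h w = 1,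
    forall y, y != w -> (len w <= len y)%N -> h y = 0 & T s * h = v *: h].
Proof.
move=> sS ds IH; have lw := len_desc sS ds.
have lsw : (len (s * w)%g < len w)%N by rewrite lw.
have [isw sw1 sw0 _] := IH _ lsw.
pose g := (T s + v^-1 *: 1) * CpH (s * w)%g.
have ge y : g y = CpH (s * w)%g (s * y)%g + (if desc s y then v else v^-1) * CpH (s * w)%g y.
  by rewrite /g Tplus_coef.
have s_neq y : y != w -> (s * y != s * w)%g by move=> yw; rewrite (inj_eq (mulgI s)).
have desc_neq y : desc s y -> y != (s * w)%g.
  by move=> dy; apply: contraTneq dy => ->; rewrite desc_mul // ds.
(* When [s] is a descent of [y], a coefficient gets multiplied by [v], which may create a constant
   term, necessarily an integer. *)
have gnp y : y != w -> desc s y -> exists c : int, negA (g y - c%:~R).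
  move=> yw dy; apply: npZ_ct; rewrite ge dy; apply: npZD.
    by apply: npZ_negA; apply: kl_neg isw _; exact: s_neq.
  by apply: npZ_vnegA; apply: kl_neg isw _; exact: desc_neq.
have [c hc] : exists c : 'S_n -> int, forall y, y != w -> desc s y -> negA (g y - (c y)%:~R).
  have hex y : exists z : int, y != w -> desc s y -> negA (g y - z%:~R).
    have [yw|yw] := eqVneq y w; first by exists 0.
    have [dy|] := boolP (desc s y); last by exists 0.
    by have [z hz] := gnp y yw dy; exists z.
  exists (fun y => sval (constructive_indefinite_description _ (hex y))) => y.
  exact: svalP (constructive_indefinite_description _ (hex y)).
(* Constant terms arise only at [y] with [s] as a descent, and precisely these [C'_y] are
   eigenvectors of [T s] with eigenvalue [v], so the correction preserves the eigenvector
   property. *)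
pose P y := (len y < len w)%N && desc s y.
pose h := g - \sum_(y | P y) (c y)%:~R *: CpH y.
have he z : h z = g z - \sum_(y | P y) (c y)%:~R * CpH y z.
  rewrite /h addHE oppHE; congr (_ - _); rewrite sumHE; apply: eq_bigr => y _.
  by rewrite scaleHE.
have big z : (len w <= len z)%N -> \sum_(y | P y) (c y)%:~R * CpH y z = 0.
  move=> lz; apply: big1 => y /andP[ly _]; have [_ _ y0 _] := IH _ ly.
  rewrite y0 ?mulr0 //; last by apply: leq_trans lz; exact: ltnW.
  by apply: contraTneq lz => ->; rewrite -ltnNge.
have neq_sw z : (len w <= len z)%N -> z != (s * w)%g.
  by move=> lz; apply: contraTneq lz => ->; rewrite -ltnNge.
have hw : h w = 1.
  rewrite he big // subr0 ge sw1 ds sw0 ?mulr0 ?addr0 //; last exact: ltnW.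
  exact: neq_sw.
have hz z : z != w -> (len w <= len z)%N -> h z = 0.
  move=> zw lz; rewrite he big // subr0 ge sw0 ?s_neq //; last first.
    rewrite -ltnS -lw (leq_trans lz) //; case: (boolP (desc s z)) => [d|a].
      by rewrite -len_desc.
    by rewrite len_asc // -addn2 leq_addr.
  rewrite sw0 ?mulr0 ?addr0 ?neq_sw //.
  by apply: leq_trans lz; exact: ltnW.
have lin : T s * (T s + v^-1 *: 1) = v *: (T s + v^-1 *: 1).
  rewrite mulrDr Ts2 // -scalerAr mulr1 -addrA -scalerDl subrK scalerDr scalerA.
  by rewrite mulfV ?v_neq0 // scale1r addrC.
exists h; split=> //.
- split.
    rewrite bHdef /h bHD bHN bH_sum; congr (_ - _).
      rewrite /g bHM; have -> : bH (CpH (s * w)%g) = CpH (s * w)%g by case: isw => b _; rewrite -bHdef.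
      have -> // : bH (T s + v^-1 *: 1) = T s + v^-1 *: 1.
      rewrite bHD bHZ bH1 barKvV -[T s]mulr1 bHTs // bH1 !mulr1.
      by rewrite /Tsinv -addrA -scaleNr -scalerDl opprB subrK.
    apply: eq_bigr => y /andP[ly _]; rewrite bHZ rmorph_int.
    by have [[b _] _ _ _] := IH _ ly; rewrite -bHdef b.
  move=> z; rewrite [Tb R w z]ffunE; have [->|zw] := eqVneq z w.
    by rewrite hw subrr; exact: negA0.
  rewrite subr0; have [lz|lz] := leqP (len w) (len z); first by rewrite hz //; exact: negA0.
  have rest (Q : pred 'S_n) : (forall y, Q y -> P y && (z != y)) ->
      negA (\sum_(y | Q y) (c y)%:~R * CpH y z).
    move=> hQ; apply: negA_sum => y /hQ /andP[/andP[ly _] zy].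
    apply: negAM; first exact: npZ_int.
    by have [iy _ _ _] := IH _ ly; exact: kl_neg iy zy.
  rewrite he; have [dz|az] := boolP (desc s z).
    have Pz : P z by rewrite /P lz.
    rewrite (bigD1 z) //=; have [_ -> _ _] := IH _ lz; rewrite mulr1 opprD addrA.
    apply: negAB; first exact: hc.
    by apply: rest => y /andP[-> ]; rewrite eq_sym.
  apply: negAB.
    rewrite ge (negPf az); apply: negAD; first by apply: kl_neg isw _; exact: s_neq.
    have [->|zsw] := eqVneq z (s * w)%g; first by rewrite sw1; apply: negAV; exact: npZ1.
    by apply: negAV; apply: npZ_negA; exact: kl_neg isw zsw.
  apply: rest => y Py; rewrite Py; apply: contraNneq az => ->.
  by case/andP: Py.
- rewrite /h mulrBr scalerBr; congr (_ - _); first by rewrite /g mulrA lin -scalerAl.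
  rewrite mulr_sumr scaler_sumr; apply: eq_bigr => y /andP[ly dy].
  have [_ _ _ D] := IH _ ly.
  by rewrite -scalerAr D // !scalerA mulrC.
Qed.

Lemma klP w : kl_spec w (CpH w).
Proof.
have [m] := ubnP (len w); elim: m w => // m IH w hm.
have [->|w1] := eqVneq w 1%g.
  have e : CpH 1%g = 1.
    apply: isCp_Cp; split; first by rewrite bHdef bH1.
    by move=> y; rewrite -T1 subrr; exact: negA0.
  rewrite e; split.
  - split; first by rewrite bHdef bH1.
    by move=> y; rewrite -T1 subrr; exact: negA0.
  - by rewrite -T1 TE eqxx.
  - by move=> y y1 _; rewrite -T1 TE (negPf y1).
  - by move=> s _; rewrite (negPf (asc1 s)).
have IH' y : (len y < len w)%N -> kl_spec y (CpH y) by move=> ly; apply: IH; lia.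
have [s sS ds] := ex_desc w1; have [h [ih h1 h0 _]] := kl_step sS ds IH'.
have e := isCp_Cp ih.
(* The recursion run from any other descent [t] produces the same element by uniqueness, so the
   eigenvector property holds for all descents. *)
rewrite e; split=> // t tS dt; have [h' [ih' _ _ D]] := kl_step tS dt IH'.
by rewrite (isCp_uniq ih ih').
Qed.

Lemma Cp_bar w : bH (CpH w) = CpH w. Proof. by case: (klP w) => -[b _] _ _ _; rewrite -bHdef. Qed.
Lemma Cp_diag w : CpH w w = 1. Proof. by case: (klP w). Qed.
Lemma Cp_tri w y : y != w -> (len w <= len y)%N -> CpH w y = 0.
Proof. by move=> h1 h2; case: (klP w) => _ _ h _; exact: h. Qed.
Lemma Cp_neg w y : y != w -> negA (CpH w y).
Proof. by move=> h; case: (klP w) => i _ _ _; exact: kl_neg i h. Qed.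
Lemma Cp_desc s w : s \in Sgen n -> desc s w -> T s * CpH w = v *: CpH w.
Proof. by case: (klP w) => _ _ _; apply. Qed.

Lemma Cp_flat w : flat (CpH w) = CpH (w^-1)%g.
Proof.
symmetry; apply: isCp_Cp; split; first by rewrite bHdef bH_flat Cp_bar.
move=> y; rewrite flatE ffunE; have [->|yw] := eqVneq y (w^-1)%g.
  by rewrite invgK Cp_diag subrr; exact: negA0.
by rewrite subr0; apply: Cp_neg; apply: contraNneq yw => <-; rewrite invgK.
Qed.

(* The semilinear ring automorphism [T_w -> eps_w T_w], [v -> v^-1], which carries
   [C'_w] to [eps_w C_w]. *)
Definition jH h : H := [ffun w => eps R w * barK (h w)].
Lemma jHE h w : jH h w = eps R w * barK (h w). Proof. by rewrite ffunE. Qed.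
Lemma eps_sq w : eps R w * eps R w = 1.
Proof. by rewrite /eps -expr2 sqrr_sign. Qed.
Lemma eps_neq0 w : eps R w != 0. Proof. by rewrite /eps signr_eq0. Qed.
Lemma epsV w : eps R (w^-1)%g = eps R w. Proof. by rewrite /eps lenV. Qed.
Lemma barK_eps w : barK (eps R w) = eps R w.
Proof. by rewrite /eps rmorph_sign. Qed.
Lemma eps_s s w : s \in Sgen n -> eps R (s * w)%g = - eps R w.
Proof.
move=> sS; rewrite /eps; have [d|a] := boolP (desc s w).
  by rewrite (len_desc sS d) exprS mulN1r opprK.
by rewrite (len_asc sS a) exprS mulN1r.
Qed.

Lemma jHD h h' : jH (h + h') = jH h + jH h'.
Proof. by apply/ffunP=> w; rewrite addHE !jHE addHE rmorphD mulrDr. Qed.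
Lemma jHZ (a : F) h : jH (a *: h) = barK a *: jH h.
Proof. by apply/ffunP=> w; rewrite scaleHE !jHE scaleHE rmorphM mulrCA. Qed.
Lemma jH0 : jH 0 = 0. Proof. by have := jHZ 0 0; rewrite scale0r rmorph0 scale0r. Qed.
Lemma jH_sum (I : Type) (r : seq I) (P : pred I) (f : I -> H) :
  jH (\sum_(i <- r | P i) f i) = \sum_(i <- r | P i) jH (f i).
Proof. exact: (big_morph jH jHD jH0). Qed.
Lemma jHT w : jH (T w) = eps R w *: T w.
Proof.
apply/ffunP=> y; rewrite jHE scaleHE !TE.
by have [->|_] := eqVneq; rewrite ?rmorph1 // rmorph0 !mulr0.
Qed.
Lemma jH1 : jH 1 = 1. Proof. by rewrite -T1 jHT /eps len1 expr0 scale1r. Qed.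

Lemma jHTs s h : s \in Sgen n -> jH (T s * h) = - (T s * jH h).
Proof.
move=> sS; apply/ffunP=> y; rewrite oppHE -!mulTlM // mulTlE !jHE mulTlE.
rewrite eps_s // rmorphD; case: ifP => _; last by rewrite rmorph0; ring.
by rewrite rmorphM /= barK_sub; ring.
Qed.

Lemma jHTM w h : jH (T w * h) = eps R w *: (T w * jH h).
Proof.
have [m] := ubnP (len w); elim: m w => // m IH w hm.
have [->|w1] := eqVneq w 1%g; first by rewrite T1 /eps len1 expr0 scale1r !mul1r.
have [s sS ds] := ex_desc w1; have lw := len_desc sS ds.
have a : ~~ desc s (s * w)%g by rewrite desc_mul // ds.
rewrite -{1 3}(sgenK w sS) -TsM // -mulrA jHTs // IH; last by lia.
by rewrite eps_s // -scalerAr scaleNr opprK mulrA.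
Qed.

Lemma jHM h h' : jH (h * h') = jH h * jH h'.
Proof.
rewrite {1 2}(hecke_basis h) mulr_suml !jH_sum mulr_suml; apply: eq_bigr => w _.
by rewrite -scalerAl !jHZ -scalerAl jHTM jHT -scalerAl.
Qed.

Lemma jH_bar h : bH (jH h) = jH (bH h).
Proof.
rewrite (hecke_basis h) !(jH_sum, bH_sum); apply: eq_bigr => w _.
rewrite bHZ !jHZ bHZ bHT jHT bHZ bHT barK_eps; congr (_ *: _).
have [e1 e2] := IT_inv R w.
have e3 : jH (IT R w) * T (w^-1)%g = eps R w *: 1.
  have := congr1 jH e1; rewrite jHM jHT jH1 epsV -scalerAr => <-.
  by rewrite scalerA eps_sq scale1r.
have e4 : eps R w *: jH (IT R w) = IT R w.
  by apply: IT_uniq; rewrite -scalerAl e3 scalerA eps_sq scale1r.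
by rewrite -{1}e4 scalerA eps_sq scale1r.
Qed.

Lemma jH_flat h : flat (jH h) = jH (flat h).
Proof. by apply/ffunP=> w; rewrite !(flatE, jHE) epsV. Qed.

End KLBasis.

HB.lock Definition C (R : realType) (n : nat) (w : 'S_n) : hecke R n :=
  eps R w *: jH (CpH R w).

Section CBasis.
Variables (R : realType) (n : nat).
Local Notation H := (hecke R n).
Local Notation F := (K R).
Local Notation v := (vK R).
Local Notation T := (@T R n).
Local Notation C := (@C R n).
Local Notation CpH := (@CpH R n).
Implicit Types (s t w x y d u : 'S_n) (h : H).

Lemma Cdef w : C w = eps R w *: jH (CpH w). Proof. by rewrite C.unlock. Qed.

Lemma C_bar w : bH (C w) = C w.
Proof. by rewrite Cdef bHZ barK_eps jH_bar Cp_bar. Qed.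
Lemma C_diag w : C w w = 1.
Proof. by rewrite Cdef scaleHE jHE Cp_diag rmorph1 mulr1 eps_sq. Qed.
Lemma C_tri w y : y != w -> (len w <= len y)%N -> C w y = 0.
Proof. by move=> h1 h2; rewrite Cdef scaleHE jHE Cp_tri // rmorph0 !mulr0. Qed.

Lemma C_off w y : y != w -> [/\ Laur (C w y), inO (C w y) & ct (C w y) = 0].
Proof.
move=> yw; have [h1 h2 h3] := posP_O (barK_negA (Cp_neg R yw)).
have hs k : inO ((-1) ^+ k : F) by apply: inOX; exact: inON1.
have hl k : Laur ((-1) ^+ k : F) by apply: LaurX; apply: LaurN; exact: Laur1.
rewrite Cdef scaleHE jHE mulrA; split; first by apply: LaurM h1; apply: LaurM; exact: hl.
  by apply: inOM h2; apply: inOM; exact: hs.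
by rewrite ctM ?h3 ?mulr0 //; apply: inOM; exact: hs.
Qed.

Lemma C_desc s w : s \in Sgen n -> desc s w -> T s * C w = - v^-1 *: C w.
Proof.
move=> sS ds; rewrite Cdef -scalerAr -[T s * _]opprK -jHTs // Cp_desc // jHZ barKv.
by rewrite -scaleNr !scalerA mulrC.
Qed.

Lemma C_flat w : flat (C w) = C (w^-1)%g.
Proof. by rewrite !Cdef flatZ jH_flat Cp_flat epsV. Qed.

Lemma C_rdesc s w : s \in Sgen n -> rdesc w s -> C w * T s = - v^-1 *: C w.
Proof.
move=> sS; rewrite rdescV // => ds.
by rewrite -[C w * T s]flatK flatM flatT C_flat (sgenV sS) C_desc // flatZ C_flat invgK.
Qed.

End CBasis.

(** * Cell preorders *)

Section Coordinates.
Variables (R : realType) (n : nat).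
Local Notation H := (hecke R n).
Local Notation F := (K R).
Local Notation v := (vK R).
Local Notation T := (@T R n).
Local Notation C := (@C R n).
Implicit Types (s t w x y z d u : 'S_n) (h : H).

Lemma len_max w : (len w <= #|[set: 'I_n * 'I_n]|)%N.
Proof. by apply: subset_leq_card; exact: subsetT. Qed.

Section Triangular.
Variable B : 'S_n -> H.
Hypothesis B1 : forall w, B w w = 1.
Hypothesis B0 : forall w y, y != w -> (len w <= len y)%N -> B w y = 0.

(** [S] stands for a subring of scalars: the trivial predicate yields spanning, and [Laur] yields
    Laurent coordinates. The elimination starts from the longest elements. *)
Lemma tri_span (S : F -> Prop) : S 0 -> (forall a b, S a -> S b -> S (a + b)) ->
  (forall a b, S a -> S b -> S (a - b)) ->
  (forall a b, S a -> S b -> S (a * b)) -> (forall w y, S (B w y)) ->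
  forall h, (forall y, S (h y)) ->
  exists c : {ffun 'S_n -> F}, (forall y, S (c y)) /\ h = \sum_w c w *: B w.
Proof.
move=> S0 SD SB SM SBw h.
have : forall y, (#|[set: 'I_n * 'I_n]|.+1 <= len y)%N -> h y = 0.
  by move=> y hy; have := len_max y; lia.
elim: {1}_.+1 h => [|m IH] h hm Sh.
  exists 0; split=> [y|]; first by rewrite ffunE.
  by rewrite big1 => [|w _]; [apply/ffunP=> y; rewrite zeroHE hm|rewrite ffunE scale0r].
have SS (P : pred 'S_n) (f : 'S_n -> F) : (forall w, S (f w)) -> S (\sum_(w | P w) f w).
  by move=> hf; elim/big_rec: _ => // i a _ Sa; apply: SD.
pose h' : H := h - \sum_(w | len w == m) h w *: B w.
have h'E y : h' y = h y - \sum_(w | len w == m) h w * B w y.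
  by rewrite /h' addHE oppHE; congr (_ - _); rewrite sumHE; apply: eq_bigr => w _; rewrite scaleHE.
have h'0 y : (m <= len y)%N -> h' y = 0.
  move=> ly; rewrite h'E; have [e|ne] := eqVneq (len y) m.
    rewrite (bigD1 y) /= ?e // B1 mulr1 big1 ?addr0 ?subrr // => w /andP[/eqP lw wy].
    by rewrite B0 ?mulr0 // ?lw // eq_sym.
  have ly' : (m < len y)%N by rewrite ltn_neqAle eq_sym ne.
  rewrite hm // big1 ?subrr // => w /eqP lw.
  rewrite B0 ?mulr0 //; last by rewrite lw ltnW.
  by apply: contraTneq ly' => ->; rewrite lw ltnn.
have Sh' y : S (h' y) by rewrite h'E; apply: SB => //; apply: SS => w; apply: SM.
have [c [Sc e]] := IH h' h'0 Sh'.
exists [ffun w => c w + (if len w == m then h w else 0)]; split=> [y|].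
  by rewrite ffunE; apply: SD => //; case: ifP.
transitivity (h' + \sum_(w | len w == m) h w *: B w); first by rewrite /h' subrK.
rewrite {1}e [X in _ + X]big_mkcond -big_split /=; apply: eq_bigr => w _.
by rewrite ffunE scalerDl; case: (len w == m); rewrite ?scale0r.
Qed.

Lemma tri_indep (c : 'S_n -> F) : \sum_w c w *: B w = 0 -> forall w, c w = 0.
Proof.
move=> e w; have [m] := ubnP (#|[set: 'I_n * 'I_n]| - len w)%N.
elim: m w => // m IH w hm.
have /ffunP/(_ w) := e; rewrite sumHE zeroHE (bigD1 w) //= scaleHE B1 mulr1.
rewrite big1 ?addr0 // => y yw; rewrite scaleHE.
have [ly|ly] := leqP (len y) (len w); first by rewrite B0 ?mulr0 // eq_sym.
by rewrite IH ?mul0r //; have := len_max y; lia.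
Qed.

Lemma tri_uniq (c c' : 'S_n -> F) :
  \sum_w c w *: B w = \sum_w c' w *: B w -> c =1 c'.
Proof.
move=> e w; apply/eqP; rewrite -subr_eq0; apply/eqP.
apply: (tri_indep (c := fun w => c w - c' w)).
rewrite -[RHS](subrr (\sum_w c w *: B w)) {2}e -sumrB.
by apply: eq_bigr => y _; rewrite scalerBl.
Qed.
End Triangular.

Lemma C_Laur w y : Laur (C w y).
Proof.
have [->|yw] := eqVneq y w; last by case: (C_off R yw).
by rewrite C_diag; exact: Laur1.
Qed.

Lemma coC_ex h : exists c : {ffun 'S_n -> F},
  ((forall y, Laur (h y)) -> forall y, Laur (c y)) /\ h = \sum_w c w *: C w.
Proof.
have B1 := @C_diag R n; have B0 := @C_tri R n.
have [c [_ e]] := tri_span B1 B0 (S := fun=> True) I (fun _ _ _ _ => I) (fun _ _ _ _ => I)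
  (fun _ _ _ _ => I) (fun _ _ => I) (h := h) (fun=> I).
exists c; split=> // hL.
have [c' [L e']] := tri_span B1 B0 (@Laur0 R) (@LaurD R) (@LaurB R) (@LaurM R) C_Laur hL.
by move=> y; rewrite (tri_uniq B1 B0 (c := c) (c' := c')) // -e -e'.
Qed.

Definition coC h : {ffun 'S_n -> F} := sval (constructive_indefinite_description _ (coC_ex h)).

Lemma coCE h : h = \sum_w coC h w *: C w.
Proof. by case: (svalP (constructive_indefinite_description _ (coC_ex h))). Qed.

Lemma coC_Laur h : (forall y, Laur (h y)) -> forall y, Laur (coC h y).
Proof. by case: (svalP (constructive_indefinite_description _ (coC_ex h))). Qed.

Lemma coC_uniq h (c : 'S_n -> F) : h = \sum_w c w *: C w -> coC h =1 c.
Proof.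
move=> e; apply: (tri_uniq (@C_diag R n) (@C_tri R n)).
by rewrite -e -coCE.
Qed.

Lemma coCD h h' w : coC (h + h') w = coC h w + coC h' w.
Proof.
apply: (coC_uniq (c := fun w => coC h w + coC h' w)).
rewrite {1}(coCE h) {1}(coCE h') -big_split; apply: eq_bigr => y _ /=.
by rewrite scalerDl.
Qed.
Lemma coCZ (a : F) h w : coC (a *: h) w = a * coC h w.
Proof.
apply: (coC_uniq (c := fun w => a * coC h w)).
rewrite {1}(coCE h) scaler_sumr; apply: eq_bigr => y _ /=.
by rewrite scalerA.
Qed.
Lemma coC0 w : coC 0 w = 0.
Proof. by have := coCZ 0 0 w; rewrite scale0r mul0r. Qed.
Lemma coC_sum (I : Type) (r : seq I) (P : pred I) (f : I -> H) w :
  coC (\sum_(i <- r | P i) f i) w = \sum_(i <- r | P i) coC (f i) w.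
Proof.
elim/big_rec2: _ => [|i a b _ <-]; first exact: coC0.
exact: coCD.
Qed.
Lemma coC_C y w : coC (C y) w = (w == y)%:R.
Proof.
apply: (coC_uniq (c := fun w => (w == y)%:R)).
rewrite (bigD1 y) //= eqxx scale1r big1 ?addr0 // => z zy.
by rewrite (negPf zy) scale0r.
Qed.

Lemma coC_flat h w : coC (flat h) (w^-1)%g = coC h w.
Proof.
rewrite (coC_uniq (h := flat h) (c := fun y => coC h (y^-1)%g)) ?invgK //.
rewrite {1}(coCE h) flat_sum (reindex_inj invg_inj) /=; apply: eq_bigr => y _.
by rewrite flatZ C_flat invgK.
Qed.

Lemma coC_bar h : bH h = h -> forall w, barK (coC h w) = coC h w.
Proof.
move=> bh w; symmetry; apply: (coC_uniq (c := fun w => barK (coC h w))).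
rewrite -{1}bh {1}(coCE h) bH_sum; apply: eq_bigr => y _.
by rewrite bHZ C_bar.
Qed.

Lemma hcoefsE x y : CpH R x * CpH R y = \sum_z hxyz R x y z *: CpH R z.
Proof.
have [c [_ e]] := tri_span (@Cp_diag R n) (@Cp_tri R n) (S := fun=> True) I
  (fun _ _ _ _ => I) (fun _ _ _ _ => I)
  (fun _ _ _ _ => I) (fun _ _ => I) (h := CpH R x * CpH R y) (fun=> I).
pose P (c : {ffun 'S_n -> F}) := mulH (Cp R x) (Cp R y) = \sum_(z : 'S_n) scH (c z) (Cp R z).
have hP : P (hcoefs R x y).
  by apply: epsilon_spec; exists c; rewrite /P -/(CpH R x) mulHE.
by rewrite -mulHE; exact: hP.
Qed.

(** [jH] sends the structure constants of the basis [C'] to those of [C] up to signs and bar, which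
    do not affect vanishing. *)
Lemma edgeC s y x : (coC (C s * C y) x != 0) = (hxyz R s y x != 0).
Proof.
rewrite (coC_uniq (h := C s * C y)
  (c := fun z => eps R s * eps R y * eps R z * barK (hxyz R s y z))).
  have nz : eps R s * eps R y * eps R x != 0.
    by apply: mulf_neq0; [apply: mulf_neq0|]; exact: eps_neq0.
  by rewrite mulf_eq0 (negPf nz) barK_eq0.
rewrite !Cdef -scalerAl -scalerAr scalerA -jHM hcoefsE jH_sum scaler_sumr.
apply: eq_bigr => z _; rewrite jHZ Cdef !scalerA; congr (_ *: _).
by rewrite -[LHS]mulr1 -(eps_sq R z); move: (eps R s) (eps R y) (eps R z) => a b c; ring.
Qed.

Lemma edgeLP x y : reflect (exists2 s : 'S_n, s \in Sgen n & coC (C s * C y) x != 0)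
  (edgeL R x y).
Proof.
apply: (iffP existsP) => [[s /andP[sS hx]]|[s sS hx]]; exists s.
- exact: sS.
- by rewrite edgeC.
by rewrite sS -edgeC.
Qed.

(** Triangularity leaves only the coefficient at 1 unknown, and the eigenvalue [- v^-1] of [T s] on
    [C s] determines it. *)
Lemma C_s s : s \in Sgen n -> C s = T s - v *: 1.
Proof.
move=> sS.
have ds : desc s s by rewrite -{2}(mulg1 s) desc_mul // asc1.
have ls : len s = 1%N by rewrite (len_desc sS ds); have := sgenK 1%g sS; rewrite mulg1 => ->; rewrite len1.
have e : C s = T s + C s 1%g *: 1.
  apply/ffunP=> y; rewrite addHE scaleHE -T1 !TE.
  have [->|y1] := eqVneq y 1%g.
    have /negPf-> : (1 != s :> 'S_n)%g.
      by apply/eqP=> e; move: ls; rewrite -e len1.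
    by rewrite add0r mulr1.
  have [->|ys] := eqVneq y s; first by rewrite C_diag mulr0 addr0.
  have ly : (len s <= len y)%N by rewrite ls lt0n len_eq0.
  by rewrite (C_tri R ys ly) mulr0 addr0.
have := C_desc R sS ds; rewrite e mulrDr Ts2 // -scalerAr mulr1.
move/(congr1 (fun h : H => h 1%g)).
rewrite !(addHE, scaleHE) -!T1 !TE eqxx.
have /negPf-> : (1 != s :> 'S_n)%g by apply/eqP=> e'; move: ls; rewrite -e' len1.
rewrite !mulr0 !addr0 add0r mulr1 => e1.
have -> : C s 1%g = - v.
  have := congr1 (fun a => - v * a) e1; rewrite mulr1 => ->.
  by rewrite mulrA mulrNN mulfV ?v_neq0 // mul1r.
by rewrite scaleNr.
Qed.

(** Membership in the span of the [C x] with [x] below [y] in the left preorder. Writing [T s] as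
    [C s + v] shows that this span is a left ideal. *)
Definition lowerL y h := forall x, coC h x != 0 -> leL R x y.

Lemma lowerLD y h h' : lowerL y h -> lowerL y h' -> lowerL y (h + h').
Proof.
move=> hg hg' z; rewrite coCD => nz.
have [/eqP e|l] := boolP (coC h z == 0); last exact: hg l.
by apply: hg'; rewrite e add0r in nz.
Qed.

Lemma lowerLZ y (a : F) h : lowerL y h -> lowerL y (a *: h).
Proof. by move=> hg z; rewrite coCZ mulf_eq0 negb_or => /andP[_ /hg]. Qed.

Lemma lowerL0 y : lowerL y 0.
Proof. by move=> z; rewrite coC0 eqxx. Qed.

Lemma lowerL_sum y (I : finType) (f : I -> H) :
  (forall i, lowerL y (f i)) -> lowerL y (\sum_i f i).
Proof.
move=> hf; elim/big_rec: _ => [|i g _ hg]; first exact: lowerL0.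
exact: lowerLD (hf i) hg.
Qed.

Lemma lowerL_Ts s y h : s \in Sgen n -> lowerL y h -> lowerL y (T s * h).
Proof.
move=> sS hg; have -> : T s * h = C s * h + v *: h.
  by rewrite C_s // mulrBl -scalerAl mul1r subrK.
apply: lowerLD; last exact: lowerLZ.
rewrite {1}(coCE h) mulr_sumr; apply: lowerL_sum => z; rewrite -scalerAr.
have [e|nz] := altP (coC h z =P 0); first by rewrite e scale0r; exact: lowerL0.
apply: lowerLZ => x' hx'; apply: connect_trans (hg z nz).
by apply: connect1; apply/edgeLP; exists s.
Qed.

Lemma lowerL_T w y h : lowerL y h -> lowerL y (T w * h).
Proof.
move=> hg; elim/T_ind: w => [|s w sS a IH]; first by rewrite T1 mul1r.
by rewrite -(TsM R sS a) -mulrA; exact: lowerL_Ts.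
Qed.

Lemma leL_closed h y x : coC (h * C y) x != 0 -> leL R x y.
Proof.
suff : lowerL y (h * C y) by apply.
rewrite (hecke_basis h) mulr_suml; apply: lowerL_sum => w.
rewrite -scalerAl; apply: lowerLZ; apply: lowerL_T => z; rewrite coC_C.
by have [->|_] := eqVneq z y; [rewrite /leL connect0|rewrite eqxx].
Qed.

Lemma leR_closed h y x : coC (C y * h) x != 0 -> leR R x y.
Proof.
rewrite -coC_flat flatM C_flat; exact: leL_closed.
Qed.

Lemma leLR_L x y : leL R x y -> leLR R x y.
Proof. by move=> h; apply: connect1; rewrite h. Qed.
Lemma leLR_R x y : leR R x y -> leLR R x y.
Proof. by move=> h; apply: connect1; rewrite h orbT. Qed.
Lemma leLR_trans x y z : leLR R x y -> leLR R y z -> leLR R x z.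
Proof. exact: connect_trans. Qed.

Lemma leLR_closed h h' y x : coC (h * C y * h') x != 0 -> leLR R x y.
Proof.
rewrite (coCE (h * C y)) mulr_suml coC_sum => nz.
have [z hz] : exists z, coC (coC (h * C y) z *: C z * h') x != 0.
  apply/existsP; rewrite -[X in is_true X]negbK negb_exists; apply: contra nz => /forallP all0.
  by apply/eqP; apply: big1 => z _; apply/eqP; rewrite -[_ == _]negbK; exact: all0.
move: hz; rewrite -scalerAl coCZ mulf_eq0 negb_or => /andP[h1 h2].
apply: (leLR_trans (y := z)); first exact/leLR_R/(leR_closed h2).
exact/leLR_L/(leL_closed h1).
Qed.

(** If the [C y] with [G y] span a two-sided ideal, then [G] is closed downwards: each arrow of the
    preorder records a nonzero coordinate of a left product, or of a right product after [flat]. *)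
Lemma leLR_absorb (G : pred 'S_n) :
  (forall h y x, G y -> coC (h * C y) x != 0 -> G x) ->
  (forall h y x, G y -> coC (C y * h) x != 0 -> G x) ->
  forall x y, leLR R x y -> G y -> G x.
Proof.
move=> hl hr.
have GL x y : leL R x y -> G y -> G x.
  move=> /connectP[p]; elim: p x => [|z p IH] x /=; first by move=> _ ->.
  move=> /andP[/edgeLP[s sS hs] /IH h] /h h' /h' Gz.
  exact: hl Gz hs.
have GR x y : leR R x y -> G y -> G x.
  rewrite /leR => /connectP[p]; elim: p x => [|z p IH] x /=.
    by move=> _ /invg_inj ->.
  move=> /andP[/edgeLP[s sS hs] ph] eh Gy.
  have Gz : G (z^-1)%g by apply: IH Gy; rewrite invgK.
  by apply: (hr (flat (C s)) _ _ Gz); rewrite -coC_flat flatM flatK C_flat invgK.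
move=> x y /connectP[p]; elim: p x => [|z p IH] x /=; first by move=> _ ->.
move=> /andP[/orP[/GL|/GR] h /IH h'] /h' h'' /h'' Gz; exact: h.
Qed.
End Coordinates.

Lemma hecke_param (F : fieldType) (a : F) : a != 0 ->
  (- a^-1) * (- a^-1) = 1 + (a - a^-1) * (- a^-1).
Proof. by move=> a0; field. Qed.

(** * Sign idempotents of parabolic subalgebras *)

Section ParabolicElements.
Variables (R : realType) (n : nat) (b : 'I_n -> nat).
Hypothesis b_mono : forall i j : 'I_n, (i <= j)%N -> (b i <= b j)%N.
Local Notation H := (hecke R n).
Local Notation F := (K R).
Local Notation v := (vK R).
Local Notation T := (@T R n).
Local Notation W := (bgrp b).
Implicit Types (s t w x y z d u : 'S_n) (h : H).

Lemma big_cosets (V : nmodType) (f : 'S_n -> V) :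
  \sum_w f w = \sum_(d | rreduced b d) \sum_(u in W) f (d * u)%g.
Proof.
transitivity (\sum_w \sum_(d | rreduced b d && ((d^-1 * w)%g \in W)) f w).
  apply: eq_bigr => w _; have [d [u [dr uW e]]] := rreduced_ex b w.
  have dW : (d^-1 * w)%g \in W by rewrite e mulKg.
  rewrite (bigD1 d) /=; last by rewrite dr dW.
  rewrite big1 ?addr0 // => d' /andP[/andP[dr' dW'] ne].
  case/eqP: ne.
  have [] := rreduced_uniq b_mono dr' dr dW' dW; last by [].
  by rewrite !mulgA !mulgV !mul1g.
rewrite (exchange_big_dep (rreduced b)) /=; last by move=> w d _ /andP[].
apply: eq_bigr => d dr; rewrite (reindex_inj (mulgI d)) /=.
by apply: eq_bigl => u; rewrite dr mulKg.
Qed.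

Section OneParameter.
Variable q : F.
Hypothesis hq : q * q = 1 + (v - v^-1) * q.

Lemma q_neq0 : q != 0.
Proof.
by apply/eqP=> q0; move: hq; rewrite q0 !mulr0 addr0 => /esym/eqP; rewrite oner_eq0.
Qed.

(** A root [q] of the quadratic relation is a one-dimensional character of the parabolic subalgebra,
    and [Q] is its quasi-idempotent: [q = - v^-1] is the sign character, [q = v] the index
    character. *)
Definition Q : H := [ffun w => if w \in W then q ^+ len w else 0].
Lemma QE w : Q w = if w \in W then q ^+ len w else 0. Proof. by rewrite ffunE. Qed.
Lemma Q1 : Q 1%g = 1. Proof. by rewrite QE group1 len1. Qed.
Lemma Q_sum : Q = \sum_(u in W) q ^+ len u *: T u.
Proof.
rewrite [LHS]hecke_basis [RHS]big_mkcond; apply: eq_bigr => w _; rewrite QE.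
by case: ifP => _; rewrite ?scale0r.
Qed.

Lemma TsQ s : s \in bgens b -> T s * Q = q *: Q.
Proof.
move=> sb; have sS := bgens_Sgen sb; have sW := bgens_bgrp sb.
apply/ffunP=> y; rewrite -mulTlM // mulTlE scaleHE !QE groupMl //.
case: ifP => yW; last by rewrite !mulr0 if_same addr0.
case: ifP => [ds|/negbT a].
  by rewrite (len_desc sS ds) exprS [RHS]mulrA hq [RHS]mulrDl mul1r mulrA.
by rewrite len_asc // exprS addr0.
Qed.

Lemma flatQ : flat Q = Q.
Proof. by apply/ffunP=> w; rewrite flatE !QE groupV lenV. Qed.

Lemma QTs s : s \in bgens b -> Q * T s = q *: Q.
Proof.
move=> sb; rewrite -[Q * T s]flatK flatM flatQ flatT (sgenV (bgens_Sgen sb)).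
by rewrite TsQ // flatZ flatQ.
Qed.

Lemma absorbT h : (forall s, s \in bgens b -> h * T s = q *: h) ->
  forall u, u \in W -> h * T u = q ^+ len u *: h.
Proof.
move=> hs u; have [m] := ubnP (len u); elim: m u => // m IH u hm uW.
have [->|u1] := eqVneq u 1%g; first by rewrite T1 mulr1 len1 scale1r.
have [s sb ds] := bgrp_rdesc b_mono uW u1; have sS := bgens_Sgen sb.
have lu := len_rdesc sS ds.
have a : ~~ rdesc (u * s)%g s by rewrite rdesc_mul // ds.
rewrite -{1}(sgenKr u sS) -TMs // mulrA IH; last 2 first.
- by lia.
- by rewrite groupM // bgens_bgrp.
by rewrite -scalerAl hs // scalerA lu exprSr.
Qed.

Lemma QT u : u \in W -> Q * T u = q ^+ len u *: Q.
Proof. by apply: absorbT; exact: QTs. Qed.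

Lemma TQ u : u \in W -> T u * Q = q ^+ len u *: Q.
Proof.
move=> uW; rewrite -[T u * Q]flatK flatM flatQ flatT QT ?groupV //.
by rewrite flatZ flatQ lenV.
Qed.

(** The Poincaré polynomial of the parabolic subgroup, evaluated at [q ^+ 2]. *)
Definition pQ : F := \sum_(u in W) (q ^+ len u) ^+ 2.

Lemma absorbQ h : (forall s, s \in bgens b -> h * T s = q *: h) -> h * Q = pQ *: h.
Proof.
move=> hs; rewrite Q_sum mulr_sumr scaler_suml; apply: eq_bigr => u uW.
by rewrite -scalerAr absorbT // scalerA expr2.
Qed.

Lemma QQ : Q * Q = pQ *: Q. Proof. by apply: absorbQ; exact: QTs. Qed.

Lemma absorb_coef h : (forall s, s \in bgens b -> h * T s = q *: h) ->
  forall d u, rreduced b d -> u \in W -> h (d * u)%g = q ^+ len u * h d.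
Proof.
move=> hs d u dr; have [m] := ubnP (len u); elim: m u => // m IH u hm uW.
have [->|u1] := eqVneq u 1%g; first by rewrite mulg1 len1 mul1r.
have [s sb ds] := bgrp_rdesc b_mono uW u1; have sS := bgens_Sgen sb.
have lu := len_rdesc sS ds.
have usW : (u * s)%g \in W by rewrite groupM // bgens_bgrp.
have := hs _ sb => /(congr1 (fun g : H => g (d * (u * s))%g)).
rewrite scaleHE -mulTrM // mulTrE (rreduced_rdesc b_mono) // rdesc_mul // ds /= addr0 => e.
have <- : (d * (u * s) * s = d * u)%g by rewrite mulgA sgenKr.
rewrite e IH //; last by lia.
by rewrite mulrA lu exprS.
Qed.

(** An element on which the block generators act from the right by [q] has its coefficients on each
    coset fixed by the one at the minimal representative. Hence it lies in the left ideal generated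
    by [Q]. *)
Lemma absorb_decomp h : (forall s, s \in bgens b -> h * T s = q *: h) ->
  h = \sum_(d | rreduced b d) h d *: (T d * Q).
Proof.
move=> hs; rewrite {1}(hecke_basis h) big_cosets; apply: eq_bigr => d dr.
rewrite Q_sum mulr_sumr scaler_sumr; apply: eq_bigr => u uW.
rewrite absorb_coef // -scalerAr TM ?(len_rreduced b_mono) // scalerA.
by rewrite mulrC.
Qed.

Lemma TdQ_coef g d : rreduced b d -> (g * Q) d = \sum_(u in W) g (d * u)%g * q ^+ len u.
Proof.
move=> dr; rewrite Q_sum mulr_sumr sumHE.
rewrite (reindex_inj invg_inj) /=; apply: eq_big => [u|u]; first by rewrite groupV.
rewrite groupV => uW; rewrite lenV -scalerAr scaleHE mulrC; congr (_ * _).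
rewrite coefE -mulrA TM.
  by rewrite [RHS]coefE invMg.
rewrite -invMg !lenV addnC; exact: (len_rreduced b_mono).
Qed.

End OneParameter.

Definition qm : F := - v^-1.
Definition qp : F := v.
Lemma hqm : qm * qm = 1 + (v - v^-1) * qm.
Proof.
exact: (hecke_param (v_neq0 R)).
Qed.
Lemma hqp : qp * qp = 1 + (v - v^-1) * qp.
Proof. by rewrite /qp mulrBl mulVf ?v_neq0 // addrC subrK. Qed.

Definition Qm : H := Q qm.
Definition Qp : H := Q qp.
Definition pm : F := pQ qm.

Lemma block_decr (f : 'I_n -> nat) : (forall i, (f i <= n)%N) ->
  (forall i j, adj i j -> b i = b j -> (f j < f i)%N) ->
  forall i j : 'I_n, (i < j)%N -> b i = b j -> (f j < f i)%N.
Proof.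
move=> fn hf i j ij bij.
have := @block_incr n b b_mono (fun k => n - f k)%N _ i j ij bij.
have := fn i; have := fn j => h1 h2 h.
suff : (n - f i < n - f j)%N by lia.
apply: h => k l akl bkl; have := hf k l akl bkl; have := fn k; have := fn l.
by move: (f k) (f l); lia.
Qed.

Definition longest w0 := w0 \in W /\ forall s, s \in bgens b -> rdesc w0 s.

(** The inverse of [w0] is decreasing on every block, so [w0] turns ascents inside the blocks into
    descents and each letter of [x] shortens the product by one. *)
Lemma longest_len w0 x : longest w0 -> x \in W -> (len (w0 * x)%g + len x = len w0)%N.
Proof.
move=> [wW wd]; have [m] := ubnP (len x); elim: m x => // m IH x hm xW.
have [->|x1] := eqVneq x 1%g; first by rewrite mulg1 len1 addn0.
have [s sb ds] := bgrp_rdesc b_mono xW x1; have sS := bgens_Sgen sb.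
have lx := len_rdesc sS ds.
have xsW : (x * s)%g \in W by rewrite groupM // bgens_bgrp.
have e := IH (x * s)%g ltac:(lia) xsW.
have decr : forall i j : 'I_n, (i < j)%N -> b i = b j -> ((w0^-1)%g j < (w0^-1)%g i)%N.
  apply: (block_decr (f := fun k => val ((w0^-1)%g k))) => [i|i j aij bij].
    by rewrite /= ltnW.
  have /wd : tperm i j \in bgens b by apply/bgensP; exists i, j.
  by rewrite rdescE.
have rdy y : y \in W -> ~~ rdesc y s -> rdesc (w0 * y)%g s.
  rewrite -groupV => /bgrpP byV; case/bgensP: sb => i [j [aij bij ->]].
  rewrite !rdescE // invMg !permM -leqNgt leq_eqVlt => /orP[/eqP/val_inj/perm_inj ij|lt].
    by move: (adj_neq aij); rewrite ij eqxx.
  by apply: decr; rewrite ?byV.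
have rd : rdesc (w0 * (x * s))%g s by apply: rdy; rewrite ?rdesc_mul ?ds.
have := len_rdesc sS rd.
have -> : (w0 * (x * s) * s = w0 * x)%g by rewrite -!mulgA [(x * _)%g]mulgA sgenKr.
by lia.
Qed.

Lemma longest_max w0 x : longest w0 -> x \in W ->
  (len x <= len w0)%N /\ (len x = len w0 -> x = w0).
Proof.
move=> lw xW; have [wW _] := lw.
have := longest_len lw xW => e1.
have yW : (w0^-1 * x)%g \in W by rewrite groupM ?groupV.
have := longest_len lw yW; rewrite mulKVg => e2; split; first by lia.
move=> e3; have /eqP : len (w0^-1 * x)%g = 0%N by lia.
by rewrite len_eq0 => /eqP e; rewrite -[x]mul1g -(mulgV w0) -mulgA e mulg1.
Qed.

Lemma longest_argmax w0 : w0 \in W -> (forall x, x \in W -> (len x <= len w0)%N) -> longest w0.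
Proof.
move=> wW mx; split=> // s sb; apply/negPn/negP=> nd.
have wsW : (w0 * s)%g \in W by rewrite groupM // bgens_bgrp.
by have := mx _ wsW; rewrite (len_rasc (bgens_Sgen sb) nd) ltnn.
Qed.

Section Longest.
Variable w0 : 'S_n.
Hypothesis lw : longest w0.

Lemma longestV : (w0^-1)%g = w0.
Proof.
have [wW _] := lw; have wW' : (w0^-1)%g \in W by rewrite groupV.
by apply: (longest_max lw wW').2; rewrite lenV.
Qed.

(** [pm] is the Poincaré polynomial in [v^-2]. After multiplication by [v ^+ (2 * len w0)] only the
    longest element contributes at [v = 0]; every other element leaves a positive power of [v]. *)
Lemma pm_ct : inO (v ^+ (2 * len w0) * pm) /\ ct (v ^+ (2 * len w0) * pm) = 1.
Proof.
have [wW _] := lw.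
pose m u := (2 * (len w0 - len u))%N.
have e : v ^+ (2 * len w0) * pm = \sum_(u in W) v ^+ m u.
  rewrite mulr_sumr; apply: eq_bigr => u uW; have [le _] := longest_max lw uW.
  have -> : (qm ^+ len u) ^+ 2 = (v ^+ (2 * len u))^-1.
    by rewrite /qm exprNn exprMn sqrr_sign mul1r !exprVn -exprM mulnC.
  rewrite /m.
  have -> : (2 * len w0 = 2 * (len w0 - len u) + 2 * len u)%N by lia.
  by rewrite exprD -mulrA mulfV ?mulr1 // vX_neq0.
have hO u : inO (v ^+ m u) by exact: inOXv.
rewrite e; split; first by apply: inO_bigsum => u _.
rewrite ct_sum // (bigD1 w0) //= {1}/m subnn muln0 expr0 ct1 big1 ?addr0 // => u /andP[uW ne].
have [le eq] := longest_max lw uW.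
have : (0 < m u)%N.
  rewrite /m muln_gt0 /= subn_gt0 ltn_neqAle le andbT; apply/eqP=> /eq e'.
  by rewrite e' eqxx in ne.
by case: (m u) => // k _; exact: ctXv.
Qed.

Lemma pm_neq0 : pm != 0.
Proof.
apply/eqP=> p0; have := pm_ct.2; rewrite p0 mulr0 ct0 => /esym/eqP.
by rewrite oner_eq0.
Qed.

(** [C R w0] lies in the left ideal of [Qm]. A representative [d] other than 1 would give a
    coefficient at [d * w0], which triangularity excludes, and the coefficient 1 at [w0] fixes the
    scalar. *)
Lemma C_longest : C R w0 = (- v) ^+ len w0 *: Qm.
Proof.
have [wW wd] := lw.
have hs s : s \in bgens b -> C R w0 * T s = qm *: C R w0.
  by move=> sb; exact: (C_rdesc R (bgens_Sgen sb) (wd s sb)).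
have r1 : rreduced b 1%g.
  apply/rreducedP=> s /bgens_Sgen sS.
  by rewrite rdescV // invg1 asc1.
rewrite {1}(absorb_decomp hs) (bigD1 1%g) //= T1 mul1r big1 ?addr0 => [|d /andP[dr d1]].
  congr (_ *: _); have := absorb_coef hs r1 wW; rewrite mul1g C_diag => e.
  have := congr1 (fun a => (- v) ^+ len w0 * a) e; rewrite mulr1 mulrA -exprMn /qm.
  by rewrite mulrNN mulfV ?v_neq0 // expr1n mul1r => ->.
have := absorb_coef hs dr wW; rewrite C_tri.
- move/esym/eqP; rewrite mulf_eq0 expf_eq0 (negPf (q_neq0 hqm)) andbF /= => /eqP ->.
  by rewrite scale0r.
- by rewrite -{2}(mul1g w0) (inj_eq (mulIg w0)).
- by rewrite (len_rreduced b_mono) // leq_addl.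
Qed.

(** The right descents put [C R z] into the left ideal of [Qm], and [Qm] differs from [C R w0] only
    by a sign and a power of [v]; so the cofactor keeps Laurent coefficients. *)
Lemma C_factor z : (forall s, s \in bgens b -> rdesc z s) ->
  exists g : H, (forall y, Laur (g y)) /\ C R z = g * C R w0.
Proof.
move=> zd; have [wW wd] := lw.
have hs s : s \in bgens b -> C R z * T s = qm *: C R z.
  by move=> sb; exact: (C_rdesc R (bgens_Sgen sb) (zd s sb)).
exists (\sum_(d | rreduced b d) (C R z d * qm ^+ len w0) *: T d); split.
  move=> y; rewrite sumHE; apply: Laur_sum => d _; rewrite scaleHE TE.
  apply: LaurM; first apply: LaurM; first exact: C_Laur.
    by apply: LaurX; apply: LaurN; exact: LaurV.
  by case: (y == d); [exact: Laur1|exact: Laur0].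
rewrite C_longest {1}(absorb_decomp hs) mulr_suml; apply: eq_bigr => d _.
rewrite -scalerAl -scalerAr scalerA -mulrA -exprMn /qm mulrNN mulVf ?v_neq0 //.
by rewrite expr1n mulr1.
Qed.
End Longest.
End ParabolicElements.

(** * Irreducible representations and induced characters *)

Section Representations.
Variables (R : realType) (n : nat).
Local Notation H := (hecke R n).
Local Notation F := (K R).
Local Notation v := (vK R).
Local Notation T := (@T R n).
Implicit Types (s t w x y z u : 'S_n) (h g : H).

Section OneRep.
Variables (d : nat) (X : 'S_n -> 'M[F]_d).

Definition Xh h : 'M[F]_d := \sum_w h w *: X w.

Lemma XhD h g : Xh (h + g) = Xh h + Xh g.
Proof. by rewrite -big_split; apply: eq_bigr => w _; rewrite addHE scalerDl. Qed.
Lemma XhZ (a : F) h : Xh (a *: h) = a *: Xh h.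
Proof. by rewrite scaler_sumr; apply: eq_bigr => w _; rewrite scaleHE scalerA. Qed.
Lemma Xh0 : Xh 0 = 0.
Proof. by have := XhZ 0 0; rewrite !scale0r. Qed.
Lemma XhN h : Xh (- h) = - Xh h.
Proof. by have := XhZ (-1) h; rewrite !scaleN1r. Qed.
Lemma Xh_sum (I : Type) (r : seq I) (P : pred I) (f : I -> H) :
  Xh (\sum_(i <- r | P i) f i) = \sum_(i <- r | P i) Xh (f i).
Proof. exact: (big_morph Xh XhD Xh0). Qed.
Lemma XhT w : Xh (T w) = X w.
Proof.
rewrite /Xh (bigD1 w) //= TE eqxx scale1r big1 ?addr0 // => y yw.
by rewrite TE (negPf yw) scale0r.
Qed.

Hypothesis repX : isRep X.

Lemma Xh1 : Xh 1 = 1%:M.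
Proof. by rewrite -T1 XhT; case: repX. Qed.

Lemma XhTT x y : Xh (T x * T y) = X x *m X y.
Proof. by case: repX => _ <-; rewrite /Xh -mulHE. Qed.

Lemma XhM h g : Xh (h * g) = Xh h *m Xh g.
Proof.
rewrite {1}(hecke_basis h) mulr_suml Xh_sum {2}/Xh mulmx_suml; apply: eq_bigr => x _.
rewrite -scalerAl XhZ -scalemxAl; congr (_ *: _).
rewrite {1}(hecke_basis g) mulr_sumr Xh_sum mulmx_sumr; apply: eq_bigr => y _.
by rewrite -scalerAr XhZ -scalemxAr XhTT.
Qed.

Section Irr.
Hypothesis irrX : irrRep X.

(** The rows of the [A *m X w] span an invariant subspace [U]. It is nonzero, hence everything by
    irreducibility, so it cannot be annihilated by [B]. *)
Lemma rep_prime m p (A : 'M[F]_(m, d)) (B : 'M[F]_(d, p)) : A != 0 -> B != 0 ->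
  exists w, A *m X w *m B != 0.
Proof.
move=> A0 B0; apply/existsP; rewrite -[X in is_true X]negbK negb_exists.
apply/negP=> /forallP all0.
pose U := (\sum_(w : 'S_n) <<A *m X w>>)%MS.
have AU w : (A *m X w <= U)%MS by apply: (sumsmx_sup w) => //; rewrite genmxE.
have [_ [_ hirr]] := irrX.
have Uinv y : (U *m X y <= U)%MS.
  rewrite sumsmxMr; apply/sumsmx_subP => w _.
  have -> : (<<A *m X w>> *m X y <= U)%MS = (A *m X w *m X y <= U)%MS.
    by rewrite (eqmxMr _ (genmxE _)).
  rewrite -mulmxA -XhTT /Xh mulmx_sumr; apply: summx_sub => z _.
  by rewrite -scalemxAr scalemx_sub.
have UB : U *m B = 0.
  suff : (U *m B <= (0 : 'M[F]_p))%MS by rewrite submx0 => /eqP.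
  rewrite sumsmxMr_gen; apply/sumsmx_subP => w _; rewrite genmxE.
  have -> : (<<A *m X w>> *m B <= (0 : 'M[F]_p))%MS = (A *m X w *m B <= (0 : 'M[F]_p))%MS.
    by rewrite (eqmxMr _ (genmxE _)).
  by rewrite submx0 -[_ == _]negbK; exact: all0.
case/orP: (hirr _ U Uinv) => [|full].
  rewrite mxrank_eq0 => /eqP U0; move: (AU 1%g).
  by case: repX => -> _; rewrite mulmx1 U0 submx0 (negPf A0).
have : (B == 0); last by rewrite (negPf B0).
move: full => /row_fullP[V VU].
by rewrite -[B]mul1mx -VU -mulmxA UB mulmx0.
Qed.

(** Irreducibility is assumed for row spaces. If the columns [X w *m c] failed to span, a nonzero
    row vector would kill all of them, against [rep_prime]. *)
Lemma rep_col_span (c : 'cV[F]_d) : c != 0 -> forall y : 'cV[F]_d,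
  exists h, y = Xh h *m c.
Proof.
move=> c0 y.
pose M := \matrix_(i < #|'S_n|, j < d) (X (enum_val i) *m c) j 0.
have full : row_full M.
  apply/negPn/negP=> nf.
  have nfT : ~~ row_free M^T by rewrite /row_free mxrank_tr.
  have : kermx M^T != 0 by rewrite kermx_eq0.
  case/rowV0Pn=> r /sub_kermxP rM r0.
  have [w hw] := rep_prime r0 c0; case/eqP: hw.
  apply/matrixP=> i j; rewrite !ord1 [RHS]mxE.
  have /matrixP/(_ 0 (enum_rank w)) := rM; rewrite [RHS]mxE => <-.
  rewrite -mulmxA !mxE; apply: eq_bigr => k _; rewrite !mxE enum_rankK.
  by congr (_ * _); apply: eq_bigr => ? _.
have /submxP[r er] : (y^T <= M)%MS by apply: submx_full.
exists (\sum_(w : 'S_n) r 0 (enum_rank w) *: T w).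
rewrite Xh_sum mulmx_suml; apply/matrixP=> i j; rewrite !ord1.
have -> : y i 0 = y^T 0 i by rewrite mxE.
rewrite er mxE summxE (reindex (@enum_rank 'S_n)) /=; last exact/onW_bij/enum_rank_bij.
by apply: eq_bigr => w _; rewrite mxE enum_rankK XhZ XhT -scalemxAl [in RHS]mxE.
Qed.
End Irr.
End OneRep.
End Representations.

(** * Partitions, dominance and Young subgroups *)

Section YoungBlocks.
Variable n : nat.
Implicit Types (s t w x y z d u : 'S_n) (i j : 'I_n) (k : nat) (l mu nu : Part n).

(** The index, counted from 0, of the block containing [k] when the blocks end at [A 1], [A 2], and
    so on: it counts the blocks that end at or before [k]. *)
Definition blk (A : nat -> nat) (k : 'I_n) : nat := (\sum_(r < n) (A r.+1 <= k))%N.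

Lemma blk_mono A i j : (i <= j)%N -> (blk A i <= blk A j)%N.
Proof. by move=> ij; apply: leq_sum => r _; case: (leqP _ i) => // h; rewrite (leq_trans h ij). Qed.

Lemma blk_adj A i j : adj i j -> (blk A i == blk A j) = ~~ [exists r : 'I_n, (j : nat) == A r.+1].
Proof.
move=> /eqP aij; rewrite negb_exists.
have le (r : 'I_n) : true -> ((A r.+1 <= i) <= (A r.+1 <= j) ?= iff ((j : nat) != A r.+1))%N.
  move=> _; rewrite aij; split; first by case: (leqP _ i) => // h; rewrite (leq_trans h (leqnSn i)).
  by case: (ltngtP i.+1 (A r.+1)) => h; lia.
by have := leqif_sum le => -[_ ->]; apply: eq_forallb => r.
Qed.

Definition bpart l : 'I_n -> nat := blk (psum l).

Lemma bpart_mono l i j : (i <= j)%N -> (bpart l i <= bpart l j)%N.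
Proof. exact: blk_mono. Qed.

Lemma ysgensE l : ysgens l = bgens (bpart l).
Proof.
apply/setP=> s; apply/imsetP/imsetP => -[[i j]]; rewrite inE /= => /andP[aij h] ->;
  exists (i, j) => //; rewrite inE /=; apply/andP; split; [exact: aij| |exact: aij|].
- by rewrite blk_adj.
- by move: h; rewrite blk_adj.
Qed.

Lemma youngE l : youngS l = bgrp (bpart l).
Proof. by apply/val_inj; rewrite /= ysgensE -(bgrp_gen (@bpart_mono l)). Qed.

Lemma DminE l d : (d \in Dmin l) = rreduced (bpart l) d.
Proof.
rewrite inE youngE; apply/forallP/rreducedP => [h s sb|h u].
  by have := h s; rewrite bgens_bgrp //= /rdesc -leqNgt.
apply/implyP=> uW; rewrite (len_rreduced (@bpart_mono l)) ?leq_addr //.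
exact/rreducedP.
Qed.

Lemma longest_wlong l : longest (bpart l) (wlong l).
Proof.
have [wW mx] : wlong l \in bgrp (bpart l) /\
    forall x, x \in bgrp (bpart l) -> (len x <= len (wlong l))%N.
  rewrite /wlong; case: Order.TotalTheory.arg_maxP => [|w wW mx]; first exact: group1.
  by rewrite -youngE; split=> // x xW; have := mx x xW; rewrite Order.NatOrder.leEnat.
exact: longest_argmax.
Qed.

Lemma psumS l k (hk : (k < n)%N) : psum l k.+1 = (psum l k + l (Ordinal hk))%N.
Proof.
rewrite /psum (bigD1 (Ordinal hk)) //= addnC; congr (_ + _)%N.
by apply: eq_bigl => i; rewrite -val_eqE /= ltnS ltn_neqAle andbC.
Qed.
Lemma psum0 l : psum l 0 = 0%N.
Proof. by rewrite /psum big_pred0. Qed.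
Lemma psum_n l : ispart l -> psum l n = n.
Proof.
move=> /andP[_ /eqP e]; rewrite -[RHS]e; apply: eq_bigl => i.
by rewrite ltn_ord.
Qed.
Lemma psum_mono l k k' : (k <= k')%N -> (psum l k <= psum l k')%N.
Proof.
move=> kk; rewrite /psum [X in (X <= _)%N]big_mkcond [X in (_ <= X)%N]big_mkcond.
by apply: leq_sum => i _; case: ifP => // h; rewrite (leq_trans h kk).
Qed.
Lemma part_mono l i j : ispart l -> (i <= j)%N -> (l j <= l i)%N.
Proof. by move=> /andP[/forallP/(_ i)/forallP/(_ j)/implyP h _]; exact: h. Qed.

Lemma dom_refl l : dominates l l.
Proof. exact/forallP. Qed.
Lemma dom_trans l mu nu : dominates l mu -> dominates mu nu -> dominates l nu.
Proof.
move=> /forallP h /forallP h'; apply/forallP=> k.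
exact: leq_trans (h k) (h' k).
Qed.
Lemma domP l mu : dominates l mu -> forall k, (k <= n)%N -> (psum l k <= psum mu k)%N.
Proof. by move=> /forallP h k hk; exact: (h (Ordinal (hk : (k < n.+1)%N))). Qed.
Lemma dom_anti l mu : dominates l mu -> dominates mu l -> l = mu.
Proof.
move=> /domP h /domP h'; apply/ffunP=> i; apply/val_inj/eqP.
have e k : (k <= n)%N -> psum l k = psum mu k.
  by move=> hk; apply/eqP; rewrite eqn_leq h ?h'.
have := e i.+1 (ltn_ord i); rewrite !(psumS _ (ltn_ord i)) (e i (ltnW (ltn_ord i))).
by move/addnI; case: i => i hi /= e'; apply/eqP; rewrite (bool_irrelevance hi (ltn_ord (Ordinal hi))).
Qed.

(** The partition with all parts 1. Its Young subgroup is trivial and its sign sum is 1, so its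
    induced module is the regular one; this is the source of faithfulness. *)
Definition onepart : Part n := [ffun=> inord 1].
Lemma onepartE i : onepart i = 1%N :> nat.
Proof. by rewrite ffunE inordK // ltnS; case: i => i; exact: leq_ltn_trans. Qed.
Lemma onepart_part : ispart onepart.
Proof.
apply/andP; split.
  by apply/forallP=> i; apply/forallP=> j; apply/implyP=> _; rewrite !onepartE.
by under eq_bigr do rewrite onepartE; rewrite sum1_card card_ord.
Qed.
Lemma onepart_psum k : (k <= n)%N -> psum onepart k = k.
Proof.
elim: k => [|k IH] hk; first by rewrite psum0.
by rewrite (psumS _ hk) IH ?onepartE ?addn1 // ltnW.
Qed.
Lemma onepart_bgens : bgens (bpart onepart) = set0.
Proof.
apply/setP=> s; rewrite inE; apply/negP=> /bgensP[i [j [aij /eqP]]].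
rewrite blk_adj // => /existsP[]; exists i.
by rewrite onepart_psum //; move/eqP: aij => ->.
Qed.
End YoungBlocks.

Section InducedCharacter.
Variables (R : realType) (n : nat).
Local Notation H := (hecke R n).
Local Notation F := (K R).
Local Notation v := (vK R).
Local Notation T := (@T R n).
Implicit Types (s t w x y z u d : 'S_n) (h g : H) (l mu nu : Part n).

Definition Qs l : H := Qm R (bpart l).
Definition ps l : F := pm R (bpart l).

Lemma ps_neq0 l : ps l != 0.
Proof. exact: (pm_neq0 R (@bpart_mono n l) (longest_wlong l)). Qed.
Lemma QsQs l : Qs l * Qs l = ps l *: Qs l.
Proof. exact: (QQ (@bpart_mono n l) (hqm R)). Qed.
Lemma flatQs l : flat (Qs l) = Qs l. Proof. exact: flatQ. Qed.

Definition indch l h : F := \sum_w h w * indchar R l w.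

Lemma indcharE l w : indchar R l w = \sum_(d | rreduced (bpart l) d) (T w * T d * Qs l) d.
Proof.
rewrite /indchar; apply: eq_big => [d|d]; first by rewrite DminE.
rewrite DminE => dr; rewrite (TdQ_coef (@bpart_mono n l)) //.
apply: eq_big => [u|u _]; first by rewrite youngE.
by rewrite -mulHE /eps /qm [(- v^-1) ^+ _]exprNn exprVn.
Qed.

Lemma indchE l h : indch l h = \sum_(d | rreduced (bpart l) d) (h * T d * Qs l) d.
Proof.
rewrite /indch; under eq_bigr => w _ do rewrite indcharE mulr_sumr.
rewrite exchange_big; apply: eq_bigr => d _ /=.
rewrite {2}(hecke_basis h) !mulr_suml sumHE; apply: eq_bigr => w _.
by rewrite -!scalerAl scaleHE.
Qed.

(** Summing over the whole group instead of coset representatives costs the factor [ps l], because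
    [T u] is absorbed by [Qs l] on both sides. The resulting sum is expressed through the trace
    form, where positivity is visible. *)
Lemma indch_trace l h :
  ps l * indch l h = \sum_w (h * T w * Qs l * T (w^-1)%g) 1%g.
Proof.
rewrite (big_cosets (@bpart_mono n l)) indchE mulr_sumr; apply: eq_bigr => d dr.
rewrite /ps /pm /pQ mulr_suml; apply: eq_bigr => u uW.
have lu := len_rreduced (@bpart_mono n l) dr uW.
rewrite coefE -TM // invMg -TM; last by rewrite -invMg !lenV addnC.
have e1 : T u * Qs l = qm R ^+ len u *: Qs l by exact: (TQ (@bpart_mono n l) (hqm R)).
have e2 : Qs l * T (u^-1)%g = qm R ^+ len u *: Qs l.
  by rewrite -lenV; apply: (QT (@bpart_mono n l) (hqm R)); rewrite groupV.
rewrite !mulrA -[h * T d * T u * Qs l]mulrA e1 -scalerAr -!scalerAl.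
rewrite -[h * T d * Qs l * T (u^-1)%g]mulrA e2 -scalerAr -scalerAl scalerA.
by rewrite scaleHE expr2.
Qed.

(* [indch] is the trace of a *-representation on a positive definite space. *)
Lemma indch_pos l g : indch l (flat g * g) = 0 -> forall w, g * T w * Qs l = 0.
Proof.
move=> i0; have := congr1 (fun a => ps l * (ps l * a)) i0; rewrite !mulr0 indch_trace.
have -> : ps l * \sum_w (flat g * g * T w * Qs l * T (w^-1)%g) 1%g =
  \sum_(p : 'S_n * 'S_n) 1 * ((g * T p.1 * Qs l) p.2) ^+ 2.
  rewrite mulr_sumr -(pair_bigA _ (fun w y => 1 * ((g * T w * Qs l) y) ^+ 2)) /=.
  apply: eq_bigr => w _; under [RHS]eq_bigr => y _ do rewrite mul1r.
  rewrite -tau_flat !flatM flatQs flatT.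
  have -> : (Qs l * (T (w^-1)%g * flat g) * (g * T w * Qs l)) 1%g =
            (flat g * g * T w * (Qs l * Qs l) * T (w^-1)%g) 1%g.
    by rewrite -!mulrA tauC -!mulrA tauC !mulrA.
  by rewrite QsQs -scalerAr -scalerAl scaleHE.
move=> s0 w; apply/ffunP=> y; rewrite zeroHE.
have := sumsq_eq0 (u := fun=> 1) (fun=> inO1 R) (fun=> ct1 R) s0 (w, y).
by [].
Qed.
End InducedCharacter.

Lemma sum_ord_lt m k : (k <= m)%N -> (\sum_(i < m) (i < k) = k)%N.
Proof.
move=> km; have := big_ord_widen m (fun=> 1%N) km (op := addn) (idx := 0%N).
by rewrite sum1_card card_ord big_mkcond => {2}->; apply: eq_bigr => i _; case: ifP.
Qed.

(** A decreasing predicate holds on an initial segment, and the sum is the length of that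
    segment. *)
Lemma sum_threshold m (p : nat -> bool) :
  (forall r r', (r <= r')%N -> p r' -> p r) ->
  forall r, (r < m)%N -> (r < \sum_(i < m) p i)%N = p r.
Proof.
move=> dec r rm; case pr : (p r).
  apply: (@leq_trans (\sum_(i < m) (i < r.+1))%N); first by rewrite sum_ord_lt.
  apply: leq_sum => i _; case ir : (i < r.+1)%N => //.
  by rewrite (dec i r ir pr).
apply/negbTE; rewrite -leqNgt.
apply: (@leq_trans (\sum_(i < m) (i < r))%N); last by rewrite sum_ord_lt // ltnW.
apply: leq_sum => i _; case pi : (p i) => //; rewrite lt0b ltnNge.
by apply/negP=> /dec /(_ pi); rewrite pr.
Qed.

(** * The Gale-Ryser argument *)

Section Tableaux.
Variable n : nat.
Implicit Types (s t w d u : 'S_n) (x y : 'I_n) (k r i j : nat) (l mu kap : Part n).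

Section BlkPrefix.
Variable A : nat -> nat.
Hypothesis A0 : A 0 = 0%N.
Hypothesis An : A n = n.
Hypothesis Am : forall i j, (i <= j)%N -> (A i <= A j)%N.

Lemma blk_lt x r : (r < n)%N -> (r < blk A x)%N = (A r.+1 <= x)%N.
Proof.
move=> rn; apply: (sum_threshold (p := fun r => (A r.+1 <= x)%N)) => // i j ij.
by apply: leq_trans; exact: Am.
Qed.

Lemma blk_bound x : (blk A x < n)%N.
Proof.
have n0 : (0 < n)%N by apply: leq_ltn_trans (ltn_ord x).
have h : (n.-1 < n)%N by rewrite prednK.
have := blk_lt x h; rewrite prednK // An => e.
by rewrite ltnNge e -ltnNge ltn_ord.
Qed.

Lemma blk_lo x : (A (blk A x) <= x)%N.
Proof.
case e : (blk A x) => [|r]; first by rewrite A0.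
by rewrite -blk_lt ?e //; have := blk_bound x; rewrite e; apply: leq_ltn_trans.
Qed.

Lemma blk_hi x : (x < A (blk A x).+1)%N.
Proof. by rewrite ltnNge -blk_lt ?ltnn // blk_bound. Qed.

Lemma blk_uniq x r : (A r <= x < A r.+1)%N -> blk A x = r.
Proof.
move=> /andP[lo hi]; apply/eqP; rewrite eqn_leq; apply/andP; split.
  have [rn|nr] := ltnP r n; first by rewrite leqNgt blk_lt // -ltnNge.
  by apply: leq_trans nr; exact/ltnW/blk_bound.
rewrite leqNgt; apply/negP=> h; have := leq_trans (blk_hi x) (Am h).
by rewrite ltnNge lo.
Qed.

Lemma blk_count r : (r <= n)%N -> (\sum_(x : 'I_n) (blk A x < r) = A r)%N.
Proof.
move=> rn; have h : (A r <= n)%N by rewrite -[X in (_ <= X)%N]An Am.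
rewrite -[RHS](sum_ord_lt h); apply: eq_bigr => x _; congr nat_of_bool.
case: r rn {h} => [_|r rn]; first by rewrite A0.
by rewrite ltnS leqNgt blk_lt // -ltnNge.
Qed.

Lemma blk_card j : (j < n)%N -> (\sum_(x : 'I_n) (blk A x == j) = A j.+1 - A j)%N.
Proof.
move=> jn; apply: (@addnI (A j)); rewrite subnKC ?Am //.
rewrite -(blk_count jn) -(blk_count (ltnW jn)) -big_split; apply: eq_bigr => x _ /=.
by case: ltngtP; lia.
Qed.
End BlkPrefix.

(** The number of boxes in the first [r] columns of the diagram, that is, the partial sums of the
    conjugate partition. The conjugate itself is never formed; only its blocks [bcol] are needed. *)
Definition colA l r : nat := (\sum_(i < n) minn (l i) r)%N.
Definition bcol l : 'I_n -> nat := blk (colA l).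

Lemma colA0 l : colA l 0 = 0%N.
Proof. by rewrite /colA big1 // => i _; rewrite minn0. Qed.
Lemma colA_n l : ispart l -> colA l n = n.
Proof.
move=> /andP[_ /eqP e]; rewrite -[RHS]e; apply: eq_bigr => i _.
by apply/minn_idPl; rewrite -ltnS.
Qed.
Lemma colA_mono l i j : (i <= j)%N -> (colA l i <= colA l j)%N.
Proof. by move=> ij; apply: leq_sum => k _; rewrite leq_min geq_minl (leq_trans (geq_minr _ _)). Qed.
Lemma bcol_mono l x y : (x <= y)%N -> (bcol l x <= bcol l y)%N.
Proof. exact: blk_mono. Qed.

Definition collen l j : nat := (\sum_(i < n) (j < l i))%N.
Lemma colAS l j : colA l j.+1 = (colA l j + collen l j)%N.
Proof. by rewrite -big_split; apply: eq_bigr => i _ /=; case: ltnP; lia. Qed.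

Lemma collen_lt l j (x : 'I_n) : ispart l -> (x < collen l j)%N = (j < l x)%N.
Proof.
move=> hl; pose p r := if insub r is Some y then (j < l (y : 'I_n))%N else false.
have pE (y : 'I_n) : p y = (j < l y)%N by rewrite /p valK.
have -> : collen l j = (\sum_(i < n) p i)%N by apply: eq_bigr => i _; rewrite pE.
rewrite sum_threshold ?pE // => r r' rr; rewrite /p.
case: insubP => [y' _ ey'|//] h; have rn : (r < n)%N.
  by apply: leq_ltn_trans (ltn_ord y'); rewrite ey'.
rewrite insubT /=; apply: leq_trans h _; apply: part_mono => //=.
by rewrite ey'.
Qed.

Lemma psum_sum l r : psum l r = (\sum_(i < n) (i < r) * l i)%N.
Proof. by rewrite /psum big_mkcond; apply: eq_bigr => i _; case: ifP; rewrite ?mul1n. Qed.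

(** Both sides count the boxes in the first [r] rows, once by columns and once by rows. *)
Lemma sum_collen l r : ispart l -> (r <= n)%N ->
  (\sum_(j < n) minn r (collen l j) = psum l r)%N.
Proof.
move=> hl rn.
have e (j : 'I_n) : (minn r (collen l j) = \sum_(i < n) (i < r) * (j < l i))%N.
  have h : (minn r (collen l j) <= n)%N by rewrite geq_min rn.
  rewrite -[LHS](sum_ord_lt h); apply: eq_bigr => i _.
  by rewrite leq_min (collen_lt _ _ hl) mulnb.
under eq_bigr => j _ do rewrite e.
rewrite exchange_big psum_sum; apply: eq_bigr => i _ /=.
by rewrite -big_distrr /= sum_ord_lt // -ltnS.
Qed.

Section Pairs.
Variables (mu kap : Part n) (w : 'S_n).
Hypothesis pmu : ispart mu.
Hypothesis pkap : ispart kap.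
(** When injective, these pairs are the ones of a 0-1 matrix with row sums [mu] and column sums the
    conjugate of [kap]: the Gale-Ryser setting. *)
Definition pairmap x := (bpart mu x, bcol kap (w x)).
Hypothesis inj : injective pairmap.

Let Am := @psum_mono n mu.
Let A0 := psum0 mu.
Let An := psum_n pmu.
Let Bm := colA_mono kap.
Let B0 := colA0 kap.
Let Bn := colA_n pkap.

Definition colcount j r : nat := (\sum_(x : 'I_n) ((bpart mu x < r) && (bcol kap (w x) == j)))%N.

(** Injectivity gives points of one column distinct rows, whence the bound [r]; the column block has
    [collen kap j] elements, whence the other. Summed over [j], this bounds the partial sums of [mu]
    by those of [kap]. *)
Lemma colcount_le j r : (j < n)%N -> (r <= n)%N -> (colcount j r <= minn r (collen kap j))%N.
Proof.
move=> jn rn; rewrite leq_min; apply/andP; split.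
  pose S := [set x : 'I_n | (bpart mu x < r)%N && (bcol kap (w x) == j)].
  have -> : colcount j r = #|S|.
    by rewrite -sum1_card big_mkcond; apply: eq_bigr => x _; rewrite inE; case: ifP.
  have bnd x : (bpart mu x < n)%N by exact: blk_bound.
  pose f x : 'I_n := Ordinal (bnd x).
  have fi : {in S &, injective f}.
    move=> x y; rewrite !inE => /andP[_ /eqP hx] /andP[_ /eqP hy] [e].
    by apply: inj; rewrite /pairmap e hx hy.
  rewrite -(card_in_imset fi) -[X in (_ <= X)%N](sum_ord_lt rn).
  have -> : (\sum_(i < n) (i < r) = #|[set i : 'I_n | (i < r)%N]|)%N.
    by rewrite -sum1_card [RHS]big_mkcond; apply: eq_bigr => x _; rewrite inE; case: ifP.
  apply: subset_leq_card; apply/subsetP=> y /imsetP[x]; rewrite !inE => /andP[h _] ->.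
  exact: h.
have -> : collen kap j = (colA kap j.+1 - colA kap j)%N by rewrite colAS addKn.
rewrite -(blk_card B0 Bn Bm jn) (reindex_inj (@perm_inj _ w)) /=.
by apply: leq_sum => x _; case: (_ == j); rewrite ?andbF // andbT; case: (_ < _)%N.
Qed.

Lemma sum_colcount r : (r <= n)%N -> (\sum_(j < n) colcount j r = psum mu r)%N.
Proof.
move=> rn; rewrite -(blk_count A0 An Am rn) exchange_big; apply: eq_bigr => x _ /=.
have bnd : (bcol kap (w x) < n)%N by exact: (blk_bound Bn Bm).
rewrite (bigD1 (Ordinal bnd)) //= eqxx andbT big1 ?addn0 // => j nj.
rewrite [X in _ && X]eq_sym; have /negPf-> : (val j != bcol kap (w x))%N.
  by apply: contraNneq nj => e; apply/eqP/val_inj.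
by rewrite andbF.
Qed.

Lemma pairs_dom : dominates mu kap.
Proof.
apply/forallP=> r; have rn : (r <= n)%N by rewrite -ltnS.
rewrite -(sum_colcount rn) -(sum_collen pkap rn).
by apply: leq_sum => j _; apply: colcount_le.
Qed.

Hypothesis eqmk : mu = kap.

Lemma colcount_eq j r : (j < n)%N -> (r <= n)%N -> colcount j r = minn r (collen kap j).
Proof.
move=> jn rn; have := leqif_sum (fun (j : 'I_n) (_ : true) =>
  leqif_geq (colcount_le (ltn_ord j) rn)).
rewrite (sum_colcount rn) (sum_collen pkap rn) eqmk => -[_].
rewrite eqxx => /esym/forallP/(_ (Ordinal jn)) /= h.
by apply/eqP; rewrite eqn_leq h colcount_le.
Qed.

(** For equal shapes all the counting bounds are attained. A point of column [j] in row [i] makes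
    the count grow from [i] to [i.+1], which is possible only while [i] is below the column length:
    every point lies inside the diagram. *)
Lemma pairs_diagram x : (bcol kap (w x) < kap (Ordinal (blk_bound An Am x)))%N.
Proof.
set j := bcol kap (w x); set i := Ordinal _.
have jn : (j < n)%N by exact: (blk_bound Bn Bm).
rewrite -(collen_lt _ _ pkap).
have e1 := colcount_eq jn (ltn_ord i); have e2 := colcount_eq jn (ltnW (ltn_ord i)).
have : (colcount j i < colcount j i.+1)%N.
  rewrite /colcount (bigD1 x) //= [X in (_ < X)%N](bigD1 x) //= eqxx !andbT.
  have -> : (bpart mu x < i)%N = false by exact: ltnn.
  have -> : (bpart mu x < i.+1)%N by exact: leqnn.
  rewrite add0n add1n ltnS.
  apply: leq_sum => y _; case: (_ == j); rewrite ?andbF // !andbT.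
  by case h : (_ < i)%N => //; rewrite ltnS (ltnW h).
rewrite e1 e2; rewrite leq_min !gtn_min; lia.
Qed.

Hypothesis winc : forall x y, (x < y)%N -> bpart mu x = bpart mu y -> (w x < w y)%N.

Lemma colstrict x y : (x < y)%N -> bpart mu x = bpart mu y ->
  (bcol kap (w x) < bcol kap (w y))%N.
Proof.
move=> xy bxy; rewrite ltn_neqAle; apply/andP; split; last first.
  by apply: bcol_mono; apply/ltnW; exact: winc.
apply/eqP=> e; have := inj (x1 := x) (x2 := y); rewrite /pairmap bxy e => /(_ erefl) exy.
by rewrite exy ltnn in xy.
Qed.

(** Along a row the column numbers strictly increase and stay below the row length. Counting from
    the left end bounds them below, counting from the right end bounds them above, and the two
    bounds meet. *)
Lemma colnumE x : bcol kap (w x) = (x - psum mu (bpart mu x))%N.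
Proof.
set i := bpart mu x; pose c (y : 'I_n) := bcol kap (w y).
have lo := blk_lo A0 An Am; have hi := blk_hi An Am.
have inblk (y : 'I_n) : (psum mu i <= y < psum mu i.+1)%N -> bpart mu y = i.
  exact: (blk_uniq An Am).
have low m (y : 'I_n) : (psum mu i + m = y)%N -> (y < psum mu i.+1)%N -> (m <= c y)%N.
  elim: m y => // m IH y ey yh.
  have hy : (psum mu i + m < n)%N by have := ltn_ord y; lia.
  have h1 : (psum mu i + m < psum mu i.+1)%N by lia.
  apply: leq_ltn_trans (IH (Ordinal hy) erefl h1) _.
  apply: colstrict => /=; first by lia.
  by rewrite !inblk //=; lia.
have iN : (i < n)%N by exact: (blk_bound An Am).
have ei : psum mu i.+1 = (psum mu i + mu (Ordinal iN))%N by exact: psumS.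
have up m (y : 'I_n) : (y + m.+1 = psum mu i.+1)%N -> (psum mu i <= y)%N ->
    (c y + m < mu (Ordinal iN))%N.
  elim: m y => [|m IH] y ey yl.
    have by_ : bpart mu y = i by apply: inblk; lia.
    rewrite addn0 /c; have := pairs_diagram y; rewrite -eqmk.
    by congr (_ < _)%N; congr (nat_of_ord (mu _)); apply: val_inj.
  have hy : (y.+1 < n)%N.
    have := leq_trans (Am iN) (eq_leq An); lia.
  have e1 : (Ordinal hy + m.+1 = psum mu i.+1)%N by rewrite /=; lia.
  have := IH (Ordinal hy) e1 (leqW yl).
  have : (c y < c (Ordinal hy))%N.
    by apply: colstrict => //=; rewrite !inblk //=; lia.
  lia.
have l1 : (psum mu i <= x)%N := lo x.
have h1 : (x < psum mu i.+1)%N := hi x.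
apply/eqP; rewrite eqn_leq -/(c x); apply/andP; split; last first.
  by apply: low => //; rewrite subnKC.
have e1 : (x + (psum mu i.+1 - x).-1.+1 = psum mu i.+1)%N by lia.
by have := up _ x e1 l1; rewrite ei; lia.
Qed.
End Pairs.
End Tableaux.

(** * The column reading permutation *)

Section ColumnReading.
Variables (n : nat) (kap : Part n).
Hypothesis pk : ispart kap.
Implicit Types (x y : 'I_n).

Let Am := @psum_mono n kap.
Let A0 := psum0 kap.
Let An := psum_n pk.
Let Bm := colA_mono kap.
Let B0 := colA0 kap.
Let Bn := colA_n pk.

Definition rowcol x : nat := (x - psum kap (bpart kap x))%N.

Lemma rowcol_lt x : (rowcol x < n)%N /\ (bpart kap x < collen kap (rowcol x))%N.
Proof.
have iN : (bpart kap x < n)%N by exact: (blk_bound An Am).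
have lo : (psum kap (bpart kap x) <= x)%N := blk_lo A0 An Am x.
have hi : (x < psum kap (bpart kap x).+1)%N := blk_hi An Am x.
rewrite (psumS _ iN) in hi.
have h : (rowcol x < kap (Ordinal iN))%N by rewrite /rowcol; lia.
split; first by apply: leq_trans h _; rewrite -ltnS.
by rewrite -[bpart kap x]/(nat_of_ord (Ordinal iN)) collen_lt.
Qed.

Lemma colread_lt x : (colA kap (rowcol x) + bpart kap x < n)%N.
Proof.
have [h1 h2] := rowcol_lt x.
by rewrite -[X in (_ < X)%N]Bn; apply: leq_trans (Bm h1); rewrite colAS -addnS leq_add2l.
Qed.

(** The diagram is numbered row by row in the source and column by column in the target; the box in
    row [i] and column [j] is sent to position [colA kap j + i]. *)
Definition colread_fun x : 'I_n := Ordinal (colread_lt x).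

Lemma bcol_colread x : bcol kap (colread_fun x) = rowcol x.
Proof.
have [h1 h2] := rowcol_lt x; apply: (blk_uniq Bn Bm) => /=.
by rewrite leq_addr /= colAS ltn_add2l.
Qed.

Lemma rowcol_inj x y : bpart kap x = bpart kap y -> rowcol x = rowcol y -> x = y.
Proof.
have lo z : (psum kap (bpart kap z) <= z)%N := blk_lo A0 An Am z.
move=> e1; rewrite /rowcol e1 => e2; apply: val_inj => /=.
by have := lo x; have := lo y; rewrite e1; lia.
Qed.

Lemma colread_inj : injective colread_fun.
Proof.
move=> x y e; have e1 := bcol_colread x; rewrite e bcol_colread in e1.
have := congr1 val e; rewrite /= e1 => /addnI e2.
exact: rowcol_inj.
Qed.

Definition colread : 'S_n := perm colread_inj.

Lemma colread_pair : injective (pairmap kap kap colread).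
Proof.
move=> x y [e1]; rewrite !permE !bcol_colread; exact: rowcol_inj.
Qed.

Lemma colread_incr x y : (x < y)%N -> bpart kap x = bpart kap y -> (colread x < colread y)%N.
Proof.
move=> xy e; rewrite !permE /=.
have [h1 h2] := rowcol_lt x; have [h3 h4] := rowcol_lt y.
have lo z : (psum kap (bpart kap z) <= z)%N := blk_lo A0 An Am z.
have lt : (rowcol x < rowcol y)%N.
  by have := lo x; have := lo y; rewrite /rowcol e; lia.
apply: (@leq_trans (colA kap (rowcol x).+1)); first by rewrite colAS -addnS leq_add2l.
by apply: leq_trans (Bm lt) _; exact: leq_addr.
Qed.

Lemma colreadV_incr x y : (x < y)%N -> bcol kap x = bcol kap y ->
  ((colread^-1)%g x < (colread^-1)%g y)%N.
Proof.
rewrite -{1 2}(permKV colread x) -{1 2}(permKV colread y).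
set x' := (colread^-1)%g x; set y' := (colread^-1)%g y.
rewrite !permE !bcol_colread /= => h e; rewrite e ltn_add2l in h.
have lo z : (psum kap (bpart kap z) <= z)%N := blk_lo A0 An Am z.
have hi (z : 'I_n) : (z < psum kap (bpart kap z).+1)%N := blk_hi An Am z.
apply: leq_trans (hi x') _; apply: leq_trans (Am h) _.
exact: lo.
Qed.
End ColumnReading.

Lemma rreducedPn n (b : 'I_n -> nat) (d : 'S_n) : ~~ rreduced b d ->
  exists2 s : 'S_n, s \in bgens b & rdesc d s.
Proof.
by rewrite negb_forall => /existsP[s]; rewrite negb_imply negbK => /andP[]; exists s.
Qed.

(** * Products of a sign sum and an index sum over double cosets *)

Section DoubleCosets.
Variables (R : realType) (n : nat).
Local Notation H := (hecke R n).
Local Notation F := (K R).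
Local Notation v := (vK R).
Local Notation T := (@T R n).
Implicit Types (s t w x y z u d : 'S_n) (h g : H).

Lemma qm_qp : qm R - qp R != 0.
Proof.
have e : v * (qm R - qp R) = - (1 + v * v).
  by rewrite /qm /qp mulrBr mulrN mulfV ?v_neq0 // opprD.
apply/eqP=> q0; move: e; rewrite q0 mulr0 => /esym/eqP; rewrite oppr_eq0 => /eqP e.
have ov := inOv R; have oo := inO1 R.
have := ct0 R; rewrite -e (ctD oo (inOM ov ov)) (ctM ov ov) ctv ct1 mulr0 addr0.
by move/eqP; rewrite oner_eq0.
Qed.

Section TwoBlocks.
Variables b1 b2 : 'I_n -> nat.
Hypothesis m1 : forall i j : 'I_n, (i <= j)%N -> (b1 i <= b1 j)%N.
Hypothesis m2 : forall i j : 'I_n, (i <= j)%N -> (b2 i <= b2 j)%N.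

Definition bireduced w := rreduced b1 (w^-1)%g && rreduced b2 w.
Definition pairinj w := [forall x : 'I_n, forall y : 'I_n, (b1 x == b1 y) && (b2 (w x) == b2 (w y)) ==> (x == y)].

Lemma pairinjP w : reflect (injective (fun x : 'I_n => (b1 x, b2 (w x)))) (pairinj w).
Proof.
apply: (iffP forallP) => [h x y [e1 e2]|h x].
  by have /forallP/(_ y) := h x; rewrite e1 e2 !eqxx => /eqP.
apply/forallP=> y; apply/implyP=> /andP[/eqP e1 /eqP e2].
by apply/eqP/h; rewrite e1 e2.
Qed.

Lemma lreduced_desc w s : rreduced b1 (w^-1)%g -> s \in bgens b1 -> ~~ desc s w.
Proof. by move=> /rreducedP h sb; rewrite descV ?h // (bgens_Sgen sb). Qed.

Lemma birreduce w : exists2 w', bireduced w' &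
  exists a, Qm R b1 * T w * Qp R b2 = a *: (Qm R b1 * T w' * Qp R b2).
Proof.
have [m] := ubnP (len w); elim: m w => // m IH w hm.
have [br|] := boolP (bireduced w); first by exists w => //; exists 1; rewrite scale1r.
rewrite negb_and => /orP[] /rreducedPn[s sb ds]; have sS := bgens_Sgen sb.
  rewrite -descV // in ds; have lw := len_desc sS ds.
  have [|w' br [a e]] := IH (s * w)%g; first by lia.
  exists w' => //; exists (qm R * a); rewrite -scalerA -e.
  have a' : ~~ desc s (s * w)%g by rewrite desc_mul // ds.
  rewrite -{1}(sgenK w sS) -(TsM R sS a') mulrA.
  by rewrite (QTs (hqm R) sb) -!scalerAl.
have lw := len_rdesc sS ds.
have [|w' br [a e]] := IH (w * s)%g; first by lia.
exists w' => //; exists (qp R * a); rewrite -scalerA -e.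
have a' : ~~ rdesc (w * s)%g s by rewrite rdesc_mul // ds.
rewrite -{1}(sgenKr w sS) -(TMs R sS a') -!mulrA.
by rewrite (TsQ (hqp R) sb) -!scalerAr.
Qed.

Lemma lreduced_incr w : rreduced b1 (w^-1)%g -> forall x y : 'I_n, (x < y)%N -> b1 x = b1 y ->
  (w x < w y)%N.
Proof.
by move=> br x y xy e; have := rreduced_incr m1 br xy e; rewrite invgK.
Qed.

(** A collision yields generators [s] and [t] of the two parabolics with [T s * T w = T w * T t].
    The sign sum absorbs the first with eigenvalue [- v^-1], the index sum absorbs the second with
    eigenvalue [v], and these differ. *)
Lemma not_pairinj0 w : bireduced w -> ~~ pairinj w -> Qm R b1 * T w * Qp R b2 = 0.
Proof.
move=> /andP[br1 br2] npi.
have [x [y [xy e1 e2]]] : exists x y : 'I_n, [/\ (x < y)%N, b1 x = b1 y & b2 (w x) = b2 (w y)].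
  move: npi; rewrite negb_forall => /existsP[x]; rewrite negb_forall => /existsP[y].
  rewrite negb_imply => /andP[/andP[/eqP e1 /eqP e2]].
  rewrite -val_eqE neq_ltn => /orP[] xy; first by exists x, y.
  by exists y, x.
have hx : (x.+1 < n)%N by apply: leq_trans (ltn_ord y).
pose x' := Ordinal hx.
have e1' : b1 x = b1 x'.
  by apply/eqP; rewrite eqn_leq m1 //= e1 m1.
have lt1 : (w x < w x')%N by apply: lreduced_incr.
have lt2 : (w x' <= w y)%N.
  have [e|ne] := eqVneq x' y; first by rewrite e.
  apply/ltnW/lreduced_incr => //; last by rewrite -e1'.
  by rewrite ltn_neqAle -val_eqE in ne *; rewrite ne.
have e2' : b2 (w x) = b2 (w x').
  by apply/eqP; rewrite eqn_leq m2 ?(ltnW lt1) // e2 m2.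
(* A value strictly between [w x] and [w x'] would lie in the same block, so its preimage would lie
   strictly between [x] and its successor. *)
have aw : adj (w x) (w x').
  apply/eqP/eqP; rewrite eqn_leq lt1 andbT leqNgt; apply/negP=> lt3.
  have hz : ((w x).+1 < n)%N by apply: leq_trans (ltn_ord (w x')); apply: ltnW.
  pose z := Ordinal hz.
  have ez : b2 (w x) = b2 z.
    by apply/eqP; rewrite eqn_leq m2 //= e2' m2 // ltnW.
  have i1 := rreduced_incr m2 br2 (i := w x) (j := z) (leqnn _) ez.
  have i2 := rreduced_incr m2 br2 (i := z) (j := w x') lt3 (etrans (esym ez) e2').
  by move: i1 i2; rewrite !permK /=; lia.
have ax : adj x x' by apply/eqP.
pose s := tperm x x'; pose t := tperm (w x) (w x').
have sb : s \in bgens b1 by apply/bgensP; exists x, x'.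
have tb : t \in bgens b2 by apply/bgensP; exists (w x), (w x').
have est : (s * w = w * t)%g.
  apply/permP=> z; rewrite !permM /s /t.
  have [->|zx] := eqVneq z x; first by rewrite !tpermL.
  have [->|zx'] := eqVneq z x'; first by rewrite !tpermR.
  by rewrite !tpermD // 1?eq_sym // (inj_eq (@perm_inj _ w)).
have es : T s * T w = T w * T t.
  rewrite TsM ?(bgens_Sgen sb) ?lreduced_desc // est TMs ?(bgens_Sgen tb) //.
  by move/rreducedP: br2; apply.
have : Qm R b1 * (T s * T w) * Qp R b2 = Qm R b1 * (T w * T t) * Qp R b2 by rewrite es.
rewrite mulrA (QTs (hqm R) sb) -!scalerAl -!mulrA (TsQ (hqp R) tb) -!scalerAr.
move/eqP; rewrite -subr_eq0 -scalerBl scaler_eq0 (negPf qm_qp) /= => /eqP.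
by [].
Qed.

Lemma QmQp_neq0 h : Qm R b1 * h * Qp R b2 != 0 -> exists w, bireduced w && pairinj w.
Proof.
move=> nz; apply/existsP; rewrite -[X in is_true X]negbK negb_exists.
apply: contra nz => /forallP none; apply/eqP.
rewrite (hecke_basis h) mulr_sumr mulr_suml big1 // => w _.
rewrite -scalerAr -scalerAl; have [w' br [a ->]] := birreduce w.
rewrite not_pairinj0 ?scaler0 //.
by have := none w'; rewrite br.
Qed.

Lemma QmQp_line d : (forall w, bireduced w && pairinj w -> w = d) ->
  forall h, exists a, Qm R b1 * h * Qp R b2 = a *: (Qm R b1 * T d * Qp R b2).
Proof.
move=> uniq h.
have step w : exists a, Qm R b1 * T w * Qp R b2 = a *: (Qm R b1 * T d * Qp R b2).
  have [w' br [a e]] := birreduce w.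
  have [pi|npi] := boolP (pairinj w'); first by exists a; rewrite e (uniq w') // br.
  by exists 0; rewrite e not_pairinj0 // scaler0 scale0r.
pose f w := sval (constructive_indefinite_description _ (step w)).
have fE w : Qm R b1 * T w * Qp R b2 = f w *: (Qm R b1 * T d * Qp R b2).
  exact: svalP (constructive_indefinite_description _ (step w)).
exists (\sum_w h w * f w).
rewrite {1}(hecke_basis h) mulr_sumr mulr_suml scaler_suml; apply: eq_bigr => w _.
by rewrite -scalerAr -scalerAl (fE w) scalerA.
Qed.

(** Injectivity of the pairs says that the first parabolic meets the [d]-conjugate of the second
    trivially, so no other term of the expansion reaches [d]. *)
Lemma QmQp_coef d : bireduced d -> pairinj d -> (Qm R b1 * T d * Qp R b2) d = 1.
Proof.
move=> /andP[br1 br2] /pairinjP pi.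
rewrite (TdQ_coef m2) //.
have key u u' : u \in bgrp b1 -> u' \in bgrp b2 -> (d * u' = u * d)%g -> u = 1%g /\ u' = 1%g.
  move=> /bgrpP ub /bgrpP ub' e.
  have u1 : u = 1%g.
    apply/permP=> x; rewrite perm1; apply: pi; rewrite ub.
    by have /permP/(_ x) := e; rewrite !permM => <-; rewrite ub'.
  by split=> //; apply: (mulgI d); rewrite e u1 mul1g mulg1.
have cf u' : u' \in bgrp b2 -> (Qm R b1 * T d) (d * u')%g = (u' == 1%g)%:R.
  move=> u'W; rewrite /Qm Q_sum mulr_suml sumHE (bigD1 1%g) ?group1 //=.
  have ed : (d * u' == d)%g = (u' == 1%g) by rewrite -{2}(mulg1 d) (inj_eq (mulgI d)).
  rewrite len1 scale1r T1 mul1r TE ed big1 ?addr0 // => u /andP[uW u1].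
  rewrite -scalerAl scaleHE TM; last first.
    rewrite -lenV invMg (len_rreduced m1) ?groupV // !lenV addnC //.
  rewrite TE; case: eqP => [e|_]; last by rewrite mulr0.
  by have [e1 _] := key u u' uW u'W e; rewrite e1 eqxx in u1.
rewrite (bigD1 1%g) ?group1 //= cf ?group1 // eqxx len1 mul1r big1 ?addr0 // => u /andP[uW u1].
by rewrite cf // (negPf u1) mul0r.
Qed.
End TwoBlocks.
End DoubleCosets.

(** * The family of irreducible representations *)

Section Family.
Variables (R : realType) (n : nat).
Variable dim : Part n -> nat.
Variable X : forall l : Part n, 'S_n -> 'M[K R]_(dim l).
Hypothesis HX : chosen_reps X.
Local Notation H := (hecke R n).
Local Notation F := (K R).
Local Notation v := (vK R).
Local Notation T := (@T R n).
Local Notation Qs := (@Qs R n).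
Local Notation ps := (@ps R n).
Implicit Types (s t w x y z u d : 'S_n) (h g : H) (l mu nu kap : Part n).

Definition XX l h : 'M[F]_(dim l) := Xh (X l) h.

Lemma X_irr l : ispart l -> irrRep (X l). Proof. by case: HX => h _; exact: h. Qed.
Lemma X_rep l : ispart l -> isRep (X l). Proof. by move=> /X_irr []. Qed.

Lemma XXM l h g : ispart l -> XX l (h * g) = XX l h *m XX l g.
Proof. by move=> pl; apply: XhM; exact: X_rep. Qed.
Lemma XXT l w : XX l (T w) = X l w. Proof. exact: XhT. Qed.
Lemma XX1 l : ispart l -> XX l 1 = 1%:M. Proof. by move=> pl; apply: Xh1; exact: X_rep. Qed.
Lemma XXD l h g : XX l (h + g) = XX l h + XX l g. Proof. exact: XhD. Qed.
Lemma XXZ l (a : F) h : XX l (a *: h) = a *: XX l h. Proof. exact: XhZ. Qed.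
Lemma XX0 l : XX l 0 = 0. Proof. exact: Xh0. Qed.
Lemma XXN l h : XX l (- h) = - XX l h. Proof. exact: XhN. Qed.
Lemma XX_sum l (I : Type) (r : seq I) (P : pred I) (f : I -> H) :
  XX l (\sum_(i <- r | P i) f i) = \sum_(i <- r | P i) XX l (f i).
Proof. exact: Xh_sum. Qed.
Lemma XXE l h : XX l h = \sum_w h w *: X l w. Proof. by []. Qed.

Lemma XX_prime l h g : ispart l -> XX l h != 0 -> XX l g != 0 ->
  exists w, XX l (h * T w * g) != 0.
Proof.
move=> pl h0 g0; have [w hw] := rep_prime (X_rep pl) (X_irr pl) h0 g0.
by exists w; rewrite (XXM _ _ pl) (XXM _ _ pl) XXT; exact: hw.
Qed.

Lemma indch_chi l : ispart l -> exists m : Part n -> nat, forall h,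
  indch l h = \tr (XX l h) + \sum_(mu | ispart mu && sdom l mu) (m mu)%:R * \tr (XX mu h).
Proof.
case: HX => _ [hlab _] pl; have [m hm] := hlab l pl; exists m => h.
have trE mu : \tr (XX mu h) = \sum_w h w * chi X mu w.
  rewrite XXE raddf_sum; apply: eq_bigr => w _ /=.
  by rewrite mxtraceZ.
rewrite /indch; under eq_bigr => w _ do rewrite hm mulrDr.
rewrite big_split /= trE; congr (_ + _).
under [RHS]eq_bigr => mu _ do rewrite trE mulr_sumr.
rewrite exchange_big; apply: eq_bigr => w _ /=.
by rewrite mulr_sumr; apply: eq_bigr => mu _; rewrite mulrCA.
Qed.

(** By the labelling, the induced character only involves [chi_nu] with [l] dominated by [nu], so it
    vanishes on [flat g * g]. Positivity then makes [g] itself act as zero on the induced module. *)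
Lemma kill_induced l g : ispart l ->
  (forall nu, ispart nu -> dominates l nu -> XX nu g = 0) ->
  forall w, g * T w * Qs l = 0.
Proof.
move=> pl g0; apply: indch_pos; have [m ->] := indch_chi pl.
have z nu : ispart nu -> dominates l nu -> XX nu (flat g * g) = 0.
  by move=> pn dn; rewrite XXM // (g0 _ pn dn) mulmx0.
rewrite z ?dom_refl // mxtrace0 add0r big1 // => mu /andP[pm /andP[dm _]].
by rewrite z // mxtrace0 mulr0.
Qed.

Lemma Qs_onepart : Qs (onepart n) = 1.
Proof.
apply/ffunP=> w; rewrite QE -T1 TE.
have [->|w1] := eqVneq w 1%g; first by rewrite group1 len1.
case: ifP => // wW.
have [s] := bgrp_desc (@bpart_mono n (onepart n)) wW w1.
by rewrite onepart_bgens inE.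
Qed.

Lemma XX_faithful g : (forall nu, ispart nu -> XX nu g = 0) -> g = 0.
Proof.
move=> g0; have := kill_induced (onepart_part n) (fun nu pn _ => g0 nu pn) 1%g.
by rewrite Qs_onepart T1 !mulr1.
Qed.

Lemma XX_ex g : g != 0 -> exists2 mu, ispart mu & XX mu g != 0.
Proof.
move=> g0; have [[mu [pm hm]]|no] :=
  excluded_middle_informative (exists mu, ispart mu /\ XX mu g != 0); first by exists mu.
case/eqP: g0; apply: XX_faithful => nu pn; apply/eqP/negPn/negP=> hn.
by apply: no; exists nu.
Qed.

(** Containment of kernels, a substitute for equivalence of representations until [kerle_eq] shows
    that it forces equality of the labels. *)
Definition kerle nu mu := forall g, XX nu g = 0 -> XX mu g = 0.

(** Otherwise every [nu] above [kap] is killed by some element that [X_mu] does not kill. Primeness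
    multiplies these into one such [g] for all [nu] at once; [g] annihilates the module induced from
    [kap], and primeness applied to [g] and [Qs kap] gives a contradiction. *)
Lemma Qs_support_ker mu kap : ispart mu -> ispart kap -> XX mu (Qs kap) != 0 ->
  exists nu, [/\ ispart nu, dominates kap nu & kerle nu mu].
Proof.
move=> pm pk nz.
have [//|no] := excluded_middle_informative
  (exists nu, [/\ ispart nu, dominates kap nu & kerle nu mu]).
have each nu : ispart nu -> dominates kap nu -> exists2 g, XX nu g = 0 & XX mu g != 0.
  move=> pn dn; have [[g [g1 g2]]|no'] := excluded_middle_informative
    (exists g, XX nu g = 0 /\ XX mu g != 0); first by exists g.
  case: no; exists nu; split=> // g g1; apply/eqP/negPn/negP=> g2.
  by apply: no'; exists g.
have [g g1 g2] : exists2 g, (forall nu, nu \in enum (Part n) -> ispart nu -> dominates kap nu ->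
    XX nu g = 0) & XX mu g != 0.
  elim: (enum _) => [|nu r [g g1 g2]].
    exists 1 => //; rewrite XX1 // -mxrank_eq0 mxrank1.
    by have [_ [h _]] := X_irr pm; rewrite -lt0n.
  have [|bad] := boolP (ispart nu && dominates kap nu); last first.
    exists g => // nu'; rewrite inE => /orP[/eqP->|]; last exact: g1.
    by move=> pn dn; move: bad; rewrite pn dn.
  move=> /andP[pn dn]; have [g' g1' g2'] := each nu pn dn.
  have [w hw] := XX_prime pm g2 g2'; exists (g * T w * g') => // nu'.
  rewrite inE => /orP[/eqP-> _ _|nr pn' dn']; first by rewrite XXM // g1' mulmx0.
  by rewrite !XXM // g1 // !mul0mx.
have k0 := kill_induced pk (fun nu => g1 nu (mem_enum _ nu)).
have [w hw] := XX_prime pm g2 nz.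
by rewrite k0 XX0 eqxx in hw.
Qed.

Definition Qc kap : H := Qp R (bcol kap).
(** The Hecke analogue of a Young symmetriser: the sign sum over rows and the index sum over
    columns, joined by the column reading. *)
Definition gk kap : ispart kap -> H := fun pk => Qs kap * T (colread pk) * Qc kap.

Lemma incr_rreduced (b : 'I_n -> nat) d :
  (forall i j : 'I_n, (i < j)%N -> b i = b j -> ((d^-1)%g i < (d^-1)%g j)%N) -> rreduced b d.
Proof.
move=> h; apply/rreducedP=> s /bgensP[i [j [aij bij ->]]].
rewrite rdescE // -leqNgt ltnW // h //.
by move/eqP: aij => ->.
Qed.

Lemma colread_bireduced kap (pk : ispart kap) :
  bireduced (bpart kap) (bcol kap) (colread pk).
Proof.
apply/andP; split; apply: incr_rreduced => i j ij e.
  by rewrite invgK; apply: colread_incr.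
exact: colreadV_incr.
Qed.

Lemma colread_pairinj kap (pk : ispart kap) : pairinj (bpart kap) (bcol kap) (colread pk).
Proof. by apply/pairinjP; exact: colread_pair. Qed.

Lemma gk_neq0 kap (pk : ispart kap) : gk pk != 0.
Proof.
apply/eqP=> /ffunP/(_ (colread pk)).
rewrite /gk (QmQp_coef R (@bpart_mono n kap) (@bcol_mono n kap)) ?colread_bireduced
  ?colread_pairinj // zeroHE => /eqP; by rewrite oner_eq0.
Qed.

Lemma QsQc_dom mu kap h : ispart mu -> ispart kap -> Qs mu * h * Qc kap != 0 ->
  dominates mu kap.
Proof.
move=> pm pk /(QmQp_neq0 (@bpart_mono n mu) (@bcol_mono n kap))[w /andP[_ /pairinjP pi]].
exact: (pairs_dom (w := w) pm pk pi).
Qed.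

Lemma XX_QsQc_dom nu mu kap : ispart nu -> ispart mu -> ispart kap ->
  XX nu (Qs mu) != 0 -> XX nu (Qc kap) != 0 -> dominates mu kap.
Proof.
move=> pn pm pk h1 h2; have [w hw] := XX_prime pn h1 h2.
apply: (QsQc_dom (h := T w)) => //; apply: contraNneq hw => ->.
by rewrite XX0.
Qed.

Lemma XX_gk_factors nu kap (pk : ispart kap) : ispart nu -> XX nu (gk pk) != 0 ->
  XX nu (Qs kap) != 0 /\ XX nu (Qc kap) != 0.
Proof.
move=> pn; rewrite /gk !XXM // => nz; split; apply: contraNneq nz => ->.
  by rewrite !mul0mx.
by rewrite mulmx0.
Qed.

Lemma dom_ind (P : Part n -> Prop) :
  (forall kap, ispart kap -> (forall nu, ispart nu -> sdom kap nu -> P nu) -> P kap) ->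
  forall kap, ispart kap -> P kap.
Proof.
move=> IH kap; have [m] := ubnP #|[set nu | sdom kap nu]|; elim: m kap => // m IHm kap hm pk.
apply: IH => // nu pn sd; apply: IHm => //.
rewrite -ltnS; apply: leq_trans hm; rewrite ltnS; apply: proper_card; apply/properP; split.
  apply/subsetP=> z; rewrite !inE => /andP[d1 ne]; case/andP: sd => d2 ne2.
  rewrite /sdom (dom_trans d2 d1) /=; apply: contraNneq ne => e.
  by apply/eqP/dom_anti => //; rewrite -e.
by exists nu; rewrite inE // /sdom eqxx andbF.
Qed.

(** Some [X_mu] sees [gk pk], and kernel containment moves this to a [nu] above [kap]. If [nu] were
    different from [kap], induction would give [X_nu (Qs nu) != 0]; together with
    [X_nu (Qc kap) != 0] this puts [nu] below [kap] by Gale-Ryser. *)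
Lemma XX_gk kap (pk : ispart kap) : XX kap (gk pk) != 0.
Proof.
move: (pk) (pk); move: kap {pk}.
apply: (@dom_ind (fun kap => forall pk : ispart kap, XX kap (gk pk) != 0)) => kap _ IH pk.
have [mu pm nz] := XX_ex (gk_neq0 pk).
have [h1 _] := XX_gk_factors pm nz.
have [nu [pn dn kn]] := Qs_support_ker pm pk h1.
have nzn : XX nu (gk pk) != 0 by apply: contraNneq nz => /kn ->.
have [e|ne] := eqVneq kap nu; first by move: nzn; rewrite -e.
have [h2 h3] := XX_gk_factors pn nzn.
have sd : sdom kap nu by rewrite /sdom dn.
have [h4 h5] := XX_gk_factors pn (IH nu pn sd pn).
by case/eqP: ne; apply: dom_anti => //; apply: (XX_QsQc_dom pn).
Qed.

(** [X_nu] kills neither [gk] of [nu] nor [gk] of [mu], so Gale-Ryser applies in both directions. *)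
Lemma kerle_eq nu mu : ispart nu -> ispart mu -> kerle nu mu -> nu = mu.
Proof.
move=> pn pm kn.
have h0 : XX nu (gk pm) != 0 by apply: contraNneq (XX_gk pm) => /kn ->.
have [h1 h2] := XX_gk_factors pn h0; have [h3 h4] := XX_gk_factors pn (XX_gk pn).
by apply: dom_anti; apply: (XX_QsQc_dom pn).
Qed.

Lemma Qs_support mu kap : ispart mu -> ispart kap -> XX mu (Qs kap) != 0 -> dominates kap mu.
Proof.
move=> pm pk /(Qs_support_ker pm pk)[nu [pn dn kn]].
by rewrite -(kerle_eq pn pm kn).
Qed.

(** Only one double coset survives: by [colnumE] a surviving [w] has the same column numbers as the
    column reading, hence lies in the same coset, and both are reduced. *)
Lemma Qs_line kap (pk : ispart kap) h : exists a, Qs kap * h * Qc kap = a *: gk pk.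
Proof.
apply: (QmQp_line (@bpart_mono n kap) (@bcol_mono n kap)) => w /andP[/andP[br1 br2] /pairinjP pi].
have winc := lreduced_incr (@bpart_mono n kap) br1.
have cw (x : 'I_n) : bcol kap (w x) = bcol kap (colread pk x).
  by rewrite (colnumE pk pk pi erefl winc) permE bcol_colread.
have uW : ((colread pk)^-1 * w)%g \in bgrp (bcol kap).
  by apply/bgrpP=> y; rewrite permM cw permKV.
have /andP[_ cr2] := colread_bireduced pk.
have e : (w * 1 = colread pk * ((colread pk)^-1 * w))%g by rewrite mulg1 mulKVg.
by have [] := rreduced_uniq (@bcol_mono n kap) br2 cr2 (group1 _) uW e.
Qed.

(** A nonzero column of [X (Qc kap)] generates the whole module, and [Qs kap * h * Qc kap] is always
    a multiple of [gk pk]; so [X (Qs kap)] maps every vector to a multiple of one fixed column. *)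
Lemma XX_rank1 kap : ispart kap -> exists (a : 'cV[F]_(dim kap)) (rho : 'rV[F]_(dim kap)),
  XX kap (Qs kap) = a *m rho.
Proof.
move=> pk; have nz := XX_gk pk.
pose G := XX kap (gk pk).
have [j cj] : exists j, col j G != 0.
  apply/existsP; rewrite -[X in is_true X]negbK negb_exists; apply: contra nz => /forallP z.
  apply/eqP/matrixP=> i j; rewrite [RHS]mxE; have := z j; rewrite negbK => /eqP/matrixP/(_ i 0).
  by rewrite !mxE.
have f0 : col j (XX kap (Qc kap)) != 0.
  by apply: contraNneq cj => e; rewrite /G /gk XXM // colE -mulmxA -colE e mulmx0.
have line (y : 'cV[F]_(dim kap)) : exists b : F, XX kap (Qs kap) *m y = b *: col j G.
  have [h ->] := rep_col_span (X_rep pk) (X_irr pk) f0 y.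
  have [b e] := Qs_line pk h; exists b.
  rewrite -/(XX kap h) colE 2!mulmxA -!XXM // e XXZ -scalemxAl -colE.
  by [].
pose b i := sval (constructive_indefinite_description _ (line (delta_mx i 0))).
have bE i : XX kap (Qs kap) *m delta_mx i 0 = b i *: col j G.
  exact: svalP (constructive_indefinite_description _ (line (delta_mx i 0))).
exists (col j G), (\row_i b i); apply/matrixP=> i k.
have := bE k; rewrite -colE => /matrixP/(_ i 0); rewrite !mxE => ->.
by rewrite big_ord1 !mxE mulrC.
Qed.

Lemma Qs_sandwich kap B : ispart kap -> exists c : F,
  XX kap (Qs kap) *m B *m XX kap (Qs kap) = c *: XX kap (Qs kap).
Proof.
move=> pk; have [a [rho ->]] := XX_rank1 pk; exists ((rho *m B *m a) 0 0).
rewrite -mulmxA [B *m _]mulmxA mulmxA -[a *m rho *m (B *m a)]mulmxA.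
by rewrite [rho *m (B *m a)]mulmxA {1}[rho *m B *m a]mx11_scalar -mulmxA mul_scalar_mx scalemxAr.
Qed.

Lemma Qs_nz kap : ispart kap -> XX kap (Qs kap) != 0.
Proof. by move=> pk; case: (XX_gk_factors pk (XX_gk pk)). Qed.

(** The square of a rank one matrix is its trace times itself. *)
Lemma XX_trace1 kap : ispart kap -> \tr (XX kap (Qs kap)) = ps kap.
Proof.
move=> pk; have nz := Qs_nz pk; have [a [rho e]] := XX_rank1 pk.
have := congr1 (XX kap) (QsQs R kap); rewrite XXM // XXZ e.
rewrite mulmxA -[a *m rho *m a]mulmxA {1}[rho *m a]mx11_scalar -mulmxA mul_scalar_mx -scalemxAr.
rewrite mxtrace_mulC trace_mx11 => /eqP; rewrite -subr_eq0 -scalerBl scaler_eq0 -e (negPf nz) orbF.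
by rewrite subr_eq0 => /eqP.
Qed.

Lemma Schur_neq nu mu (Phi : 'M[F]_(dim nu, dim mu)) : ispart nu -> ispart mu -> nu != mu ->
  (forall w, X nu w *m Phi = Phi *m X mu w) -> Phi = 0.
Proof.
move=> pn pm ne com; apply/eqP/negPn/negP=> nz; case/eqP: ne; symmetry.
have comh h : XX nu h *m Phi = Phi *m XX mu h.
  rewrite !XXE mulmx_suml mulmx_sumr; apply: eq_bigr => w _.
  by rewrite -scalemxAl -scalemxAr com.
apply: kerle_eq => // g g0; apply/eqP/negPn/negP=> gn.
have [w] := rep_prime (X_rep pn) (X_irr pn) gn nz.
rewrite -mulmxA com mulmxA comh g0 mulmx0 mul0mx eqxx.
by [].
Qed.

(** The field is not algebraically closed, so the eigenvalue comes from elsewhere: [Phi] commutes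
    with the rank one matrix of [Qs kap] and so preserves its image line, and this line generates
    the module. *)
Lemma Schur_eq kap (Phi : 'M[F]_(dim kap)) : ispart kap ->
  (forall w, X kap w *m Phi = Phi *m X kap w) -> exists c, Phi = c%:M.
Proof.
move=> pk com.
have comh h : XX kap h *m Phi = Phi *m XX kap h.
  rewrite !XXE mulmx_suml mulmx_sumr; apply: eq_bigr => w _.
  by rewrite -scalemxAl -scalemxAr com.
have nz := Qs_nz pk; have p0 := ps_neq0 R kap; have [a [rho e]] := XX_rank1 pk.
have a0 : a != 0 by apply: contraNneq nz => a0; rewrite e a0 mul0mx.
have tr : (rho *m a) 0 0 = ps kap.
  by rewrite -trace_mx11 mxtrace_mulC -e XX_trace1.
pose c := (rho *m Phi *m a) 0 0 / ps kap.
have ea : Phi *m a = c *: a.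
  have h1 : XX kap (Qs kap) *m a = ps kap *: a.
    by rewrite e -mulmxA [rho *m a]mx11_scalar tr mul_mx_scalar.
  have h2 : XX kap (Qs kap) *m (Phi *m a) = ps kap *: (Phi *m a).
    by rewrite mulmxA comh -mulmxA h1 scalemxAr.
  apply: (scalerI p0); rewrite -h2 e -mulmxA [rho *m (Phi *m a)]mulmxA [rho *m Phi *m a]mx11_scalar.
  by rewrite mul_mx_scalar scalerA /c mulrC divfK.
exists c; apply/matrixP=> i j.
have [h eh] := rep_col_span (X_rep pk) (X_irr pk) a0 (delta_mx j 0).
have : Phi *m (delta_mx j 0 : 'cV[F]_(dim kap)) = c%:M *m (delta_mx j 0 : 'cV[F]_(dim kap)).
  rewrite eh -/(XX kap h) mulmxA -comh -mulmxA ea mulmxA mul_scalar_mx -scalemxAr.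
  by rewrite scalemxAl.
by rewrite -!colE => /matrixP/(_ i 0); rewrite !mxE.
Qed.
End Family.

(** * Strict monotonicity of the a-invariant along dominance *)

Section AInvariant.
Variable n : nat.
Implicit Types (x y : 'I_n) (l mu kap : Part n).

Lemma longest_inv (b : 'I_n -> nat) (m : forall i j : 'I_n, (i <= j)%N -> (b i <= b j)%N) w0 x y :
  longest b w0 -> (x < y)%N -> (w0 y < w0 x)%N = (b x == b y).
Proof.
move=> lw xy; have e := longestV m lw; have [wW wd] := lw.
have /bgrpP bw := wW.
have [exy|ne] := eqVneq (b x) (b y).
  rewrite -e; apply: (block_decr m (f := fun k => val ((w0^-1)%g k))) => // [i|i j aij bij].
    by rewrite /= ltnW.
  have /wd : tperm i j \in bgens b by apply/bgensP; exists i, j.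
  by rewrite rdescE.
apply/negbTE; rewrite -leqNgt; apply: ltnW; rewrite ltnNge; apply/negP=> /m.
by rewrite !bw; have := m _ _ (ltnW xy); move: ne; lia.
Qed.

Lemma sum_sq_blocks l : ispart l ->
  (\sum_(x : 'I_n) \sum_(y : 'I_n) (bpart l x == bpart l y) = \sum_(i < n) l i * l i)%N.
Proof.
move=> pl; have A0 := psum0 l; have An := psum_n pl; have Am := @psum_mono n l.
have cnt (i : 'I_n) : (\sum_(x : 'I_n) (bpart l x == i) = l i)%N.
  rewrite (blk_card A0 An Am (ltn_ord i)) (psumS _ (ltn_ord i)) addKn.
  by congr (nat_of_ord (l _)); apply: val_inj.
transitivity (\sum_(x : 'I_n) \sum_(i < n) (bpart l x == i) * l i)%N.
  apply: eq_bigr => x _; have hx : (bpart l x < n)%N by exact: (blk_bound An Am).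
  rewrite [RHS](bigD1 (Ordinal hx)) //= eqxx mul1n [X in (_ + X)%N]big1 ?addn0.
    rewrite -cnt /=; apply: eq_bigr => y _.
    by rewrite eq_sym.
  move=> i ni; have /negPf-> // : (bpart l x != i)%N.
  by apply: contraNneq ni => e; apply/eqP/val_inj.
rewrite exchange_big; apply: eq_bigr => i _ /=.
by rewrite -big_distrl /= cnt.
Qed.

(** The inversions of [wlong l] are the pairs [x < y] inside one block; both orders together with
    the diagonal give all ordered pairs inside blocks. *)
Lemma aval_sq l : ispart l -> (aval l * 2 + n = \sum_(i < n) l i * l i)%N.
Proof.
move=> pl; rewrite -(sum_sq_blocks pl).
pose f x y := nat_of_bool ((x < y)%N && (bpart l x == bpart l y)).
have ea : aval l = (\sum_(x : 'I_n) \sum_(y : 'I_n) f x y)%N.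
  rewrite /aval /len -sum1_card big_mkcond /= pair_bigA; apply: eq_bigr => -[x y] _ /=.
  rewrite inE /= /f; case xy : (x < y)%N => //=.
  by rewrite (longest_inv (@bpart_mono n l) (longest_wlong l) xy); case: eqP.
have e1 : (\sum_(x : 'I_n) \sum_(y : 'I_n) (x == y) = n)%N.
  rewrite -[RHS]card_ord -sum1_card; apply: eq_bigr => x _.
  rewrite (bigD1 x) //= ?eqxx big1 ?addn0 // => y yx.
  by rewrite eq_sym (negPf yx).
have e2 : aval l = (\sum_(x : 'I_n) \sum_(y : 'I_n) f y x)%N by rewrite ea exchange_big.
rewrite muln2 -addnn {1}ea e2 -[X in (_ + X)%N]e1 -!big_split; apply: eq_bigr => x _ /=.
rewrite -!big_split; apply: eq_bigr => y _ /=; rewrite /f -val_eqE /= (eq_sym (bpart l y)).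
by case: (ltngtP x y) => /= e; rewrite ?addn0 ?add0n // (val_inj e) eqxx.
Qed.

(** Abel summation for a decreasing [f] whose partial sums are bounded by those of [g]. The boundary
    terms carrying [f m] make the induction run and cancel when the total sums agree. *)
Lemma abel_ineq (f g : nat -> nat) m :
  (forall i, f i.+1 <= f i)%N ->
  (forall k, k <= m -> \sum_(i < k) f i <= \sum_(i < k) g i)%N ->
  (f m * \sum_(i < m) g i + \sum_(i < m) f i * f i <=
   \sum_(i < m) f i * g i + f m * \sum_(i < m) f i)%N.
Proof.
move=> fd; elim: m => [|m IH] h; first by rewrite !big_ord0 muln0.
have := IH (fun k hk => h k (leqW hk)); have := h m.+1 (leqnn _); have := fd m.
rewrite !big_ord_recr /=.
move: (\sum_(i < m) g i)%N (\sum_(i < m) f i)%N (\sum_(i < m) f i * f i)%N (\sum_(i < m) f i * g i)%N.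
move: (f m) (g m) (f m.+1) => a b c G S SS SG ca le ih.
suff : (c * (G + b) + a * (S + a) <= a * (G + b) + c * (S + a))%N by lia.
have [e ->] : exists e, (G + b = S + a + e)%N by exists (G + b - (S + a))%N; rewrite subnKC.
rewrite !mulnDr; have : (c * e <= a * e)%N by rewrite leq_mul2r ca orbT.
by lia.
Qed.

(** Abel summation bounds the sum of the [l i * l i] by that of the [l i * kap i]. Since [l] and
    [kap] differ, twice the latter is strictly less than the two sums of squares together. *)
Lemma aval_sdom l kap : ispart l -> ispart kap -> sdom l kap -> (aval l < aval kap)%N.
Proof.
move=> pl pk /andP[dlk ne].
suff : (\sum_(i < n) l i * l i < \sum_(i < n) kap i * kap i)%N.
  by rewrite -!aval_sq // ltn_add2r ltn_mul2r.
pose ext (mu : Part n) i : nat := if insub i is Some j then mu (j : 'I_n) else 0%N.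
have extE mu (i : 'I_n) : ext mu i = mu i by rewrite /ext valK.
have extd i : (ext l i.+1 <= ext l i)%N.
  rewrite /ext; case: insubP => [j _ ej|//].
  have hi : (i < n)%N by rewrite -ltnS ltnW // ltnS -ej ltn_ord.
  by rewrite insubT; apply: part_mono => //=; rewrite ej.
have exts mu k : (k <= n)%N -> (\sum_(i < k) ext mu i = psum mu k)%N.
  move=> kn; rewrite /psum (big_ord_widen n (ext mu) kn).
  by apply: eq_bigr => i _; rewrite extE.
have h k : (k <= n)%N -> (\sum_(i < k) ext l i <= \sum_(i < k) ext kap i)%N.
  by move=> kn; rewrite !exts // (domP dlk).
have := abel_ineq extd h; rewrite !exts // !psum_n // addnC leq_add2r.
under eq_bigr => i _ do rewrite extE.
under [X in (_ <= X)%N]eq_bigr => i _ do rewrite !extE.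
move=> le.
have lq : (\sum_(i < n) 2 * (l i * kap i) < \sum_(i < n) (l i ^ 2 + kap i ^ 2))%N.
  have h2 (i : 'I_n) : true -> (2 * (l i * kap i) <= l i ^ 2 + kap i ^ 2 ?= iff (l i == kap i :> nat))%N.
    by move=> _; exact: nat_Cauchy.
  have [le2 eq2] := leqif_sum h2; rewrite ltn_neqAle le2 andbT eq2.
  apply: contra ne => /forallP all_eq; apply/eqP/ffunP=> i; apply/val_inj/eqP.
  by have := all_eq i.
rewrite -big_distrr big_split /= in lq.
have sq mu : (\sum_(i < n) mu i ^ 2 = \sum_(i < n) mu i * mu i)%N by apply: eq_bigr => i _; rewrite mulnn.
rewrite !sq in lq; rewrite -(ltn_add2l (\sum_(i < n) l i * l i)); apply: leq_ltn_trans lq.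
by rewrite mul2n -addnn leq_add.
Qed.
End AInvariant.

(** * Schur relations and leading coefficients *)

Section SchurRelations.
Variables (R : realType) (n : nat).
Variable dim : Part n -> nat.
Variable X : forall l : Part n, 'S_n -> 'M[K R]_(dim l).
Hypothesis HX : chosen_reps X.
Local Notation H := (hecke R n).
Local Notation F := (K R).
Local Notation v := (vK R).
Local Notation T := (@T R n).
Local Notation Qs := (@Qs R n).
Local Notation ps := (@ps R n).
Local Notation XX := (XX X).
Implicit Types (s t w x y z u d : 'S_n) (h g : H) (l mu nu kap : Part n).

(** Averaging over the dual bases [T w] and [T (w^-1)] of the trace form produces an intertwiner:
    symmetry of the trace identifies the coefficients arising on the two sides. *)
Lemma Casimir nu mu (M : 'M[F]_(dim nu, dim mu)) x : ispart nu -> ispart mu ->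
  X nu x *m (\sum_w X nu w *m M *m X mu (w^-1)%g) =
  (\sum_w X nu w *m M *m X mu (w^-1)%g) *m X mu x.
Proof.
move=> pn pm; have rn := X_rep HX pn; have rm := X_rep HX pm.
have eL w : X nu x *m (X nu w *m M *m X mu (w^-1)%g) =
    \sum_z (T x * T w) z *: (X nu z *m M *m X mu (w^-1)%g).
  rewrite !mulmxA -(XhTT rn) /Xh !mulmx_suml; apply: eq_bigr => z _.
  by rewrite -!scalemxAl.
have eR z : X nu z *m M *m X mu (z^-1)%g *m X mu x =
    \sum_w (T x * T w) z *: (X nu z *m M *m X mu (w^-1)%g).
  rewrite -mulmxA -(XhTT rm) /Xh mulmx_sumr (reindex_inj invg_inj) /=.
  apply: eq_bigr => w _; rewrite -scalemxAr; congr (_ *: _).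
  by rewrite coefE' invgK [RHS]coefE mulrA tauC mulrA.
rewrite mulmx_sumr mulmx_suml; under eq_bigr => w _ do rewrite eL.
by rewrite exchange_big; apply: eq_bigr => z _; rewrite eR.
Qed.

Lemma delta_sandwich nu mu (A : 'M[F]_(dim nu)) (B : 'M[F]_(dim mu)) i j k m :
  (A *m delta_mx j k *m B) i m = A i j * B k m.
Proof.
rewrite mxE (bigD1 k) //= big1 ?addr0 => [|a ak].
  rewrite mxE (bigD1 j) //= big1 ?addr0 => [|a aj]; first by rewrite mxE !eqxx mulr1.
  by rewrite mxE (negPf aj) mulr0.
rewrite mxE big1 ?mul0r // => b _; by rewrite mxE (negPf ak) andbF mulr0.
Qed.

Lemma Schur_neq_rel nu mu i j k m : ispart nu -> ispart mu -> nu != mu ->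
  \sum_w X nu w i j * X mu (w^-1)%g k m = 0.
Proof.
move=> pn pm ne.
have := Schur_neq HX pn pm ne (fun x => Casimir (delta_mx j k) x pn pm).
move/matrixP/(_ i m); rewrite summxE [X in _ = X -> _]mxE => e.
by rewrite -[RHS]e; apply: eq_bigr => w _; rewrite delta_sandwich.
Qed.

(** Schur's lemma gives a scalar for each [j], [k]. Exchanging [w] with its inverse exchanges the
    two index pairs, which shows that the scalar vanishes unless [j = k] and does not depend on
    [j]. *)
Lemma Schur_eq_rel l : ispart l -> exists c : F, forall i j k m,
  \sum_w X l w i j * X l (w^-1)%g k m = ((i == m) && (j == k))%:R * c.
Proof.
move=> pl; pose S i j k m := \sum_w X l w i j * X l (w^-1)%g k m.
have hc j k : {c | forall i m, S i j k m = (i == m)%:R * c}.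
  apply: constructive_indefinite_description.
  have [c e] := Schur_eq HX pl (fun x => Casimir (delta_mx j k) x pl pl).
  exists c => i m; move/matrixP/(_ i m): e; rewrite summxE mxE => e.
  rewrite mulr_natl -e; apply: eq_bigr => w _.
  by rewrite delta_sandwich.
have Ssym i j k m : S i j k m = S k m i j.
  rewrite /S (reindex_inj invg_inj) /=; apply: eq_bigr => w _.
  by rewrite invgK mulrC.
have d0 : (0 < dim l)%N by have [_ [h _]] := X_irr HX pl.
pose i0 := Ordinal d0; exists (sval (hc i0 i0)) => i j k m.
rewrite -/(S i j k m).
have e1 := svalP (hc j k); have e2 := svalP (hc m i).
have [im|im] := eqVneq i m; last by rewrite e1 (negPf im) /= !mul0r.
have [jk|jk] := eqVneq j k; last by rewrite Ssym e2 eq_sym (negPf jk) /= !mul0r.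
rewrite /= mul1r -im -jk.
have -> : S i j j i = S i0 j j i0 by rewrite !(svalP (hc j j)) !eqxx.
rewrite Ssym (svalP (hc i0 i0)).
by rewrite eqxx mul1r.
Qed.

Definition cS l : F := epsilon (inhabits 0) (fun c => forall i j k m,
  \sum_w X l w i j * X l (w^-1)%g k m = ((i == m) && (j == k))%:R * c).

Lemma cSP l i j k m : ispart l ->
  \sum_w X l w i j * X l (w^-1)%g k m = ((i == m) && (j == k))%:R * cS l.
Proof. by move=> /Schur_eq_rel h; move: i j k m; exact: (epsilon_spec _ _ h). Qed.

Lemma ortho_weights l : ispart l -> exists p : 'I_(dim l) -> F,
  [/\ forall i, inO (p i), forall i, ct (p i) = 1 &
      forall w i j, X l (w^-1)%g i j = (p i)^-1 * X l w j i * p j].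
Proof.
case: HX => _ [_ [ho _]] pl; have [P [Pd [P1 [Pu Pw]]]] := ho l pl.
have PO i : inO (P i i) /\ ct (P i i) = 1.
  have [f [f1 ->]] := P1 i; rewrite -[tofrac f]/(frK f).
  by split; [exact: inO_frK|rewrite ct_frK].
exists (fun i => P i i); split=> [i|i|w i j]; [by case: (PO i)|by case: (PO i)|].
have p0 : P i i != 0.
  by apply/eqP=> e; have [_] := PO i; rewrite e ct0 => /esym/eqP; rewrite oner_eq0.
have : (P *m X l (w^-1)%g) i j = ((X l w)^T *m P) i j.
  by rewrite Pw (mulmxA P) (mulmxA P) (mulmxV Pu) mul1mx.
rewrite !mxE (bigD1 i) //= big1 ?addr0; last by move=> k ki; rewrite Pd ?mul0r // eq_sym.
rewrite (bigD1 j) //= big1 ?addr0; last by move=> k kj; rewrite Pd ?mulr0.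
by rewrite mxE => e; apply: (mulfI p0); rewrite e !mulrA (mulfV p0) mul1r.
Qed.

Definition pw l : 'I_(dim l) -> F :=
  epsilon (inhabits (fun=> 0)) (fun p : 'I_(dim l) -> F =>
   [/\ forall i, inO (p i), forall i, ct (p i) = 1 &
      forall w i j, X l (w^-1)%g i j = (p i)^-1 * X l w j i * p j]).

Lemma pwP l : ispart l ->
  [/\ forall i, inO (@pw l i), forall i, ct (@pw l i) = 1 &
      forall w i j, X l (w^-1)%g i j = (@pw l i)^-1 * X l w j i * @pw l j].
Proof. by move=> /ortho_weights h; exact: (epsilon_spec _ _ h). Qed.

Lemma ct1_neq0 (a : F) : ct a = 1 -> a != 0.
Proof. by move=> c; apply/eqP=> e; move: c; rewrite e ct0 => /esym/eqP; rewrite oner_eq0. Qed.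

Lemma inO_ratio (a b : F) : inO a -> inO b -> ct a = 1 -> ct b = 1 ->
  inO (a / b) /\ ct (a / b) = 1.
Proof.
move=> aO bO a1 b1; have b0 : ct b != 0 by rewrite b1 oner_neq0.
have [h1 h2] := inO_inv bO b0; split; first exact: inOM.
by rewrite ctM // a1 h2 b1 invr1 mulr1.
Qed.

Definition wt l i j : F := @pw l i / @pw l j.
Lemma wt_O l i j : ispart l -> inO (@wt l i j).
Proof. by move=> /pwP[h1 h2 _]; case: (inO_ratio (h1 i) (h1 j) (h2 i) (h2 j)). Qed.
Lemma wt_ct l i j : ispart l -> ct (@wt l i j) = 1.
Proof. by move=> /pwP[h1 h2 _]; case: (inO_ratio (h1 i) (h1 j) (h2 i) (h2 j)). Qed.

Lemma X_inv l w i j : ispart l -> X l (w^-1)%g i j = wt j i * X l w j i.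
Proof. by move=> /pwP[_ _ ->]; rewrite /wt mulrC mulrA. Qed.

Lemma XX_flat l h i j : ispart l -> XX l (flat h) i j = wt j i * XX l h j i.
Proof.
move=> pl; rewrite /XX /Xh !summxE mulr_sumr (reindex_inj invg_inj) /=.
apply: eq_bigr => w _; rewrite !mxE flatE invgK X_inv //.
by rewrite mulrCA.
Qed.

Lemma cS_sumsq l i j : ispart l -> \sum_w wt i j * X l w i j ^+ 2 = cS l.
Proof.
move=> pl; have := cSP i j j i pl; rewrite !eqxx mul1r => <-.
apply: eq_bigr => w _; rewrite X_inv //.
by rewrite expr2 mulrCA.
Qed.

Lemma cS_neq0 l : ispart l -> cS l != 0.
Proof.
move=> pl; have d0 : (0 < dim l)%N by have [_ [h _]] := X_irr HX pl.
pose i0 := Ordinal d0; apply/eqP=> c0.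
have := cS_sumsq i0 i0 pl; rewrite c0.
move/(sumsq_eq0 (fun=> wt_O i0 i0 pl) (fun=> wt_ct i0 i0 pl))/(_ 1%g).
have [-> _] := X_rep HX pl; rewrite mxE eqxx => /eqP.
by rewrite oner_eq0.
Qed.

(** The central idempotent of [chi_l], by the usual character formula with the Schur element
    [cS l]. *)
Definition zc l : H := \sum_w (\tr (X l (w^-1)%g) / cS l) *: T w.

Lemma XX_zc l : ispart l -> XX l (zc l) = 1%:M.
Proof.
move=> pl; apply/matrixP=> i j; rewrite /zc XX_sum summxE.
transitivity (\sum_k \sum_w (X l w i j * X l (w^-1)%g k k) / cS l).
  rewrite exchange_big; apply: eq_bigr => w _ /=.
  rewrite XXZ XXT mxE /mxtrace mulrC mulrA mulr_sumr mulr_suml.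
  by apply: eq_bigr => k _.
transitivity (\sum_k ((i == k) && (j == k))%:R : F).
  apply: eq_bigr => k _; rewrite -mulr_suml cSP //.
  by rewrite mulfK // cS_neq0.
rewrite mxE (bigD1 i) //= eqxx big1 ?addr0 => [|k ki]; first by rewrite eq_sym.
by rewrite eq_sym (negPf ki).
Qed.

Lemma XX_zc_neq l mu : ispart l -> ispart mu -> mu != l -> XX mu (zc l) = 0.
Proof.
move=> pl pm ne; apply/matrixP=> i j; rewrite /zc XX_sum summxE [RHS]mxE.
transitivity (\sum_k \sum_w (X mu w i j * X l (w^-1)%g k k) / cS l).
  rewrite exchange_big; apply: eq_bigr => w _ /=.
  rewrite XXZ XXT mxE /mxtrace mulrC mulrA mulr_sumr mulr_suml.
  by apply: eq_bigr => k _.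
apply: big1 => k _; rewrite -mulr_suml Schur_neq_rel //.
by rewrite mul0r.
Qed.

Lemma sum_zc : \sum_(l | ispart l) zc l = 1.
Proof.
apply/eqP; rewrite -subr_eq0; apply/eqP; apply: (XX_faithful HX) => nu pn.
rewrite XXD XXN XX_sum (bigD1 nu) //= XX_zc // big1 ?addr0 => [|mu /andP[pm ne]].
  by rewrite (XX1 HX) // subrr.
by rewrite XX_zc_neq // eq_sym.
Qed.

(** Insert the decomposition of 1 into the [zc l]; by dual bases the coefficient at 1 of [h * zc l]
    is the normalised trace. *)
Lemma tau_trace h : h 1%g = \sum_(l | ispart l) \tr (XX l h) / cS l.
Proof.
rewrite -{1}[h]mulr1 -sum_zc mulr_sumr sumHE; apply: eq_bigr => l _.
rewrite /zc mulr_sumr sumHE /XX /Xh raddf_sum mulr_suml (reindex_inj invg_inj) /=.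
apply: eq_bigr => w _; rewrite -scalerAr scaleHE -coefE invgK mxtraceZ.
by rewrite [LHS]mulrC mulrA.
Qed.

(** Compare poles: squares on the right double the pole order and their leading terms cannot cancel,
    while the left side is linear in the entries. So any bound on the pole order can be lowered
    until none is left. *)
Lemma inO_idem m (u A : 'I_m -> 'I_m -> F) :
  (forall i k, inO (u i k)) -> (forall i k, ct (u i k) = 1) ->
  (forall i, A i i = \sum_k u i k * A i k ^+ 2) -> forall i k, inO (A i k).
Proof.
move=> uO u1 e.
have [N hN] := inO_ex_fin (fun p : 'I_m * 'I_m => A p.1 p.2).
have {}hN i k : inO (v ^+ N * A i k) by exact: (hN (i, k)).
elim: N hN => [|N IH] hN; first by move=> i k; have := hN i k; rewrite expr0 mul1r.
apply: IH => i k; apply: inO_ct0_iff; first exact: hN.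
have e1 : \sum_j u i j * (v ^+ N.+1 * A i j) ^+ 2 = v ^+ N.+1 * (v ^+ N.+1 * A i i).
  rewrite e !mulr_sumr; apply: eq_bigr => j _.
  by rewrite exprMn expr2 mulrCA !mulrA.
have := congr1 (@ct R) e1; rewrite [X in _ = X -> _]ct_vM; last exact: hN.
have hO j : inO (u i j * (v ^+ N.+1 * A i j) ^+ 2) by apply: inOM; [exact: uO|apply: inOX; exact: hN].
rewrite ct_sum; last by move=> j _; exact: hO.
have hc j : ct (u i j * (v ^+ N.+1 * A i j) ^+ 2) = ct (v ^+ N.+1 * A i j) ^+ 2.
  rewrite ctM; [|exact: uO|apply: inOX; exact: hN].
  by rewrite u1 mul1r ctX.
under eq_bigr => j _ do rewrite hc.
move/eqP; rewrite psumr_eq0; last by move=> j _; exact: sqr_ge0.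
move/allP => /(_ k (mem_index_enum k)) /=; rewrite sqrf_eq0 => /eqP; exact.
Qed.

Lemma quasi_idem_O mu h (p : F) i k : ispart mu -> flat h = h -> h * h = p *: h -> p != 0 ->
  inO (XX mu h i k / p).
Proof.
move=> pm fh hh p0; move: i k.
apply: (inO_idem (u := fun i k => wt i k) (A := fun i k => XX mu h i k / p)) => [i k|i k|i];
  [exact: wt_O|exact: wt_ct|].
have := congr1 (fun M => (XX mu M) i i) hh.
rewrite (XXM HX) // XXZ !mxE => e.
have -> : XX mu h i i / p = (\sum_j XX mu h i j * XX mu h j i) / p / p.
  by rewrite e [p * _]mulrC (mulfK p0).
rewrite !mulr_suml; apply: eq_bigr => k _.
rewrite -{2}fh XX_flat // expr2.
by move: (XX mu h i k) (wt i k) p^-1 => a b c; ring.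
Qed.

Lemma trace_Qs_O l mu : ispart mu -> inO (\tr (XX mu (Qs l)) / ps l).
Proof.
move=> pm; rewrite /mxtrace mulr_suml; apply: inO_bigsum => i _.
exact: (quasi_idem_O i i pm (flatQs R l) (QsQs R l) (ps_neq0 R l)).
Qed.

(** Evaluate the trace formula at [Qs l], whose coefficient at 1 is 1. The term of [l] is
    [ps l / cS l]; the others come from strictly larger [mu], where by induction [1 / cS mu] has the
    higher order [2 * aval mu]. So [1 / cS l] agrees with [1 / ps l] to leading order. *)
Lemma cS_asymp l : ispart l ->
  exists g : F, [/\ inO g, ct g = 1 & (cS l)^-1 = v ^+ (2 * aval l) * g].
Proof.
move: l; apply: dom_ind => l pl IH.
have p0 := ps_neq0 R l.
have [h1 h2] := pm_ct R (@bpart_mono n l) (longest_wlong l).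
pose P := v ^+ (2 * aval l) * ps l.
have PO : inO P by exact: h1. have P1 : ct P = 1 by exact: h2.
have [g0O g01] : inO P^-1 /\ ct P^-1 = 1.
  by have [a b] := inO_inv PO (eq_ind_r (fun a => a != 0) (oner_neq0 _) P1); rewrite b P1 invr1.
have eps : (ps l)^-1 = v ^+ (2 * aval l) * P^-1.
  by rewrite /P invfM mulrA (mulfV (vX_neq0 R _)) mul1r.
have tr1 : Qs l 1%g = 1 by rewrite Q1.
have := tau_trace (Qs l); rewrite tr1 (bigD1 l) //= (XX_trace1 HX) // => e.
have {}e : (cS l)^-1 = (ps l)^-1 -
    \sum_(mu | ispart mu && (mu != l)) (\tr (XX mu (Qs l)) / ps l) / cS mu.
  apply/eqP; rewrite eq_sym subr_eq; apply/eqP; apply: (mulfI p0).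
  rewrite (mulfV p0) {1}e mulrDr; congr (_ + _).
  rewrite mulr_sumr; apply: eq_bigr => mu _.
  by rewrite mulrA [_ * (_ / _)]mulrC (divfK p0).
have [r [rO r0 er]] : exists r, [/\ inO r, ct r = 0 &
    \sum_(mu | ispart mu && (mu != l)) (\tr (XX mu (Qs l)) / ps l) / cS mu =
      v ^+ (2 * aval l) * r].
  have each mu : ispart mu -> mu != l -> exists r, [/\ inO r, ct r = 0 &
      (\tr (XX mu (Qs l)) / ps l) / cS mu = v ^+ (2 * aval l) * r].
    move=> pm ne; have [z|nz] := eqVneq (XX mu (Qs l)) 0.
      exists 0; split; [exact: inO0|exact: ct0|].
      by rewrite z mxtrace0 !mul0r mulr0.
    have sd : sdom l mu by rewrite /sdom (Qs_support HX pm pl nz) eq_sym.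
    have [g [gO g1 ->]] := IH mu pm sd.
    have lt := aval_sdom pl pm sd.
    have [k ek] : exists k, (2 * aval mu = 2 * aval l + k.+1)%N.
      by exists (2 * aval mu - 2 * aval l).-1; lia.
    have tO := trace_Qs_O l pm.
    exists (v ^+ k.+1 * (\tr (XX mu (Qs l)) / ps l * g)); split.
    - by apply: inOM; [exact: inOXv|exact: inOM].
    - by apply: ct_vM; exact: inOM.
    by rewrite ek exprD mulrCA -!mulrA; congr (_ * _); rewrite mulrCA.
  have h mu : {r | ispart mu -> mu != l -> [/\ inO r, ct r = 0 &
      (\tr (XX mu (Qs l)) / ps l) / cS mu = v ^+ (2 * aval l) * r]}.
    apply: constructive_indefinite_description.
    have [pm|] := boolP (ispart mu); last by exists 0.
    have [ne|] := boolP (mu != l); last by exists 0.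
    by have [r hr] := each mu pm ne; exists r.
  exists (\sum_(mu | ispart mu && (mu != l)) sval (h mu)); split.
  - apply: inO_bigsum => mu /andP[pm ne].
    by case: (svalP (h mu) pm ne).
  - rewrite ct_sum; last by move=> mu /andP[pm ne]; case: (svalP (h mu) pm ne).
    by apply: big1 => mu /andP[pm ne]; case: (svalP (h mu) pm ne).
  rewrite mulr_sumr; apply: eq_bigr => mu /andP[pm ne].
  by case: (svalP (h mu) pm ne).
exists (P^-1 - r); split.
- by apply: inOD => //; exact: inON.
- by rewrite ctD ?ctN ?r0 ?oppr0 ?addr0 //; exact: inON.
by rewrite e er eps mulrBr.
Qed.

Lemma cS_lead l : ispart l ->
  inO (v ^+ (2 * aval l) * cS l) /\ ct (v ^+ (2 * aval l) * cS l) = 1.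
Proof.
move=> pl; have [g [gO g1 e]] := cS_asymp pl.
have c0 := cS_neq0 pl; have g0 := ct1_neq0 g1.
have -> : v ^+ (2 * aval l) * cS l = g^-1.
  by apply: (mulIf g0); rewrite (mulVf g0) mulrAC -e (mulVf c0).
have [a b] := inO_inv gO (eq_ind_r (fun a => a != 0) (oner_neq0 _) g1).
by rewrite b g1 invr1.
Qed.

(** The weighted squares of these scaled entries sum, over all [w], to [v ^+ (2 * aval l) * cS l],
    which is regular; hence each entry is. *)
Lemma X_lead_O l w i j : ispart l -> inO (v ^+ aval l * X l w i j).
Proof.
move=> pl; apply: (inO_sumsq (I := 'S_n) (u := fun=> wt i j)
  (f := fun w => v ^+ aval l * X l w i j)) => [w'|w'|]; [exact: wt_O|exact: wt_ct|].
have -> : \sum_w wt i j * (v ^+ aval l * X l w i j) ^+ 2 = v ^+ (2 * aval l) * cS l.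
  rewrite -(cS_sumsq i j pl) mulr_sumr; apply: eq_bigr => w' _.
  by rewrite exprMn -exprM mulnC mulrCA.
by case: (cS_lead pl).
Qed.
End SchurRelations.

(** * Integral leading coefficients and the bijection onto the symmetric group *)

Section LeadingCoefficients.
Variables (R : realType) (n : nat).
Variable dim : Part n -> nat.
Variable X : forall l : Part n, 'S_n -> 'M[K R]_(dim l).
Hypothesis HX : chosen_reps X.
Local Notation H := (hecke R n).
Local Notation F := (K R).
Local Notation v := (vK R).
Local Notation T := (@T R n).
Local Notation C := (@C R n).
Local Notation Qs := (@Qs R n).
Local Notation ps := (@ps R n).
Local Notation XX := (XX X).
Local Notation cco := (cco X).
Implicit Types (s t w x y z u d : 'S_n) (h g : H) (l mu nu kap : Part n).

Definition lead l w i j : F := v ^+ aval l * X l w i j.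
Arguments lead : clear implicits.

Lemma lead_O l w i j : ispart l -> inO (lead l w i j).
Proof. by move=> pl; apply: (X_lead_O HX). Qed.

Lemma ccoE l w (i j : 'I_(dim l)) : cco w i j = (-1) ^+ len w * ct (lead l w i j).
Proof. by []. Qed.

Lemma cco_neq0 l w (i j : 'I_(dim l)) : (cco w i j != 0) = (ct (lead l w i j) != 0).
Proof. by rewrite ccoE mulf_eq0 signr_eq0. Qed.

Lemma cco_mul l mu w (i j : 'I_(dim l)) (k m : 'I_(dim mu)) :
  cco w i j * cco w k m = ct (lead l w i j) * ct (lead mu w k m).
Proof. by rewrite !ccoE mulrACA -expr2 sqrr_sign mul1r. Qed.

Lemma lead_inv l w (i j : 'I_(dim l)) : ispart l ->
  ct (lead l (w^-1)%g i j) = ct (lead l w j i).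
Proof.
move=> pl; rewrite /lead (X_inv HX) // mulrCA [LHS]ctM ?(wt_ct HX) ?mul1r //; first exact: (wt_O HX).
exact: lead_O.
Qed.

Lemma cco_pairing l mu (i j : 'I_(dim l)) (k m : 'I_(dim mu)) : ispart l -> ispart mu ->
  \sum_w cco w i j * cco w k m =
  ct (v ^+ aval l * v ^+ aval mu * \sum_w X l w i j * X mu (w^-1)%g m k).
Proof.
move=> pl pm; rewrite mulr_sumr.
have e w : v ^+ aval l * v ^+ aval mu * (X l w i j * X mu (w^-1)%g m k) =
    lead l w i j * lead mu (w^-1)%g m k by rewrite mulrACA.
under [in RHS]eq_bigr => w _ do rewrite e.
rewrite ct_sum; last by move=> w _; apply: inOM; exact: lead_O.
apply: eq_bigr => w _; rewrite ctM; [|exact: lead_O|exact: lead_O].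
by rewrite cco_mul lead_inv.
Qed.

Lemma cco_ortho l (i j k m : 'I_(dim l)) : ispart l ->
  \sum_w cco w i j * cco w k m = ((i == k) && (j == m))%:R.
Proof.
move=> pl; rewrite cco_pairing // (cSP HX) // -exprD addnn -mul2n mulrCA.
have [h1 h2] := cS_lead HX pl.
case: andP => _; rewrite ?mul1r ?h2 //.
by rewrite mul0r ct0.
Qed.

Lemma cco_ortho_neq l mu (i j : 'I_(dim l)) (k m : 'I_(dim mu)) : ispart l -> ispart mu ->
  l != mu -> \sum_w cco w i j * cco w k m = 0.
Proof.
by move=> pl pm ne; rewrite cco_pairing // (Schur_neq_rel HX) // mulr0 ct0.
Qed.

(** Squares of integers summing to 1: exactly one of them is nonzero. *)
Lemma cco_unique l (i j : 'I_(dim l)) : ispart l ->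
  exists2 w : 'S_n, cco w i j ^+ 2 = 1 & forall w', w' != w -> cco w' i j = 0.
Proof.
move=> pl; have := cco_ortho i j i j pl; rewrite !eqxx /= => e.
have hz w : {z : int | cco w i j = z%:~R}.
  apply: constructive_indefinite_description.
  by case: HX => _ [_ [_ hz]]; exact: hz.
pose z w := sval (hz w); have zE w : cco w i j = (z w)%:~R := svalP (hz w).
have {}e : \sum_w z w * z w = 1.
  apply: (@intr_inj R); rewrite rmorph_sum /= -[RHS]e; apply: eq_bigr => w _.
  by rewrite zE intrM.
have [w zw] : exists w : 'S_n, z w != 0.
  apply/existsP; rewrite -[X in is_true X]negbK negb_exists; apply/negP=> /forallP h.
  move: e; rewrite big1 // => w _.
  by have := h w; rewrite negbK => /eqP ->; rewrite mulr0.
have pos w' : 0 <= z w' * z w' by rewrite -expr2 sqr_ge0.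
have h1 : 1 <= z w * z w by move: zw; move: (z w) => a a0; nia.
move: e; rewrite (bigD1 w) //=.
have : 0 <= \sum_(w' | w' != w) z w' * z w' by apply: sumr_ge0.
move=> ge0 e.
have zz : z w * z w = 1.
  by move: e ge0 h1; move: (\sum_(_ | _) _) (z w * z w) => a b; lia.
have s0 : \sum_(w' | w' != w) z w' * z w' = 0.
  by apply: (addrI (z w * z w)); rewrite e addr0 zz.
exists w; first by rewrite zE expr2 -intrM zz.
move=> w' ne; have := psumr_eq0P (fun a _ => pos a) s0 ne.
by rewrite zE => /eqP; rewrite mulf_eq0 orbb => /eqP ->.
Qed.

Lemma cco_sum1 l mu w (i j : 'I_(dim l)) (k m : 'I_(dim mu)) : ispart l -> cco w i j != 0 ->
  \sum_x cco x i j * cco x k m = cco w i j * cco w k m.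
Proof.
move=> pl nz; have [w0 _ h] := cco_unique i j pl.
have ew : w = w0 by apply/eqP; apply: contraNT nz => /h ->.
by rewrite (bigD1 w) //= big1 ?addr0 // => x; rewrite ew => /h ->; rewrite mul0r.
Qed.

Lemma cco_posinj l w (i j k m : 'I_(dim l)) : ispart l ->
  cco w i j != 0 -> cco w k m != 0 -> i = k /\ j = m.
Proof.
move=> pl h1 h2; have := cco_sum1 k m pl h1; rewrite cco_ortho //.
case: (@andP (i == k) (j == m)) => [[/eqP-> /eqP->] //|_] /esym/eqP.
by rewrite mulf_eq0 (negPf h1) (negPf h2).
Qed.

Lemma cco_winj l w w' (i j : 'I_(dim l)) : ispart l ->
  cco w i j != 0 -> cco w' i j != 0 -> w = w'.
Proof.
move=> pl h1 h2; have [w0 _ h] := cco_unique i j pl.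
have -> : w = w0 by apply/eqP; apply: contraNT h1 => /h ->.
by apply/eqP; rewrite eq_sym; apply: contraNT h2 => /h ->.
Qed.

Lemma RsetP l w : reflect (exists i j : 'I_(dim l), cco w i j != 0) (w \in Rset X l).
Proof.
rewrite inE; apply: (iffP existsP) => [[i /existsP[j h]]|[i [j h]]]; exists i.
  by exists j.
by apply/existsP; exists j.
Qed.

Lemma Rset_disj l mu w : ispart l -> ispart mu -> w \in Rset X l -> w \in Rset X mu -> l = mu.
Proof.
move=> pl pm /RsetP[i [j h1]] /RsetP[k [m h2]]; apply/eqP/negPn/negP=> ne.
have := cco_sum1 k m pl h1; rewrite cco_ortho_neq // => /esym/eqP.
by rewrite mulf_eq0 (negPf h1) (negPf h2).
Qed.

(** The trace of [T w * T (w^-1)] is 1. If all leading coefficients at [w] vanished, every summand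
    of its expansion by characters would have constant term 0. *)
Lemma Rset_cover w : exists2 l, ispart l & w \in Rset X l.
Proof.
have [//|no] := excluded_middle_informative (exists2 l, ispart l & w \in Rset X l).
have z l i j : ispart l -> ct (lead l w i j) = 0.
  move=> pl; apply/eqP/negPn/negP=> h; apply: no; exists l => //.
  by apply/RsetP; exists i, j; rewrite cco_neq0.
have := tau_trace HX (T w * T (w^-1)%g); rewrite tau_Tl TE eqxx => e.
suff : ct (1 : F) = 0 by rewrite ct1 => /eqP; rewrite oner_eq0.
rewrite [X in ct X]e.
have hl l : ispart l -> inO (\tr (XX l (T w * T (w^-1)%g)) / cS X l) /\
    ct (\tr (XX l (T w * T (w^-1)%g)) / cS X l) = 0.
  move=> pl; have [g [gO g1 ->]] := cS_asymp HX pl.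
  have -> : \tr (XX l (T w * T (w^-1)%g)) * (v ^+ (2 * aval l) * g) =
      \sum_i \sum_j lead l w i j * lead l (w^-1)%g j i * g.
    rewrite (XXM HX) // !XXT /mxtrace mulr_suml; apply: eq_bigr => i _.
    rewrite mxE mulr_suml; apply: eq_bigr => j _.
    rewrite /lead mul2n -addnn exprD.
    by move: (v ^+ aval l) (X l w i j) (X l _ j i) => a b c; ring.
  have tO i j : inO (lead l w i j * lead l (w^-1)%g j i).
    by apply: inOM; exact: lead_O.
  split; first by apply: inO_bigsum => i _; apply: inO_bigsum => j _; exact: inOM.
  rewrite ct_sum; last by move=> i _; apply: inO_bigsum => j _; exact: inOM.
  apply: big1 => i _; rewrite ct_sum; last by move=> j _; exact: inOM.
  apply: big1 => j _; rewrite ctM // ctM ?z ?mul0r //; exact: lead_O.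
rewrite ct_sum; last by move=> l /hl[].
by apply: big1 => l /hl[].
Qed.

(** The coefficients of [C w] away from [w] vanish at [v = 0], so [C w] and [T w] have the same
    leading coefficients. *)
Lemma lead_C l w i j : ispart l ->
  inO (v ^+ aval l * XX l (C w) i j) /\ ct (v ^+ aval l * XX l (C w) i j) = ct (lead l w i j).
Proof.
move=> pl.
have -> : v ^+ aval l * XX l (C w) i j = lead l w i j + \sum_(y | y != w) C w y * lead l y i j.
  rewrite XXE summxE (bigD1 w) //= mxE C_diag mul1r mulrDr; congr (_ + _).
  by rewrite mulr_sumr; apply: eq_bigr => y _; rewrite mxE mulrCA.
have h y : y != w -> inO (C w y * lead l y i j).
  by move=> /(C_off R)[_ cO _]; apply: inOM => //; exact: lead_O.
split; first by apply: inOD; [exact: lead_O|exact: inO_bigsum].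
rewrite ctD; [|exact: lead_O|exact: inO_bigsum].
rewrite ct_sum // big1 ?addr0 // => y /(C_off R)[_ cO c0].
by rewrite ctM ?c0 ?mul0r //; exact: lead_O.
Qed.

Lemma C_wlong l : C (wlong l) = (- v) ^+ aval l *: Qs l.
Proof. exact: (C_longest R (@bpart_mono n l) (longest_wlong l)). Qed.

(** The trace of [v ^+ aval l * X (C (wlong l))] is, up to sign, the normalised Poincaré polynomial
    with constant term 1, so some diagonal leading coefficient survives. *)
Lemma wlong_diag l : ispart l -> exists i : 'I_(dim l), cco (wlong l) i i != 0.
Proof.
move=> pl; apply/existsP; rewrite -[X in is_true X]negbK negb_exists; apply/negP=> /forallP h.
have [h1 h2] := pm_ct R (@bpart_mono n l) (longest_wlong l).
have e : \sum_i v ^+ aval l * XX l (C (wlong l)) i i = (-1) ^+ aval l * (v ^+ (2 * aval l) * ps l).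
  rewrite -(XX_trace1 HX) // -mulr_sumr -/(mxtrace _) C_wlong XXZ mxtraceZ mul2n -addnn exprD [(- v) ^+ _]exprNn.
  by move: ((-1) ^+ _) (v ^+ _) (\tr _) => a b c; ring.
have := congr1 (@ct R) e; rewrite ct_sum; last by move=> i _; case: (lead_C (wlong l) i i pl).
rewrite big1 => [|i _]; last first.
  by have [_ ->] := lead_C (wlong l) i i pl; have := h i; rewrite cco_neq0 negbK => /eqP.
have sO : inO ((-1) ^+ aval l : F) by apply: inOX; exact: inON1.
rewrite ctM // ?ctX ?ctN1 ?h2 ?mulr1 //; last exact: inON1.
by move/esym/eqP; rewrite signr_eq0.
Qed.

Lemma wlong_Rset l : ispart l -> wlong l \in Rset X l.
Proof. by move=> /wlong_diag[i h]; apply/RsetP; exists i, i. Qed.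

(** The element [1 + v *: T s] is self-adjoint and quasi-idempotent with scalar [1 + v ^+ 2], a unit
    of the local ring. *)
Lemma vTs_O l s i j : ispart l -> s \in Sgen n -> inO (v * X l s i j).
Proof.
move=> pl sS; pose h : H := 1 + v *: T s; pose p : F := 1 + v ^+ 2.
have pO : inO p by apply: inOD; [exact: inO1|exact: inOXv].
have p1 : ct p = 1 by rewrite ctD ?ct1 ?ctXv ?addr0 //; [exact: inO1|exact: inOXv].
have p0 : p != 0 by exact: ct1_neq0.
have fh : flat h = h by rewrite /h linearD /= flat1 flatZ flatT (sgenV sS).
have hh : h * h = p *: h.
  rewrite /h mulrDl mul1r mulrDr mulr1 -scalerAl -scalerAr (Ts2 R sS) /p.
  have e : v * v * (v - v^-1) = v ^+ 3 - v.
    by rewrite mulrBr -mulrA (mulfK (v_neq0 R)) !exprS expr0 mulr1.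
  apply/ffunP=> y; rewrite !scalerDr !scalerA e !(addHE, scaleHE).
  move: ((1 : H) y) (T s y) => a b; ring.
have := quasi_idem_O HX i j pl fh hh p0.
move=> q; have : inO (XX l h i j) by rewrite -(divfK p0 (XX l h i j)); exact: inOM.
rewrite /h XXD (XX1 HX) // XXZ XXT mxE mxE [X in _ + X]mxE => hO.
have -> : v * X l s i j = ((i == j)%:R + v * X l s i j) - (i == j)%:R.
  by rewrite addrAC subrr add0r.
apply: inOD => //; apply: inON; case: (i == j); [exact: inO1|exact: inO0].
Qed.

(** The eigenvalue equation for [C (wlong l)] shows that [v * X s] has constant term -1 at
    [(i0, i0)]. If [s] were not a descent of [w], the leading coefficient of [w] at [(i, i0)] would
    be, up to sign, the constant term of [v] times a regular entry of [X (w * s)], which is 0. *)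
Lemma leftcell_rdesc l w s (i i0 : 'I_(dim l)) : ispart l ->
  cco (wlong l) i0 i0 != 0 -> cco w i i0 != 0 -> s \in bgens (bpart l) -> rdesc w s.
Proof.
move=> pl h0 hw sb; have sS := bgens_Sgen sb; apply/negPn/negP=> nd.
pose S k j : F := v * X l s k j.
have SO k j : inO (S k j) by exact: vTs_O.
have lead_off x a b j : cco x a b != 0 -> j != b -> ct (lead l x a j) = 0.
  move=> hx ne; apply/eqP/negPn/negP; rewrite -cco_neq0 => hx'.
  by have [_ e] := cco_posinj pl hx hx'; rewrite e eqxx in ne.
have CS : ct (S i0 i0) = -1.
  have e : C (wlong l) * T s = - v^-1 *: C (wlong l).
    by apply: C_rdesc => //; case: (longest_wlong l) => _; exact.
  have {}e := congr1 (fun h => v * (v ^+ aval l * XX l h i0 i0)) e.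
  move: e; rewrite (XXM HX) // XXT XXZ !mxE.
  have -> : v * (v ^+ aval l * (- v^-1 * XX l (C (wlong l)) i0 i0)) =
     - (v ^+ aval l * XX l (C (wlong l)) i0 i0).
    have v0 := v_neq0 R; rewrite mulrCA mulNr mulrN mulrA (mulfV v0) mul1r mulrN.
    by [].
  have -> : v * (v ^+ aval l * \sum_j XX l (C (wlong l)) i0 j * X l s j i0) =
     \sum_j v ^+ aval l * XX l (C (wlong l)) i0 j * S j i0.
    rewrite !mulr_sumr; apply: eq_bigr => j _; rewrite /S.
    by move: (v ^+ aval l) (XX _ _ _ _) (X l s _ _) => a b c; ring.
  move/(congr1 (@ct R)); have lc := lead_C (wlong l) _ _ pl.
  rewrite ctN; last by case: (lc i0 i0).
  rewrite ct_sum; last by move=> j _; apply: inOM => //; case: (lc i0 j).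
  rewrite (bigD1 i0) //= big1 ?addr0 => [|j ne]; last first.
    have [q1 q2] := lc i0 j; rewrite ctM // q2 (lead_off _ _ _ _ h0 ne) mul0r.
    by [].
  have [q1 ->] := lc i0 i0; rewrite ctM //; have [_ ->] := lc i0 i0.
  rewrite cco_neq0 in h0; move=> e; apply: (mulfI h0).
  by rewrite e mulrN1.
have e : T w * T s = T (w * s)%g by exact: TMs.
have {}e := congr1 (fun h => v * (v ^+ aval l * XX l h i i0)) e.
move: e; rewrite (XXM HX) // !XXT mxE.
have -> : v * (v ^+ aval l * \sum_j X l w i j * X l s j i0) = \sum_j lead l w i j * S j i0.
  rewrite !mulr_sumr; apply: eq_bigr => j _; rewrite /S /lead.
  by move: (v ^+ aval l) (X l w _ _) (X l s _ _) => a b c; ring.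
move/(congr1 (@ct R)); rewrite -{1}[v]expr1 ct_vM; last exact: lead_O.
rewrite ct_sum; last by move=> j _; apply: inOM => //; exact: lead_O.
rewrite (bigD1 i0) //= big1 ?addr0 => [|j ne]; last first.
  rewrite ctM //; last exact: lead_O.
  by rewrite (lead_off _ _ _ _ hw ne) mul0r.
rewrite ctM //; last exact: lead_O.
rewrite CS mulrN1 => /eqP; rewrite oppr_eq0; apply/negP.
by rewrite -cco_neq0.
Qed.
End LeadingCoefficients.
Arguments lead {R n dim} X l w i j.

(** * Two-sided cells *)

Section LaurentProducts.
Variables (R : realType) (n : nat).
Local Notation H := (hecke R n).
Local Notation v := (vK R).
Local Notation T := (@T R n).
Implicit Types (s w y : 'S_n) (h : H).

Lemma Laur_Ts s h : s \in Sgen n -> (forall y, Laur (h y)) -> forall y, Laur ((T s * h) y).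
Proof.
move=> sS hL y; have := Tplus_coef h y sS; rewrite mulrDl -scalerAl mul1r addHE scaleHE => e.
rewrite -(addrK (v^-1 * h y) ((T s * h) y)) e; apply: LaurB.
  apply: LaurD => //; apply: LaurM => //.
  by case: (desc s y); [exact: Laurv|exact: LaurV].
by apply: LaurM => //; exact: LaurV.
Qed.

Lemma Laur_mul h h' : (forall y, Laur (h y)) -> (forall y, Laur (h' y)) ->
  forall y, Laur ((h * h') y).
Proof.
move=> hL hL' y; rewrite (hecke_basis h) mulr_suml sumHE; apply: Laur_sum => w _.
rewrite -scalerAl scaleHE; apply: LaurM => //.
move: w y; apply: (@T_ind n (fun w => forall y, Laur ((T w * h') y))) => [y|s w sS a IH].
  by rewrite T1 mul1r.
by move=> y; rewrite -(TsM R sS a) -mulrA; apply: Laur_Ts.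
Qed.
End LaurentProducts.

Section CellsOfFamily.
Variables (R : realType) (n : nat).
Variable dim : Part n -> nat.
Variable X : forall l : Part n, 'S_n -> 'M[K R]_(dim l).
Hypothesis HX : chosen_reps X.
Local Notation H := (hecke R n).
Local Notation F := (K R).
Local Notation v := (vK R).
Local Notation T := (@T R n).
Local Notation C := (@C R n).
Local Notation Qs := (@Qs R n).
Local Notation ps := (@ps R n).
Local Notation XX := (XX X).
Local Notation cco := (cco X).
Local Notation lead := (lead X).
Local Notation Rset := (Rset X).
Implicit Types (s t w x y z u d : 'S_n) (h g : H) (l mu nu kap : Part n) (b : 'S_n -> F).

Lemma lead_comb b l i j w : ispart l -> (forall y, inO (b y)) -> cco w i j != 0 ->
  inO (v ^+ aval l * XX l (\sum_y b y *: C y) i j) /\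
  ct (v ^+ aval l * XX l (\sum_y b y *: C y) i j) = ct (b w) * ct (lead l w i j).
Proof.
move=> pl bO hw.
have -> : v ^+ aval l * XX l (\sum_y b y *: C y) i j =
    \sum_y b y * (v ^+ aval l * XX l (C y) i j).
  rewrite XX_sum summxE mulr_sumr; apply: eq_bigr => y _.
  by rewrite XXZ mxE mulrCA.
have lc y := lead_C HX y i j pl.
have hO y : inO (b y * (v ^+ aval l * XX l (C y) i j)).
  by apply: inOM => //; case: (lc y).
split; first exact: inO_bigsum.
rewrite ct_sum // (bigD1 w) //= big1 ?addr0 => [|y ne].
  by have [q1 q2] := lc w; rewrite ctM // q2.
have [q1 q2] := lc y; rewrite ctM // q2.
suff -> : ct (lead l y i j) = 0 by rewrite mulr0.
apply/eqP/negPn/negP; rewrite -cco_neq0 => hy.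
by rewrite (cco_winj HX pl hy hw) eqxx in ne.
Qed.

(** In terms of the ideals of the overview: [C y] belongs to [N_kap] for all [y] in [Rset kap]. *)
Definition controlled kap := forall y mu, y \in Rset kap -> ispart mu ->
  XX mu (C y) != 0 -> dominates kap mu.

Definition inRs (D : Part n -> bool) y := [exists kap, [&& ispart kap, D kap & y \in Rset kap]].

Lemma inRsP (D : Part n -> bool) y : reflect (exists kap, [/\ ispart kap, D kap & y \in Rset kap]) (inRs D y).
Proof. by apply: (iffP existsP) => -[kap /and3P h]; exists kap. Qed.

Section Support.
Variable D : Part n -> bool.
Hypothesis Dup : forall kap mu, ispart kap -> ispart mu -> D kap -> dominates kap mu -> D mu.
Hypothesis Dcon : forall kap, ispart kap -> D kap -> controlled kap.

Lemma inRs_kill y mu : inRs D y -> ispart mu -> ~~ D mu -> XX mu (C y) = 0.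
Proof.
move=> /inRsP[kap [pk Dk yR]] pm; apply: contraNeq => nz.
exact: Dup pk pm Dk (Dcon pk Dk yR pm nz).
Qed.

(** Terms indexed by [D] are invisible to representations outside [D], so they may be discarded
    before comparing leading coefficients. *)
Lemma XX_truncate b mu : ispart mu -> ~~ D mu ->
  XX mu (\sum_y (if inRs D y then 0 else b y) *: C y) = XX mu (\sum_y b y *: C y).
Proof.
move=> pm nD; rewrite !XX_sum; apply: eq_bigr => y _; rewrite !XXZ.
by case: ifP => // yD; rewrite (inRs_kill yD pm nD) !scaler0.
Qed.

(** An index outside [D] owns a matrix position [(i, j)] of a representation outside [D], where no
    other index has a leading coefficient; the constant term of [b y] can be read there. *)
Lemma descend b : (forall y, inRs D y -> b y = 0) ->
  (forall mu, ispart mu -> ~~ D mu -> forall i j, ct (v ^+ aval mu * XX mu (\sum_y b y *: C y) i j) = 0) ->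
  (forall y, inO (b y)) -> forall y, ct (b y) = 0.
Proof.
move=> bD bX bO y; have [yD|yD] := boolP (inRs D y); first by rewrite bD // ct0.
have [kap pk yR] := Rset_cover HX y; have [i [j hy]] := RsetP X kap y yR.
have nD : ~~ D kap by apply: contra yD => Dk; apply/inRsP; exists kap.
have [_] := lead_comb pk bO hy; rewrite bX // => /esym/eqP.
by rewrite mulf_eq0 -[X in _ || X]negbK -cco_neq0 hy orbF => /eqP.
Qed.

(** The truncated coordinates still give an element killed outside [D]. Repeated use of [descend]
    divides them by one more power of [v] each time, so they are 0. *)
Lemma support h : (forall mu, ispart mu -> ~~ D mu -> XX mu h = 0) ->
  forall y, ~~ inRs D y -> coC h y = 0.
Proof.
move=> hX; pose b y := if inRs D y then 0 else coC h y.
have bX mu : ispart mu -> ~~ D mu -> XX mu (\sum_y b y *: C y) = 0.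
  by move=> pm nD; rewrite XX_truncate // -coCE hX.
have [N hN] := inO_ex_fin b.
suff b0 y : b y = 0 by move=> y yD; have := b0 y; rewrite /b (negPf yD).
have step m : forall y, inO (v ^+ N * b y / v ^+ m).
  elim: m => [|m IH] {}y; first by rewrite expr0 divr1.
  have e z : v ^+ N * b z / v ^+ m = (v ^+ N / v ^+ m) * b z by rewrite mulrAC.
  rewrite exprSr invfM mulrA; apply: inO_ct0; first exact: IH.
  apply: (descend (b := fun z => v ^+ N * b z / v ^+ m)) => [z zD|mu pm nD i j|//].
    by rewrite /b zD mulr0 mul0r.
  under eq_bigr => z _ do rewrite e -scalerA.
  by rewrite -scaler_sumr XXZ bX // scaler0 mxE mulr0 ct0.
have := inO_all0 (fun m => step m y) => /eqP; rewrite mulf_eq0 (negPf (vX_neq0 R N)) /=.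
by move/eqP.
Qed.

(** Applied to [v ^+ N.+1 * b], [descend] removes the poles one order at a time; applied to [b]
    itself it removes the constant terms. Bar-invariance then finishes. *)
Lemma bar_vanish b : (forall y, inRs D y -> b y = 0) ->
  (forall mu, ispart mu -> ~~ D mu -> forall i j,
     inO (v ^+ aval mu * XX mu (\sum_y b y *: C y) i j) /\
     ct (v ^+ aval mu * XX mu (\sum_y b y *: C y) i j) = 0) ->
  (forall y, Laur (b y) /\ barK (b y) = b y) -> forall y, b y = 0.
Proof.
move=> bD bX bL.
have bXm m mu i j : ispart mu -> ~~ D mu ->
    ct (v ^+ aval mu * XX mu (\sum_y (v ^+ m * b y) *: C y) i j) = 0.
  move=> pm nD; have [h1 h2] := bX mu pm nD i j.
  under eq_bigr => z _ do rewrite -scalerA.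
  rewrite -scaler_sumr XXZ mxE mulrCA.
  by case: m => [|m]; [rewrite expr0 mul1r|rewrite ct_vM].
have bD' m y : inRs D y -> v ^+ m * b y = 0 by move=> /bD ->; rewrite mulr0.
have [N hN] := inO_ex_fin b.
have bO : forall y, inO (b y).
  elim: N hN => [|N IH] hN; first by move=> y; have := hN y; rewrite expr0 mul1r.
  apply: IH => y; apply: inO_ct0_iff; first exact: hN.
  apply: (descend (b := fun z => v ^+ N.+1 * b z)) => [z|mu pm nD i j|//]; first exact: bD'.
  exact: bXm.
have b0 : forall y, ct (b y) = 0.
  apply: descend => // mu pm nD i j; by case: (bX mu pm nD i j).
by move=> y; have [h1 h2] := bL y; exact: Laur_bar_eq0.
Qed.
End Support.

(** Here [z] has the right descents and [z'] the left descents of [w0 = wlong nu], so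
    [C z = g * C w0] and [C z' = C w0 * flat g2], and the product contains the scalar [P] with
    [C w0 * C w0 = P *: C w0]. Since [P] is bar-invariant of order [v^-a], with [a = aval nu],
    dividing by it keeps bar-invariance and brings the order [v^(-2a)] of the product back to
    [v^-a]. Written as [g * C z'], the quotient visibly has Laurent coefficients. *)
Lemma cell_product nu (i j : 'I_(dim nu)) : ispart nu ->
  exists B : H, [/\ bH B = B, forall y, Laur (B y),
    exists g g' : H, B = g * C (wlong nu) * g' &
    exists2 al : R, al != 0 & forall k m, inO (v ^+ aval nu * XX nu B k m) /\
      ct (v ^+ aval nu * XX nu B k m) = ((k == i) && (m == j))%:R * al].
Proof.
move=> pn; have [i0 hi0] := wlong_diag HX pn; set w0 := wlong nu in hi0 *.
have nz w (k m : 'I_(dim nu)) : cco w k m ^+ 2 = 1 -> cco w k m != 0.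
  by move=> e; apply/eqP=> z0; move: e; rewrite z0 expr2 mul0r => /esym/eqP; rewrite oner_eq0.
have [z /nz hz _] := cco_unique HX i i0 pn; have [z' /nz hz' _] := cco_unique HX i0 j pn.
have lw : longest (bpart nu) w0 := longest_wlong nu.
have [g [gL eg]] := C_factor R (@bpart_mono n nu) lw (fun s sb => leftcell_rdesc HX pn hi0 hz sb).
have hzV : cco (z'^-1)%g j i0 != 0 by rewrite cco_neq0 (lead_inv HX) // -cco_neq0.
have [g2 [g2L eg2]] := C_factor R (@bpart_mono n nu) lw (fun s sb => leftcell_rdesc HX pn hi0 hzV sb).
have eg' : C z' = C w0 * flat g2.
  by rewrite -[z']invgK -C_flat eg2 flatM C_flat (longestV (@bpart_mono n nu) lw).
pose P : F := (- v) ^+ aval nu * ps nu.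
have CC : C w0 * C w0 = P *: C w0.
  rewrite (C_wlong R nu) -scalerAl -scalerAr QsQs !scalerA /P.
  by congr (_ *: _); move: ((- v) ^+ _) (ps nu) => a b; ring.
have P0 : P != 0 by apply: mulf_neq0; [apply: expf_neq0; rewrite oppr_eq0; exact: v_neq0|exact: ps_neq0].
have Pbar : barK P = P.
  have := congr1 (fun h => bH h w0) CC; rewrite bHM C_bar CC bHZ C_bar !scaleHE C_diag !mulr1.
  by move/esym.
pose B := g * C w0 * flat g2.
have eB : C z * C z' = P *: B by rewrite eg eg' /B mulrA -[g * C w0 * C w0]mulrA CC -scalerAr -scalerAl.
exists B; split.
- have := congr1 (@bH R n) eB; rewrite bHM !C_bar eB bHZ Pbar => /esym.
  by move/(scalerI P0).
- move=> y; rewrite /B -mulrA -eg'; apply: Laur_mul => //; exact: C_Laur.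
- by exists g, (flat g2).
pose al0 : R := ct (lead nu z i i0) * ct (lead nu z' i0 j).
have [h1 h2] := pm_ct R (@bpart_mono n nu) lw.
pose u : F := v ^+ aval nu * P.
have [uO u1] : inO u /\ ct u = (-1) ^+ aval nu.
  have sO : inO ((-1) ^+ aval nu : F) by apply: inOX; exact: inON1.
  have -> : u = (-1) ^+ aval nu * (v ^+ (2 * aval nu) * ps nu).
    rewrite /u /P mul2n -addnn exprD [(- v) ^+ _]exprNn.
    by move: ((-1) ^+ _) (v ^+ _) (ps nu) => a b c; ring.
  split; first exact: inOM.
  by rewrite ctM // h2 mulr1 ctX ?ctN1 //; exact: inON1.
have u0 : ct u != 0 by rewrite u1 signr_eq0.
have [uO' u1'] := inO_inv uO u0.
have un0 : u != 0 by apply/eqP=> e; rewrite e ct0 eqxx in u0.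
exists (al0 / ct u).
  by rewrite mulf_neq0 ?invr_eq0 // /al0 mulf_neq0 // -cco_neq0.
move=> k m; pose M : F := \sum_p (v ^+ aval nu * XX nu (C z) k p) * (v ^+ aval nu * XX nu (C z') p m).
have lz p := lead_C HX z k p pn; have lz' p := lead_C HX z' p m pn.
have termO p : inO ((v ^+ aval nu * XX nu (C z) k p) * (v ^+ aval nu * XX nu (C z') p m)).
  by apply: inOM; [case: (lz p)|case: (lz' p)].
have MO : inO M by apply: inO_bigsum.
have cM : ct M = ((k == i) && (m == j))%:R * al0.
  have off x (p q r t : 'I_(dim nu)) : cco x r t != 0 -> ~~ ((p == r) && (q == t)) ->
      ct (lead nu x p q) = 0.
    move=> hx; apply: contraNeq; rewrite -cco_neq0 => hx'.
    by have [-> ->] := cco_posinj HX pn hx' hx; rewrite !eqxx.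
  rewrite ct_sum // (bigD1 i0) //= big1 ?addr0 => [|p pi0].
    have [q1 q2] := lz i0; have [q3 q4] := lz' i0; rewrite ctM // q2 q4.
    have [->|ki] := eqVneq k i; last by rewrite (off z k i0 i i0) ?mul0r // (negPf ki).
    have [->|mj] := eqVneq m j; first by rewrite mul1r.
    by rewrite (off z' i0 m i0 j) ?mulr0 ?mul0r // (negPf mj) andbF.
  have [q1 q2] := lz p; have [q3 q4] := lz' p; rewrite ctM // q2.
  by rewrite (off z k p i i0) ?mul0r // (negPf pi0) andbF.
have -> : v ^+ aval nu * XX nu B k m = M / u.
  apply: (mulIf un0); rewrite (divfK un0) /u.
  have := congr1 (fun h => v ^+ aval nu * v ^+ aval nu * XX nu h k m) eB.
  rewrite (XXM HX) // XXZ !mxE => e.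
  transitivity (v ^+ aval nu * v ^+ aval nu * (P * XX nu B k m)).
    by move: (v ^+ _) (XX nu B k m) (P) => a b c; ring.
  rewrite -e mulr_sumr; apply: eq_bigr => p _.
  by rewrite mulrACA.
split; first exact: inOM.
by rewrite ctM // cM u1' mulrA.
Qed.

Lemma cell_structure nu : ispart nu ->
  controlled nu /\ forall y, y \in Rset nu -> leLR R y (wlong nu).
Proof.
move: nu; apply: dom_ind => nu pn IH.
suff main y0 : y0 \in Rset nu ->
    (forall mu, ispart mu -> XX mu (C y0) != 0 -> dominates nu mu) /\ leLR R y0 (wlong nu).
  by split=> [y mu yR pm|y yR]; [case: (main y yR) => h _; exact: h|case: (main y yR)].
move=> y0R; have [i [j hy0]] := RsetP X nu y0 y0R.
have [B [Bbar BL [g [g' eB]] [al al0 hB]]] := cell_product i j pn.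
have BX mu : ispart mu -> ~~ dominates nu mu -> XX mu B = 0.
  move=> pm nd; rewrite eB (XXM HX) // (XXM HX) // (C_wlong R nu) XXZ.
  have -> : XX mu (Qs nu) = 0 by apply: contraNeq nd; exact: Qs_support.
  by rewrite scaler0 mulmx0 mul0mx.
pose D : Part n -> bool := sdom nu.
have Dup kap mu : ispart kap -> ispart mu -> D kap -> dominates kap mu -> D mu.
  move=> pk pm /andP[d1 ne] d2; rewrite /D /sdom (dom_trans d1 d2) /=.
  by apply: contraNneq ne => e; apply/eqP/dom_anti => //; rewrite e.
have Dcon kap : ispart kap -> D kap -> controlled kap by move=> pk Dk; case: (IH kap pk Dk).
(* Chosen so that [B - gam *: C y0] has no leading coefficient at [(i, j)]. Being a real constant,
   [gam] is fixed by bar. *)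
pose c0 := al / ct (lead nu y0 i j).
pose gam : F := frK c0%:P.
have l0 : ct (lead nu y0 i j) != 0 by rewrite -cco_neq0.
have c00 : c0 != 0 by rewrite mulf_neq0 ?invr_eq0.
have gO : inO gam by exact: inO_frK.
have gc : ct gam = c0 by rewrite ct_frK hornerC.
have y0D : ~~ inRs D y0.
  apply/inRsP=> -[kap [pk /andP[_ ne] yR]]; case/eqP: ne.
  exact: (Rset_disj HX pn pk y0R yR).
pose b0 y := coC B y - (y == y0)%:R * gam.
(* The coordinates indexed by strictly larger partitions are dropped; what remains is tested only
   outside [D]. *)
pose b y := if inRs D y then 0 else b0 y.
have sum0 : \sum_y b0 y *: C y = B - gam *: C y0.
  rewrite /b0; under eq_bigr => y _ do rewrite scalerBl.
  rewrite big_split /= -coCE sumrN; congr (_ - _).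
  rewrite (bigD1 y0) //= eqxx mul1r big1 ?addr0 // => y ne.
  by rewrite (negPf ne) mul0r scale0r.
have bz : forall y, b y = 0.
  apply: (bar_vanish (D := D)) => [y yD|mu pm nD k m|y].
  - by rewrite /b yD.
  - rewrite (XX_truncate Dup Dcon) // sum0 XXD XXN XXZ mxE mxE mxE mulrBr.
    have [q1 q2] := lead_C HX y0 k m pm.
    rewrite [v ^+ _ * (gam * _)]mulrCA.
    have [emu|ne] := eqVneq mu nu.
      subst mu; have [q3 q4] := hB k m.
      split; first by apply: inOD => //; apply: inON; exact: inOM.
      rewrite ctD //; last by apply: inON; exact: inOM.
      rewrite ctN; last exact: inOM.
      rewrite q4 ctM // q2 gc /c0.
      have [/andP[/eqP-> /eqP->]|ne] := boolP ((k == i) && (m == j)).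
        by rewrite mul1r divfK ?subrr.
      suff -> : ct (lead nu y0 k m) = 0 by rewrite mul0r mulr0 subrr.
      apply: contraNeq ne; rewrite -cco_neq0 => hk.
      by have [-> ->] := cco_posinj HX pn hk hy0; rewrite !eqxx.
    have nd : ~~ dominates nu mu by apply: contra nD => d; rewrite /D /sdom d eq_sym.
    have -> : XX mu B k m = 0 by rewrite BX // mxE.
    rewrite mulr0 sub0r; split; first by apply: inON; exact: inOM.
    rewrite ctN; last exact: inOM.
    rewrite ctM // q2; suff -> : ct (lead mu y0 k m) = 0 by rewrite mulr0 oppr0.
    apply/eqP/negPn/negP; rewrite -cco_neq0 => hk; case/eqP: ne.
    by apply: (Rset_disj HX pm pn _ y0R); apply/RsetP; exists k, m.
  rewrite /b; case: ifP => _; first by split; [exact: Laur0|exact: rmorph0].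
  rewrite /b0; split.
    apply: LaurB; first exact: coC_Laur.
    apply: LaurM; last exact: Laur_frK.
    by case: (y == y0); [exact: Laur1|exact: Laur0].
  rewrite rmorphB rmorphM rmorph_nat /= coC_bar //; congr (_ - _ * _).
  by rewrite /gam barK_frK /evinv map_polyC hornerC /= pKE.
have By0 : coC B y0 != 0.
  have := bz y0; rewrite /b (negPf y0D) /b0 eqxx mul1r => /eqP; rewrite subr_eq0 => /eqP ->.
  by apply/eqP=> e; move: gc; rewrite e ct0 => /esym/eqP; apply/negP.
split; last by apply: (leLR_closed (h := g) (h' := g')); rewrite -eB.
have gam0 : gam != 0 by apply/eqP=> e; move: gc; rewrite e ct0 => /esym/eqP; apply/negP.
move=> mu pm; apply: contraNT => nd.
have nD : ~~ D mu by apply: contra nd => /andP[].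
have : XX mu (\sum_y b y *: C y) = 0.
  by rewrite XX_sum big1 // => y _; rewrite bz scale0r XX0.
rewrite (XX_truncate Dup Dcon) // sum0 XXD XXN XXZ BX // sub0r => /eqP.
by rewrite oppr_eq0 scaler_eq0 (negPf gam0).
Qed.
End CellsOfFamily.

(** * The two-sided preorder against dominance *)

Section CellOrder.
Variables (R : realType) (n : nat).
Variable dim : Part n -> nat.
Variable X : forall l : Part n, 'S_n -> 'M[K R]_(dim l).
Hypothesis HX : chosen_reps X.
Local Notation H := (hecke R n).
Local Notation F := (K R).
Local Notation v := (vK R).
Local Notation T := (@T R n).
Local Notation C := (@C R n).
Local Notation Qs := (@Qs R n).
Local Notation XX := (XX X).
Local Notation Rset := (Rset X).
Local Notation inRs := (inRs X).
Implicit Types (s t w x y z u d : 'S_n) (h g : H) (l mu nu kap : Part n).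

Lemma controlled_part l : ispart l -> controlled X l.
Proof. by move=> pl; case: (cell_structure HX pl). Qed.

(** By [support], the elements killed by all representations not above [mu] are spanned by the [C y]
    indexed above [mu]. This span is a two-sided ideal, so its index set is closed under the
    preorder. *)
Lemma leLR_dom l mu x y : ispart l -> ispart mu -> x \in Rset l -> y \in Rset mu ->
  leLR R x y -> dominates mu l.
Proof.
move=> pl pm xR yR lexy; pose D : Part n -> bool := dominates mu.
have Dup kap nu : ispart kap -> ispart nu -> D kap -> dominates kap nu -> D nu.
  by move=> _ _ d1 d2; exact: dom_trans d1 d2.
have Dcon kap : ispart kap -> D kap -> controlled X kap by move=> pk _; exact: controlled_part.
have yD : inRs D y by apply/inRsP; exists mu; split=> //; exact: dom_refl.
have : inRs D x.
  apply: (leLR_absorb (R := R) (G := inRs D) _ _ lexy yD) => h y' x' y'D; apply: contraNT => x'D;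
    apply/eqP; apply: (support HX Dup Dcon _ x'D) => nu pn nD; rewrite (XXM HX) //;
    rewrite (inRs_kill Dup Dcon y'D pn nD) ?mulmx0 ?mul0mx //.
move=> /inRsP[kap [pk Dk xR']].
by rewrite (Rset_disj HX pl pk xR xR').
Qed.

(** Primeness puts [C y] between two copies of [Qs l] without killing it in [X_l]; rank one turns
    the result into a nonzero multiple of [X_l (Qs l)]. Multiplying by [zc l] removes all other
    representations, so an equality of matrices becomes one in the algebra. *)
Lemma wlong_below l y : ispart l -> XX l (C y) != 0 -> leLR R (wlong l) y.
Proof.
move=> pl nz; have Enz := Qs_nz HX pl; pose E := Qs l.
have [w hw] := XX_prime HX pl Enz nz; have [w' hw'] := XX_prime HX pl hw Enz.
have [c ec] := Qs_sandwich HX (XX l (T w * C y * T w')) pl.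
have es : XX l (E * T w * C y * T w' * E) = c *: XX l E.
  by rewrite -ec -!(XXM HX) // !mulrA.
have c0 : c != 0 by apply: contraNneq hw' => c0; rewrite es c0 scale0r.
pose h0 := zc X l * E.
have eh : zc X l * E * T w * C y * (T w' * E) = c *: h0.
  apply/eqP; rewrite -subr_eq0; apply/eqP; apply: (XX_faithful HX) => mu pm.
  rewrite XXD XXN XXZ; have -> : zc X l * E * T w * C y * (T w' * E) =
    zc X l * (E * T w * C y * T w' * E) by rewrite !mulrA.
  rewrite !(XXM HX (zc X l)) //; have [->|ne] := eqVneq mu l.
    by rewrite (XX_zc HX) // !mul1mx es subrr.
  by rewrite (XX_zc_neq HX) // !mul0mx scaler0 subrr.
pose D : Part n -> bool := sdom l.
have Dup kap nu : ispart kap -> ispart nu -> D kap -> dominates kap nu -> D nu.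
  move=> pk pn /andP[d1 ne] d2; rewrite /D /sdom (dom_trans d1 d2) /=.
  by apply: contraNneq ne => e; apply/eqP/dom_anti => //; rewrite e.
have Dcon kap : ispart kap -> D kap -> controlled X kap by move=> pk _; exact: controlled_part.
have wD : ~~ inRs D (wlong l).
  apply/inRsP=> -[kap [pk /andP[_ ne] wR]]; case/eqP: ne.
  by apply: (Rset_disj HX pl pk _ wR); exact: (wlong_Rset HX).
have hE : coC E (wlong l) != 0.
  have v0 : (- v) ^+ aval l != 0 by apply: expf_neq0; rewrite oppr_eq0; exact: v_neq0.
  have := coC_C R (wlong l) (wlong l); rewrite (C_wlong R l) coCZ eqxx => e.
  by apply/eqP=> z; move/eqP: e; rewrite z mulr0 eq_sym oner_eq0.
(* [zc l * E] and [E] differ by an element seen only by partitions strictly above [l], and [wlong l]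
   is not indexed by any of these. *)
have h00 : coC h0 (wlong l) = coC E (wlong l).
  have z : coC (h0 + -1 *: E) (wlong l) = 0.
    apply: (support HX Dup Dcon _ wD) => mu pm nD; rewrite scaleN1r XXD XXN (XXM HX) //.
    have [->|ne] := eqVneq mu l; first by rewrite (XX_zc HX) // mul1mx subrr.
    have -> : XX mu E = 0; last by rewrite mulmx0 subr0.
    apply: contraNeq nD => /(Qs_support HX pm pl) d.
    by rewrite /D /sdom d eq_sym.
  by move/eqP: z; rewrite coCD coCZ mulN1r subr_eq0 => /eqP.
apply: (leLR_closed (h := zc X l * E * T w) (h' := T w' * E)).
have e := etrans (congr1 (fun h => coC h (wlong l)) eh) (coCZ _ _ _).
have := mulf_neq0 c0 hE; rewrite -h00 -e; exact.
Qed.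

Lemma Rset_XX l y : ispart l -> y \in Rset l -> XX l (C y) != 0.
Proof.
move=> pl yR; have [i [j hy]] := RsetP X l y yR.
have [_ h] := lead_C HX y i j pl; apply: contraTneq hy => e.
by rewrite cco_neq0 -h e mxE mulr0 ct0 eqxx.
Qed.
End CellOrder.

(** * Positivity of Kostka numbers *)

Section Chain.
Variables (F : fieldType) (d : nat) (e t : F) (S : nat -> 'M[F]_d) (q : nat).
Hypothesis te : t * t = 1 + e * t.
Hypothesis quad : forall k, (k < q)%N -> S k *m S k = 1%:M + e *: S k.
Hypothesis braid : forall k, (k.+1 < q)%N ->
  S k *m S k.+1 *m S k = S k.+1 *m S k *m S k.+1.
Hypothesis far : forall k m, (k.+1 < m)%N -> (m < q)%N -> S k *m S m = S m *m S k.
Variable u : 'cV[F]_d.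
Hypothesis anti : forall k, (0 < k)%N -> (k < q)%N -> S k *m u = t *: u.

(** The vector [u] is sign-isotypic for [S 1, ..., S q.-1]. The chains apply the minimal
    representatives of the cosets of this parabolic in the one that also contains [S 0], and
    [chain_sum] is the corresponding antisymmetrisation. *)
Fixpoint chain k : 'cV[F]_d := if k is k'.+1 then S k' *m chain k' else u.
Definition chain_sum : 'cV[F]_d := \sum_(k < q.+1) t ^+ k *: chain k.

Lemma chain_far m k : (k < m)%N -> (m < q)%N -> S m *m chain k = t *: chain k.
Proof.
elim: k => [|k IH] km mq /=; first exact: anti.
rewrite mulmxA -far // -mulmxA IH ?scalemxAr //.
exact: ltnW.
Qed.

Lemma chain_above j k : (j.+1 < k)%N -> (k <= q)%N -> S j *m chain k = t *: chain k.
Proof.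
elim: k => // k IH; rewrite ltnS leq_eqVlt => /orP[/eqP<- jq|jk kq].
  rewrite /= 2!mulmxA braid // -2!mulmxA chain_far //.
  by rewrite -!scalemxAr.
rewrite /= mulmxA far // -mulmxA IH ?scalemxAr //; exact: ltnW.
Qed.

(** [S j] mixes only the terms [j] and [j.+1], which the quadratic relation handles as a pair; all
    other chains are already eigenvectors, by far commutation below and by the braid relation
    above. *)
Lemma chain_eig j : (j < q)%N -> S j *m chain_sum = t *: chain_sum.
Proof.
move=> jq; rewrite /chain_sum mulmx_sumr scaler_sumr.
pose j0 := Ordinal (ltnW jq : (j < q.+1)%N); pose j1 := Ordinal (jq : (j.+1 < q.+1)%N).
have ne : j1 != j0 by rewrite -val_eqE /= gtn_eqF.
rewrite (bigD1 j0) //= (bigD1 j1) //= [RHS](bigD1 j0) //= [X in _ = _ + X](bigD1 j1) //= !addrA.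
congr (_ + _).
  rewrite -!scalemxAr mulmxA quad // mulmxDl mul1mx -scalemxAl.
  have et : t * t ^+ j.+1 = t ^+ j + t ^+ j.+1 * e.
    by rewrite exprS mulrA te mulrDl mul1r -mulrA mulrC.
  move: (S j *m chain j) (chain j) => a b; rewrite !scalerA et exprS scalerDr scalerDl scalerA.
  by rewrite addrCA addrA.
apply: eq_bigr => k /andP[k0 k1]; rewrite -scalemxAr scalerA mulrC -scalerA; congr (_ *: _).
have [kj|jk] := ltnP k j; first exact: chain_far.
apply: chain_above; last by rewrite -ltnS.
by move: k0 k1; rewrite -!val_eqE /= => /eqP h1 /eqP h2; lia.
Qed.

Lemma chain_comm (M : 'M[F]_d) : M *m u = t *: u -> (forall k, (k < q)%N -> M *m S k = S k *m M) ->
  M *m chain_sum = t *: chain_sum.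
Proof.
move=> Mu com; have Mc k : (k <= q)%N -> M *m chain k = t *: chain k.
  elim: k => [|k IH] kq //=.
  by rewrite mulmxA com // -mulmxA IH ?scalemxAr // ltnW.
rewrite /chain_sum mulmx_sumr scaler_sumr; apply: eq_bigr => k _.
by rewrite -scalemxAr Mc ?scalerA 1?mulrC // -ltnS.
Qed.

Variable p : 'I_d -> F.
Definition form (a b : 'cV[F]_d) : F := \sum_i p i * (a i 0 * b i 0).
Hypothesis adjoint : forall k a b, (k < q)%N -> form (S k *m a) b = form a (S k *m b).

Lemma formZr a (c : F) b : form a (c *: b) = c * form a b.
Proof.
by rewrite /form mulr_sumr; apply: eq_bigr => i _; rewrite mxE; ring.
Qed.
Lemma formC a b : form a b = form b a.
Proof. by apply: eq_bigr => i _; rewrite [a i 0 * _]mulrC. Qed.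
Lemma formZl a (c : F) b : form (c *: a) b = c * form a b.
Proof. by rewrite formC formZr formC. Qed.
Lemma form_sumr a (I : Type) (r : seq I) (P : pred I) (f : I -> 'cV[F]_d) :
  form a (\sum_(i <- r | P i) f i) = \sum_(i <- r | P i) form a (f i).
Proof.
rewrite /form exchange_big; apply: eq_bigr => i _ /=.
by rewrite summxE !mulr_sumr.
Qed.

(** Self-adjointness moves the [S k] across the form onto eigenvectors. The norm thus depends only
    on [q], on the norm of [u] and on the pairing of [u] with [S 0 *m u], which makes chains in two
    directions comparable. *)
Lemma form_chain : form chain_sum chain_sum =
  (\sum_(k < q.+1) t ^+ (2 * k)) *
  (form u u + (\sum_(k < q) t ^+ (2 * k)) * (t * form u (S 0 *m u))).
Proof.
have h k : (k <= q)%N -> form (chain k) chain_sum = t ^+ k * form u chain_sum.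
  elim: k => [|k IH] kq; first by rewrite mul1r.
  by rewrite /= adjoint // chain_eig // formZr IH 1?ltnW // mulrA -exprS.
transitivity ((\sum_(k < q.+1) t ^+ (2 * k)) * form u chain_sum).
  rewrite {1}/chain_sum formC form_sumr mulr_suml; apply: eq_bigr => k _.
  rewrite formZr formC h; last by rewrite -ltnS.
  by rewrite mulrA -exprD addnn -mul2n.
congr (_ * _); rewrite /chain_sum form_sumr big_ord_recl expr0 scale1r; congr (_ + _).
rewrite mulr_suml; apply: eq_bigr => k _; rewrite formZr lift0.
have -> : form u (chain k.+1) = t ^+ k * form u (S 0 *m u).
  case: k => k /=; elim: k => [|k IH] kq; first by rewrite mul1r.
  by rewrite -adjoint // anti // formZl IH 1?ltnW // mulrA -exprS.
by rewrite mul2n -addnn exprS exprD; ring.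
Qed.
End Chain.

(** * Braid and commutation relations of the generators *)

Section AdjacentTranspositions.
Variables (R : realType) (n : nat).
Local Notation H := (hecke R n).
Local Notation T := (@T R n).
Implicit Types (i j k m : 'I_n) (g : nat).

(** Generators are numbered by their larger point, so that [adjt g] joins two blocks exactly when
    [g] is the end of a block in the sense of [psum]. Out of range it is the identity. *)
Definition adjt g : 'S_n :=
  if insub g.-1 is Some i then if insub g is Some j then tperm (i : 'I_n) j else 1%g else 1%g.

Lemma adjtE i j : adj i j -> adjt j = tperm i j.
Proof. by move=> /eqP e; rewrite /adjt {1}e /= !valK. Qed.

Lemma adjtP g : (0 < g)%N -> (g < n)%N ->
  exists i j, [/\ adj i j, (j : nat) = g & adjt g = tperm i j].
Proof.
move=> g0 gn; have hi : (g.-1 < n)%N by apply: leq_ltn_trans (leq_pred _) gn.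
exists (Ordinal hi), (Ordinal gn); have aij : adj (Ordinal hi) (Ordinal gn) by rewrite /adj /= prednK.
by split=> //; rewrite -(adjtE aij).
Qed.

Lemma adjt_Sgen g : (0 < g)%N -> (g < n)%N -> adjt g \in Sgen n.
Proof. by move=> g0 gn; have [i [j [aij _ ->]]] := adjtP g0 gn; apply/SgenP; exists i, j. Qed.

Lemma T_adj_mul i j (w : 'S_n) : adj i j -> (w i <= w j)%N -> T (tperm i j) * T w = T (tperm i j * w)%g.
Proof.
move=> aij le; apply: TsM; first by apply/SgenP; exists i, j.
by rewrite descE // -leqNgt.
Qed.

Lemma T_braid g : (0 < g)%N -> (g.+1 < n)%N ->
  T (adjt g) * T (adjt g.+1) * T (adjt g) = T (adjt g.+1) * T (adjt g) * T (adjt g.+1).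
Proof.
move=> g0 gn; have [i [j [aij ej ->]]] := adjtP g0 (ltnW gn).
have [j' [k [ajk ek ->]]] := adjtP (ltn0Sn g) gn.
have ejj : j' = j by apply: val_inj; move/eqP: ajk; rewrite ek /= ej => -[].
subst j'; move: (aij) (ajk) => /eqP e1 /eqP e2.
have ij : i != j by rewrite -val_eqE /= e1 neq_ltn ltnSn.
have jk : j != k by rewrite -val_eqE /= e2 neq_ltn ltnSn.
have ik : i != k by rewrite -val_eqE /= e2 e1 neq_ltn leqnSn.
have tki : tperm i j k = k by rewrite tpermD // eq_sym.
have tik : tperm j k i = i by rewrite tpermD // eq_sym.
have perm_eq : (tperm i j * (tperm j k * tperm i j) = tperm j k * (tperm i j * tperm j k))%g.
  have -> : (tperm i j * (tperm j k * tperm i j) = tperm i k)%g.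
    by have := tpermJ j k (tperm i j); rewrite tpermR tki /conjg tpermV.
  have := tpermJ i j (tperm j k); rewrite tpermL tik /conjg tpermV => ->.
  by [].
have lij : (i <= j)%N by rewrite e1.
have ljk : (j <= k)%N by rewrite e2.
have lik := leq_trans lij ljk.
have h1 : T (tperm j k) * T (tperm i j) = T (tperm j k * tperm i j)%g.
  by apply: T_adj_mul => //; rewrite tpermR tki.
have h2 : T (tperm i j) * T (tperm j k) = T (tperm i j * tperm j k)%g.
  by apply: T_adj_mul => //; rewrite tpermL tik.
rewrite -!mulrA h1 h2 (T_adj_mul (i := i)) ?(T_adj_mul (i := j)) ?perm_eq //.
  by rewrite !permM tpermR tik tki tpermR.
by rewrite !permM tpermL tik tki tpermL.
Qed.

Lemma T_far g g' : (0 < g)%N -> (g.+1 < g')%N -> (g' < n)%N ->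
  T (adjt g) * T (adjt g') = T (adjt g') * T (adjt g).
Proof.
move=> g0 gg' gn; have gn' : (g < n)%N by apply: ltn_trans gn; apply: ltn_trans gg'.
have g'0 : (0 < g')%N by apply: ltn_trans gg'.
have [i [j [aij ej ->]]] := adjtP g0 gn'.
have [k [m [akm em ->]]] := adjtP g'0 gn.
move: (aij) (akm) => /eqP e1 /eqP e2.
have d (x y : 'I_n) : (x < y)%N -> (x != y) && (y != x) by rewrite -!val_eqE /=; lia.
have /andP[ik ki] : (i != k) && (k != i) by apply: d; lia.
have /andP[im mi] : (i != m) && (m != i) by apply: d; lia.
have /andP[jk kj] : (j != k) && (k != j) by apply: d; lia.
have /andP[jm mj] : (j != m) && (m != j) by apply: d; lia.
have lij : (i <= j)%N by rewrite e1.
have lkm : (k <= m)%N by rewrite e2.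
rewrite (T_adj_mul (i := i)) ?(T_adj_mul (i := k)) ?(tpermD ik jk) ?(tpermD im jm) ?(tpermD ki mi)
  ?(tpermD kj mj) //.
congr (T _); have := tpermJ k m (tperm i j).
rewrite !tpermD // /conjg tpermV => e.
by rewrite -{1}e !mulgA tperm2 mul1g.
Qed.
End AdjacentTranspositions.

(** * Positive scalars and weighted sums of squares *)

Section Positivity.
Variable R : realType.
Local Notation F := (K R).
Local Notation v := (vK R).
Implicit Types (c : F).

(** Up to an even power of [v], an element with constant term 1. The even power can be absorbed into
    a square, so such a factor acts as a positive weight. *)
Definition posform c := exists a m, [/\ inO a, ct a = 1 & c = a * (v ^- m) ^+ 2].

Lemma posformM c c' : posform c -> posform c' -> posform (c * c').
Proof.
move=> [a [m [aO a1 ->]]] [a' [m' [aO' a1' ->]]]; exists (a * a'), (m + m')%N; split.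
- exact: inOM.
- by rewrite ctM // a1 a1' mulr1.
by rewrite exprD invfM exprMn mulrACA.
Qed.

Lemma posform_neq0 c : posform c -> c != 0.
Proof.
move=> [a [m [aO a1 ->]]]; apply: mulf_neq0; first exact: ct1_neq0.
by apply: expf_neq0; rewrite invr_eq0; exact: vX_neq0.
Qed.

Lemma posform_sum (D : nat) (p : 'I_D -> F) c c' (y u : 'cV[F]_D) :
  (forall i, inO (p i)) -> (forall i, ct (p i) = 1) -> posform c -> posform c' ->
  c * form p y y + c' * form p u u = 0 -> u = 0.
Proof.
move=> pO p1 [a [m [aO a1 ->]]] [a' [m' [aO' a1' ->]]] e.
pose w (x : 'I_D + 'I_D) : F := match x with inl i => a * p i | inr i => a' * p i end.
pose f (x : 'I_D + 'I_D) : F :=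
  match x with inl i => v ^- m * y i 0 | inr i => v ^- m' * u i 0 end.
have wO x : inO (w x) by case: x => i; apply: inOM.
have w1 x : ct (w x) = 1 by case: x => i; rewrite /w ctM // ?a1 ?a1' p1 mulr1.
have s0 : \sum_x w x * f x ^+ 2 = 0.
  rewrite big_sumType /= -[RHS]e /form; congr (_ + _);
    rewrite mulr_sumr; apply: eq_bigr => i _; rewrite exprMn expr2.
    by move: (v ^- m) => b; ring.
  by move: (v ^- m') => b; ring.
apply/matrixP=> i j; rewrite ord1 mxE.
have /eqP := sumsq_eq0 wO w1 s0 (inr i); rewrite /f mulf_eq0 invr_eq0 (negPf (vX_neq0 R m')).
by move/eqP.
Qed.

(** A quantum integer in [v^-2]; these are the factors in the norm formula [form_chain] for
    [t = - v^-1]. *)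
Definition geo m : F := \sum_(k < m) (- v^-1) ^+ (2 * k).

Lemma sqr_t k : (- v^-1) ^+ (2 * k) = (v ^- k) ^+ 2.
Proof. by rewrite exprM sqrrN -exprM mulnC exprM -exprVn. Qed.

Lemma posform_t k : posform ((- v^-1) ^+ (2 * k)).
Proof.
exists 1, k; split; [exact: inO1|exact: ct1|].
by rewrite mul1r sqr_t.
Qed.

Lemma posform_geo m : posform (geo m.+1).
Proof.
have v0 k : v ^+ k != 0 by exact: vX_neq0.
exists ((v ^+ m) ^+ 2 * geo m.+1), m.
have e0 : (v ^+ m) ^+ 2 * (v ^- m) ^+ 2 = 1 by rewrite -exprMn (mulfV (v0 m)) expr1n.
have [h1 h2] : inO ((v ^+ m) ^+ 2 * geo m.+1) /\ ct ((v ^+ m) ^+ 2 * geo m.+1) = 1.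
  elim: m {e0} => [|m [h1 h2]].
    rewrite /geo big_ord1 muln0 !expr0 expr1n mulr1; split; [exact: inO1|exact: ct1].
  have -> : (v ^+ m.+1) ^+ 2 * geo m.+2 = v ^+ 2 * ((v ^+ m) ^+ 2 * geo m.+1) + 1.
    rewrite {1}/geo big_ord_recr /= -/(geo m.+1) mulrDr; congr (_ + _).
      by rewrite [v ^+ m.+1]exprS exprMn mulrA.
    by rewrite sqr_t -exprMn (mulfV (v0 _)) expr1n.
  have h3 : inO (v ^+ 2 * ((v ^+ m) ^+ 2 * geo m.+1)) by apply: inOM => //; exact: inOXv.
  split; first by apply: inOD => //; exact: inO1.
  by rewrite ctD ?ct1 ?ct_vM ?add0r //; exact: inO1.
by split=> //; rewrite mulrAC e0 mul1r.
Qed.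

Lemma geoD q d : geo (q + d) = geo q + (- v^-1) ^+ (2 * q) * geo d.
Proof.
rewrite /geo big_split_ord /=; congr (_ + _); rewrite mulr_sumr; apply: eq_bigr => k _.
by rewrite mulnDr exprD.
Qed.

(* The two antisymmetrisations have norms [geo k.+1 * (N + geo k * a)] for [k = q, r], with the same
   [N = form p u u] and [a]: if the first one vanishes, the norm of the other is minus a positive
   multiple of [N]. *)
Lemma two_chains (D : nat) (p : 'I_D -> F) (S S' : nat -> 'M[F]_D) (q r : nat) (u : 'cV[F]_D) :
  (forall i, inO (p i)) -> (forall i, ct (p i) = 1) -> (0 < q)%N -> (q < r)%N -> S' 0 = S 0 ->
  form p (chain_sum (- v^-1) S q u) (chain_sum (- v^-1) S q u) =
    geo q.+1 * (form p u u + geo q * (- v^-1 * form p u (S 0 *m u))) ->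
  form p (chain_sum (- v^-1) S' r u) (chain_sum (- v^-1) S' r u) =
    geo r.+1 * (form p u u + geo r * (- v^-1 * form p u (S' 0 *m u))) ->
  chain_sum (- v^-1) S q u = 0 -> u = 0.
Proof.
move=> pO p1 q0 qr e0 ex ey x0.
have [d ed] : exists d, r = (q + d.+1)%N by exists (r - q).-1; lia.
have [q' eq'] : exists q', q = q'.+1 by exists q.-1; lia.
rewrite e0 in ey; move: ex; rewrite x0.
have -> : form p (0 : 'cV[F]_D) 0 = 0 by rewrite /form big1 // => i _; rewrite mxE mul0r mulr0.
move/esym/eqP; rewrite mulf_eq0 (negPf (posform_neq0 (posform_geo q))) /= => /eqP ex.
apply: (@posform_sum _ p (geo q) (geo r.+1 * ((- v^-1) ^+ (2 * q) * geo d.+1))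
  (chain_sum (- v^-1) S' r u)) => //.
- by rewrite eq'; exact: posform_geo.
- by apply: posformM; [exact: posform_geo|apply: posformM; [exact: posform_t|exact: posform_geo]].
rewrite ey ed geoD; move: ex; set s := - v^-1 * _.
move: (geo q) (geo d.+1) (geo _.+1) ((- v^-1) ^+ (2 * q)) (form p u u) (s) => a b c f N w e.
have -> : N = - (a * w) by apply/eqP; rewrite -addr_eq0; apply/eqP.
ring.
Qed.
End Positivity.

(** * Moving sign-isotypic vectors down the dominance order *)

Section Kostka.
Variables (R : realType) (n : nat).
Variable dim : Part n -> nat.
Variable X : forall l : Part n, 'S_n -> 'M[K R]_(dim l).
Hypothesis HX : chosen_reps X.
Variable l : Part n.
Hypothesis pl : ispart l.
Local Notation F := (K R).
Local Notation v := (vK R).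
Local Notation T := (@T R n).
Local Notation Qs := (@Qs R n).
Local Notation ps := (@ps R n).
Local Notation XX := (XX X).
Local Notation t := (- v^-1).
Implicit Types (A : nat -> nat) (u : 'cV[F]_(dim l)).

Definition Xs g : 'M[F]_(dim l) := X l (adjt n g).
Definition wp : 'I_(dim l) -> F := @pw R n dim X l.

Lemma Xs_quad g : (0 < g)%N -> (g < n)%N -> Xs g *m Xs g = 1%:M + (v - v^-1) *: Xs g.
Proof.
move=> g0 gn; have := congr1 (XX l) (Ts2 R (adjt_Sgen g0 gn)).
by rewrite (XXM HX) // XXD XXZ (XX1 HX) // !XXT.
Qed.

Lemma Xs_braid g : (0 < g)%N -> (g.+1 < n)%N ->
  Xs g *m Xs g.+1 *m Xs g = Xs g.+1 *m Xs g *m Xs g.+1.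
Proof.
by move=> g0 gn; have := congr1 (XX l) (T_braid R g0 gn); rewrite !(XXM HX) // !XXT.
Qed.

Lemma Xs_far g g' : (0 < g)%N -> (g.+1 < g')%N -> (g' < n)%N -> Xs g *m Xs g' = Xs g' *m Xs g.
Proof.
by move=> g0 gg gn; have := congr1 (XX l) (T_far R g0 gg gn); rewrite !(XXM HX) // !XXT.
Qed.

Lemma Xs_adj g (a b : 'cV[F]_(dim l)) : (0 < g)%N -> (g < n)%N ->
  form wp (Xs g *m a) b = form wp a (Xs g *m b).
Proof.
move=> g0 gn; have [_ p1 e] := pwP HX pl.
have sym i j : wp i * Xs g i j = Xs g j i * wp j.
  have wi : wp i != 0 by apply: ct1_neq0; exact: p1.
  have := e (adjt n g) i j; rewrite (sgenV (adjt_Sgen g0 gn)) -/(Xs g) -/(wp i) -/(wp j) => ->.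
  by rewrite !mulrA (mulfV wi) mul1r.
transitivity (\sum_i \sum_j wp i * Xs g i j * (a j 0 * b i 0)).
  apply: eq_bigr => i _; rewrite mxE mulr_suml mulr_sumr; apply: eq_bigr => j _.
  by rewrite !mulrA.
rewrite exchange_big; apply: eq_bigr => j _ /=.
rewrite mxE !mulr_sumr; apply: eq_bigr => i _.
by rewrite sym; ring.
Qed.

(** [u] is sign-isotypic for the Young subgroup whose blocks end at the values of [A]. General [A]
    are allowed because the intermediate shapes need only be compositions. *)
Definition fixedA A u := forall g, (0 < g)%N -> (g < n)%N ->
  (forall r, (r < n)%N -> g != A r.+1) -> Xs g *m u = t *: u.

(** One box moves from a block of size [p] to the next one, of size [q < p], by antisymmetrising [u]
    upwards from their common border [g0]. The downward chain [S'] serves only to show that the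
    result is nonzero: if it vanished, [two_chains] would force [u = 0]. *)
Lemma fixed_step A r u : (forall i j, (i <= j)%N -> (A i <= A j)%N) -> A n = n -> (r.+1 < n)%N ->
  (A r.+2 + A r < A r.+1 + A r.+1)%N -> u != 0 -> fixedA A u ->
  exists2 u', u' != 0 & fixedA (fun k => A k - (k == r.+1))%N u'.
Proof.
move=> Am An rn conc u0 hu.
have Ale i : (i <= n)%N -> (A i <= n)%N by move=> /Am; rewrite An.
have hr := Am r r.+1 (leqnSn _); have hr2 := Am r.+1 r.+2 (leqnSn _); have hn := Ale _ rn.
have A'E k : k != r.+1 -> (A k - (k == r.+1))%N = A k by move=> /negPf->; rewrite subn0.
have A'2 : (A r.+2 - (r.+2 == r.+1))%N = A r.+2 by apply: A'E; rewrite gtn_eqF.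
pose q := (A r.+2 - A r.+1)%N; pose p := (A r.+1 - A r)%N.
have qp : (q < p)%N by rewrite /q /p; lia.
(* If the receiving block is empty it becomes a single box, which imposes no condition, and [u]
   itself works. *)
have [q0|q0] := posnP q.
  exists u => // g g0 gn hg; apply: hu => // r0 r0n.
  have [e|ne] := eqVneq r0 r; last by have := hg r0 r0n; rewrite A'E.
  by have := hg _ rn; rewrite A'2 e; move: q0; rewrite /q; lia.
pose g0 := A r.+1; pose S k := Xs (g0 + k); pose S' k := Xs (g0 - k).
have Sb k : (k < q)%N -> (0 < g0 + k)%N /\ (g0 + k < n)%N by rewrite /g0 /q; lia.
have Sb' k : (k < p)%N -> (0 < g0 - k)%N /\ (g0 - k < n)%N by rewrite /g0 /p; lia.
have Santi k : (0 < k)%N -> (k < q)%N -> S k *m u = t *: u.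
  move=> k0 kq; have [b1 b2] := Sb k kq; apply: hu => // r0 r0n.
  by have [h|h] := leqP r0 r; have := Am r0.+1 r.+1; have := Am r.+2 r0.+1; move: kq; rewrite /q /g0; lia.
have Santi' k : (0 < k)%N -> (k < p)%N -> S' k *m u = t *: u.
  move=> k0 kp; have [b1 b2] := Sb' k kp; apply: hu => // r0 r0n.
  by have [h|h] := leqP r r0; have := Am r.+1 r0.+1; have := Am r0.+1 r; move: kp; rewrite /p /g0; lia.
have te : t * t = 1 + (v - v^-1) * t := hqm R.
have quad k : (k < q)%N -> S k *m S k = 1%:M + (v - v^-1) *: S k.
  by move=> /Sb[b1 b2]; exact: Xs_quad.
have quad' k : (k < p)%N -> S' k *m S' k = 1%:M + (v - v^-1) *: S' k.
  by move=> /Sb'[b1 b2]; exact: Xs_quad.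
have braid k : (k.+1 < q)%N -> S k *m S k.+1 *m S k = S k.+1 *m S k *m S k.+1.
  move=> kq; have [b1 b2] := Sb _ kq; rewrite /S addnS; apply: Xs_braid; last by rewrite -addnS.
  by have [] := Sb k (ltnW kq).
have braid' k : (k.+1 < p)%N -> S' k *m S' k.+1 *m S' k = S' k.+1 *m S' k *m S' k.+1.
  move=> kp; have [b1 b2] := Sb' _ kp; have [b3 b4] := Sb' k (ltnW kp); rewrite /S'.
  have -> : (g0 - k = (g0 - k.+1).+1)%N by lia.
  by symmetry; apply: Xs_braid => //; lia.
have far k m : (k.+1 < m)%N -> (m < q)%N -> S k *m S m = S m *m S k.
  move=> km mq; have [b1 b2] := Sb m mq; apply: Xs_far => //; last by lia.
  by have [] := Sb k; lia.
have far' k m : (k.+1 < m)%N -> (m < p)%N -> S' k *m S' m = S' m *m S' k.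
  move=> km mp; have [b1 b2] := Sb' m mp; symmetry; apply: Xs_far => //; last first.
    by have [] := Sb' k; lia.
  by lia.
have adj_S k a b : (k < q)%N -> form wp (S k *m a) b = form wp a (S k *m b).
  by move=> /Sb[b1 b2]; exact: Xs_adj.
have adj_S' k a b : (k < p)%N -> form wp (S' k *m a) b = form wp a (S' k *m b).
  by move=> /Sb'[b1 b2]; exact: Xs_adj.
have [pO p1 _] := pwP HX pl.
exists (chain_sum t S q u).
  apply: contraNneq u0 => x0; apply/eqP.
  apply: (two_chains (p := wp) (S := S) (S' := S') pO p1 q0 qp _ _ _ x0).
  - by rewrite /S /S' addn0 subn0.
  - exact: (form_chain te quad braid far Santi adj_S).
  - exact: (form_chain te quad' braid' far' Santi' adj_S').
move=> g gg gn hg; have [hin|hout] := boolP ((g0 <= g) && (g < g0 + q))%N.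
  have -> : Xs g = S (g - g0)%N by rewrite /S subnKC //; case/andP: hin.
  by apply: (chain_eig te quad braid far Santi); move: hin; lia.
(* The generators [g0 - 1] and [A r.+2], the borders of the enlarged block, are excluded; all
   remaining ones are at distance at least 2 from the chain and commute with it. *)
have g1 := hg r (ltnW rn); have g2 := hg r.+1 rn; rewrite eqxx in g1.
rewrite A'2 in g2.
apply: chain_comm => [|k kq].
  apply: hu => // r0 r0n; have [e|ne] := eqVneq r0 r; last by have := hg r0 r0n; rewrite A'E.
  by rewrite e; move: hout; rewrite -/g0; lia.
have [b1 b2] := Sb k kq; have [h|h] := ltnP g g0.
  by apply: Xs_far => //; move: g1; rewrite -/g0; lia.
by symmetry; apply: Xs_far => //; move: hout g2 kq; rewrite /q /g0; lia.
Qed.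

(** Lower [A] at the first place where [A - M] is maximal. There [A - M] rises strictly before and
    does not rise after, while [M] is concave; so [A] is strictly concave at that place, as
    [fixed_step] requires. The total excess of [A] over [M] drops at each step. *)
Lemma fixed_descend (M : nat -> nat) A u : M 0 = 0%N -> M n = n ->
  (forall r, (r.+1 < n)%N -> (M r.+2 + M r <= M r.+1 + M r.+1)%N) ->
  (forall i j, (i <= j)%N -> (A i <= A j)%N) -> A 0 = 0%N -> A n = n ->
  (forall k, (k <= n)%N -> (M k <= A k)%N) ->
  u != 0 -> fixedA A u -> exists2 u', u' != 0 & fixedA M u'.
Proof.
move=> M0 Mn Mc; have [m] := ubnP (\sum_(k < n.+1) (A k - M k))%N.
elim: m A u => // m IH A u hm Am A0 An MA u0 hu.
have [d0|dn] := boolP [forall k : 'I_n.+1, A k == M k].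
  exists u => // g g0 gn hg; apply: hu => // r rn.
  by have /eqP := forallP d0 (Ordinal (rn : (r.+1 < n.+1)%N)) => /= ->; exact: hg.
pose D k := (A k - M k)%N.
have [k0 hk0] : exists k : 'I_n.+1, forall i : 'I_n.+1, (D i <= D k)%N.
  case: (arg_maxnP (fun k : 'I_n.+1 => D k) (erefl (xpredT (ord0 : 'I_n.+1)))) => k _ h.
  by exists k => i; exact: h.
have ex : exists k, (k <= n)%N && (D k == D k0).
  by exists k0; rewrite eqxx andbT -ltnS ltn_ord.
have [k /andP[kn /eqP ek] kmin] := ex_minnP ex.
have Dmax i : (i <= n)%N -> (D i <= D k)%N by rewrite ek => h; exact: (hk0 (Ordinal (h : (i < n.+1)%N))).
have Dpos : (0 < D k)%N.
  move: dn; rewrite negb_forall => /existsP[i ne].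
  apply: leq_trans (Dmax i _); last by rewrite -ltnS ltn_ord.
  by rewrite /D subn_gt0 ltn_neqAle eq_sym ne MA // -ltnS ltn_ord.
case: k kn ek kmin Dmax Dpos => [|r] rn ek kmin Dmax Dpos; first by rewrite /D A0 M0 in Dpos.
have rn' : (r.+1 < n)%N.
  by rewrite ltn_neqAle rn andbT; apply: contraTneq Dpos => e; rewrite /D e An Mn subnn.
have Dr : (D r < D r.+1)%N.
  rewrite ltn_neqAle Dmax ?(ltnW rn) // andbT; apply/eqP=> e.
  by have := kmin r; rewrite (ltnW rn) -ek e eqxx ltnn => /(_ isT).
have Dr2 := Dmax _ rn'.
have MA0 := MA r (ltnW rn); have MA1 := MA _ rn; have MA2 := MA _ rn'; have Mc' := Mc r rn'.
have conc : (A r.+2 + A r < A r.+1 + A r.+1)%N by move: Dr Dr2 Mc' MA0 MA1 MA2; rewrite /D; lia.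
have [u' u'0 hu'] := fixed_step Am An rn' conc u0 hu.
apply: (IH _ u' _ _ _ _ _ u'0 hu') => [|i j ij| | |k kn].
- pose r1 := Ordinal (rn : (r.+1 < n.+1)%N).
  rewrite (bigD1 r1) //= eqxx; move: hm; rewrite (bigD1 r1) //=.
  set a := (\sum_(i < n.+1 | i != r1) (A i - M i))%N.
  rewrite (_ : (\sum_(i < n.+1 | i != r1) _)%N = a); first by move: Dpos; rewrite /D; lia.
  by apply: eq_bigr => i ne; rewrite -val_eqE /= in ne; rewrite (negPf ne) subn0.
- have [ej|nj] := eqVneq j r.+1; last first.
    by rewrite subn0; apply: leq_trans (leq_subr _ _) (Am _ _ ij).
  have [ei|ni] := eqVneq i r.+1; first by rewrite ej ei.
  have ir : (i <= r)%N by lia.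
  have h1 := Am i r ir; have h2 := Am r.+1 r.+2 (leqnSn _).
  by rewrite ej /= subn0 subn1; move: conc h1 h2; lia.
- by rewrite A0.
- by rewrite An gtn_eqF ?subn0.
have [->|ne] := eqVneq k r.+1; last by rewrite subn0 MA.
by move: Dpos; rewrite /D; lia.
Qed.

Lemma fixed_bgens A u s : fixedA A u -> s \in bgens (@blk n A) -> X l s *m u = t *: u.
Proof.
move=> hu /bgensP[i [j [aij bij ->]]]; rewrite -(adjtE aij); apply: hu => //.
  by move/eqP: aij => ->.
move=> r rn; move/eqP: bij; rewrite blk_adj // negb_exists => /forallP h.
exact: (h (Ordinal rn)).
Qed.

Lemma fixed_bgrp (b : 'I_n -> nat) u w : (forall i j : 'I_n, (i <= j)%N -> (b i <= b j)%N) ->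
  (forall s, s \in bgens b -> X l s *m u = t *: u) ->
  w \in bgrp b -> X l w *m u = t ^+ len w *: u.
Proof.
move=> bm hs; have [m] := ubnP (len w); elim: m w => // m IH w hm wW.
have [->|w1] := eqVneq w 1%g; first by rewrite -XXT T1 (XX1 HX) // mul1mx len1 scale1r.
have [s sb ds] := bgrp_desc bm wW w1; have sS := bgens_Sgen sb.
have lw := len_desc sS ds.
have a : ~~ desc s (s * w)%g by rewrite desc_mul // ds.
rewrite -{1}(sgenK w sS) -XXT -(TsM R sS a) (XXM HX) // !XXT -mulmxA IH.
- by rewrite -scalemxAr hs // scalerA lw exprSr.
- by lia.
by rewrite groupM // bgens_bgrp.
Qed.

(** A nonzero column of [X_l (Qs l)] is sign-isotypic for [l]. Descending to [mu] gives a nonzero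
    vector on which [Qs mu] acts by the nonzero scalar [ps mu]. *)
Lemma kostka mu : ispart mu -> dominates mu l -> XX l (Qs mu) != 0.
Proof.
move=> pm dm; have nz := Qs_nz HX pl.
have [j uj] : exists j, col j (XX l (Qs l)) != 0.
  apply/existsP; rewrite -[X in is_true X]negbK negb_exists; apply: contra nz => /forallP z.
  apply/eqP/matrixP=> i j; rewrite [RHS]mxE; have := z j; rewrite negbK => /eqP/matrixP/(_ i 0).
  by rewrite !mxE.
have hu : fixedA (psum l) (col j (XX l (Qs l))).
  move=> g g0 gn hg; have [i [k [aik ek eg]]] := adjtP g0 gn.
  have sb : tperm i k \in bgens (bpart l).
    apply/bgensP; exists i, k; split=> //; apply/eqP; rewrite blk_adj // negb_exists.
    by apply/forallP=> r; rewrite ek; exact: hg.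
  have := congr1 (XX l) (TsQ (hqm R) sb); rewrite (XXM HX) // XXZ XXT /Xs eg colE mulmxA => ->.
  by rewrite scalemxAl.
have [u u0 {}hu] : exists2 u, u != 0 & fixedA (psum mu) u.
  apply: (fixed_descend (A := psum l) _ _ _ _ _ _ _ uj hu).
  - exact: psum0.
  - exact: psum_n.
  - move=> r rn; rewrite (psumS mu rn) (psumS mu (ltnW rn)).
    have := part_mono (i := Ordinal (ltnW rn)) (j := Ordinal rn) pm (leqnSn r).
    by lia.
  - exact: psum_mono.
  - exact: psum0.
  - exact: psum_n.
  - by move=> k kn; exact: (domP dm).
have Xu s : s \in bgens (bpart mu) -> X l s *m u = t *: u by exact: fixed_bgens.
apply: contraNneq u0 => z; apply/eqP; apply: (scalerI (ps_neq0 R mu)); rewrite scaler0.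
have QX : XX l (Qs mu) *m u = ps mu *: u.
  rewrite /Qs /Qm Q_sum XX_sum mulmx_suml /ps /pm /pQ scaler_suml.
  apply: eq_bigr => w wW; rewrite XXZ XXT -scalemxAl (fixed_bgrp (@bpart_mono n mu) Xu wW).
  by rewrite scalerA expr2.
by rewrite -QX z mul0mx.
Qed.
End Kostka.

Theorem theorem5p1 (R : realType) (n : nat) (dim : Part n -> nat)
  (X : forall l : Part n, 'S_n -> 'M[K R]_(dim l))
  (HX : chosen_reps X) :
  (forall (l mu : Part n) (x y : 'S_n), ispart l -> ispart mu ->
      x \in Rset X l -> y \in Rset X mu -> (leLR R x y <-> dominates mu l)) /\
  (forall l mu : Part n, ispart l -> ispart mu ->
      (leLR R (wlong l) (wlong mu) <-> dominates mu l)) /\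
  (forall C : {set 'S_n},
      (exists x, C = LRcell R x) <-> (exists l, ispart l /\ C = Rset X l)).
Proof.
have below l mu x y : ispart l -> ispart mu -> x \in Rset X l -> y \in Rset X mu ->
    dominates mu l -> leLR R x y.
  (* The path goes from [x] to [wlong l], then to [wlong mu], then to [y]. The middle step needs
     that [X_l] does not kill [C (wlong mu)], which is [kostka]. *)
  move=> pl pm xR yR dm.
  have [_ top] := cell_structure HX pl.
  apply: leLR_trans (top x xR) _; apply: (@leLR_trans R n _ (wlong mu)).
    apply: (wlong_below HX pl); rewrite C_wlong XXZ scaler_eq0 negb_or (kostka HX pl pm dm) andbT.
    by apply: expf_neq0; rewrite oppr_eq0; exact: v_neq0.
  by apply: (wlong_below HX pm); exact: (Rset_XX HX).
have order l mu x y : ispart l -> ispart mu -> x \in Rset X l -> y \in Rset X mu ->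
    leLR R x y <-> dominates mu l.
  by move=> pl pm xR yR; split; [exact: (leLR_dom HX)|exact: below].
have cell l x : ispart l -> x \in Rset X l -> LRcell R x = Rset X l.
  move=> pl xR; apply/setP=> y; rewrite inE.
  have [mu pm yR] := Rset_cover HX y; apply/idP/idP => [/andP[h1 h2]|yR'].
    suff -> : l = mu by [].
    by apply: dom_anti; [exact: (leLR_dom HX pm pl yR xR)|exact: (leLR_dom HX pl pm xR yR)].
  by apply/andP; split; apply: (below l l) => //; exact: dom_refl.
split; first exact: order.
split=> [l mu pl pm|D]; first by apply: order => //; exact: (wlong_Rset HX).
split=> [[x ->]|[l [pl ->]]].
  by have [l pl xR] := Rset_cover HX x; exists l; split; last exact: cell.
by exists (wlong l); rewrite (cell l) //; exact: (wlong_Rset HX).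
Qed.
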